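(* Let $\mathcal{M}=\{Z\in\mathbb{C}^{N\times N}: Z=Z^t,\ ZZ^*<1\}$, viewed as an open subset of $\mathbb{C}^{N(N+1)/2}$ with coordinates $Z_{ij}$, $i\le j$, and its natural complex structure. For $Z\in\mathcal{M}$ let $\psi_Z=\det(1-ZZ^* )^{1/4}e^{-\frac12(a^*,Za^* )}\psi_0$; this is the normalized $N$-mode squeezed state satisfying $(a_i+\sum_jZ_{ij}a_j^* )\psi_Z=0$ for all $i$. Let $P_Z=|\psi_Z\rangle\langle\psi_Z|$. Then $(\mathcal{M},g,\omega)$ is a Kähler manifold with Hermitian structure $$h=\operatorname{tr}\bigl((1-ZZ^* )^{-1}\mathrm{d}Z\otimes(1-Z^*Z)^{-1}\mathrm{d}Z^*\bigr)=-\partial\otimes\bar\partial\,\operatorname{tr}\log(1-ZZ^* ).$$ Here $\mathrm{d}Z$ and $\mathrm{d}Z^*$ denote the matrix-valued 1-forms with entries $\mathrm{d}Z_{ij}$ and $\mathrm{d}\overline{Z_{ji}}$; equivalently $\omega=-\tfrac{\mathrm{i}}{2}\partial\bar\partial\operatorname{tr}\log(1-ZZ^* )$. Equivalently, $$h=\operatorname{tr}\bigl((U^*\mathrm{d}Z\,\overline U)\otimes(U^*\mathrm{d}Z\,\overline U)^*\bigr)$$ for any matrix $U$ with $UU^*=(1-ZZ^* )^{-1}$; such $U$ exist, are unique up to right multiplication by a unitary, and the expression does not depend on that choice.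
   Context: For a smooth family of rank-one projections $P$ on a parameter manifold, the adiabatic connection is $\mathcal{A}=(1-P)\,\mathrm{d}P$, and the Hermitian structure is $h(X,Y)=2\operatorname{tr}\bigl(\mathcal{A}(X)\mathcal{A}(Y)^*\bigr)$ for tangent vectors $X,Y$. The Fubini–Study metric $g$ and adiabatic curvature $\omega$ are defined by $h=g-\mathrm{i}\omega$. In the $N$-mode Fock space with annihilation operators $a_1,\dots,a_N$ and vacuum $\psi_0$, the notation $(a^*,Za^* )$ means $\sum_{i,j}Z_{ij}a_i^*a_j^*$. *)

(* Defs.v *)
(* MathComp + MathComp-Analysis (R : realType, complex numbers R[i]
   from mathcomp-real-closed). *)
From HB Require Import structures.
From mathcomp Require Import all_boot all_order all_algebra.
From mathcomp Require Import all_classical all_reals all_analysis.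
From mathcomp Require Import complex.
Set Implicit Arguments. Unset Strict Implicit. Unset Printing Implicit Defensive.
Import Order.TTheory GRing.Theory Num.Theory.
Import numFieldNormedType.Exports.
Local Open Scope classical_set_scope.
Local Open Scope ring_scope.

(* ---------- complex matrices ---------- *)

(* conjugate transpose A^* *)
Definition adjmx (R : realType) (m n : nat) (A : 'M[R[i]]_(m, n)) : 'M[R[i]]_(n, m) :=
  (map_mx Num.conj A)^T.

(* entrywise conjugate \bar A *)
Definition mxconj (R : realType) (m n : nat) (A : 'M[R[i]]_(m, n)) : 'M[R[i]]_(m, n) :=
  map_mx Num.conj A.

(* A > 0 as a Hermitian form: v^* A v is a positive real for every v <> 0 *)
Definition posdefmx (R : realType) (N : nat) (A : 'M[R[i]]_N) : Prop :=
  forall v : 'cV[R[i]]_N, v != 0 -> 0 < (adjmx v *m A *m v) 0 0.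

(* the domain M = { Z | Z = Z^t, Z Z^* < 1 } *)
Definition inM (R : realType) (N : nat) (Z : 'M[R[i]]_N) : Prop :=
  Z^T = Z /\ posdefmx (1%:M - Z *m adjmx Z).

(* tangent vectors of M (open in the symmetric matrices) *)
Definition symm (R : realType) (N : nat) (X : 'M[R[i]]_N) : Prop := X^T = X.

(* ---------- N-mode Fock space, number basis ---------- *)

(* occupation numbers n = (n_1,...,n_N); the basis vector |n> is
   prod_i (a_i^* )^{n_i} / sqrt(n_i!) psi_0 *)
Definition occ (N : nat) := {ffun 'I_N -> nat}.

Definition occ_tot (N : nat) (n : occ N) : nat := (\sum_i n i)%N.
Definition occ_fact (N : nat) (n : occ N) : nat := (\prod_i (n i)`!)%N.
Definition occ_incr (N : nat) (n : occ N) (i : 'I_N) : occ N :=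
  [ffun j => (n j + (j == i))%N].
Definition occ_decr (N : nat) (n : occ N) (i : 'I_N) : occ N :=
  [ffun j => (n j - (j == i))%N].

(* coefficient of the monomial x^n in (x^t Z x)^k = (sum_{ij} Z_ij x_i x_j)^k *)
Definition qcoef (R : realType) (N : nat) (Z : 'M[R[i]]_N) (k : nat) (n : occ N) : R[i] :=
  \sum_(s : {ffun 'I_k -> 'I_N * 'I_N} |
          [forall i : 'I_N, (\sum_(l < k) (((s l).1 == i) + ((s l).2 == i)) == n i)%N])
     \prod_(l < k) Z (s l).1 (s l).2.

(* <n| e^{-(a^+,Z a^+)/2} psi_0 : since (a^+)^n psi_0 = sqrt(n!) |n>, this is
   sqrt(n!) * sum_k (-1/2)^k/k! [x^n](x^t Z x)^k, only k = |n|/2 contributing *)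
Definition squeeze_coef (R : realType) (N : nat) (Z : 'M[R[i]]_N) (n : occ N) : R[i] :=
  if odd (occ_tot n) then 0
  else let k := (occ_tot n)./2 in
       (- 2^-1) ^+ k / (k`!)%:R * qcoef Z k n * sqrtC ((occ_fact n)%:R).

(* psi_Z = det(1 - Z Z^* )^{1/4} e^{-(a^+,Z a^+)/2} psi_0, in the number basis *)
Definition psi (R : realType) (N : nat) (Z : 'M[R[i]]_N) (n : occ N) : R[i] :=
  sqrtC (sqrtC (\det (1%:M - Z *m adjmx Z))) * squeeze_coef Z n.

(* annihilation / creation operators in the number basis *)
Definition ann (R : realType) (N : nat) (i : 'I_N) (f : occ N -> R[i]) (n : occ N) : R[i] :=
  sqrtC ((n i).+1%:R) * f (occ_incr n i).
Definition cre (R : realType) (N : nat) (i : 'I_N) (f : occ N -> R[i]) (n : occ N) : R[i] :=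
  if (n i == 0)%N then 0 else sqrtC ((n i)%:R) * f (occ_decr n i).

(* ---------- sums over countable index sets ---------- *)

Definition normR (R : realType) (z : R[i]) : R := complex.Re `|z|.

(* sum of a (absolutely summable) real family, via positive and negative parts *)
Definition rsum (R : realType) (T : choiceType) (f : T -> R) : R :=
  fine (\esum_(x in [set: T]) (Num.max (f x) 0)%:E)
  - fine (\esum_(x in [set: T]) (Num.max (- f x) 0)%:E).

Definition csum (R : realType) (T : choiceType) (f : T -> R[i]) : R[i] :=
  Complex (rsum (fun x => complex.Re (f x))) (rsum (fun x => complex.Im (f x))).

(* squared l^2 norm of a vector in the Fock space *)
Definition l2sq (R : realType) (T : choiceType) (f : T -> R[i]) : \bar R :=
  \esum_(x in [set: T]) ((normR (f x)) ^+ 2)%:E.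

(* ---------- the projection family and its adiabatic connection ---------- *)

(* integral kernel of P_Z = |psi_Z><psi_Z| *)
Definition Pker (R : realType) (N : nat) (Z : 'M[R[i]]_N) (p : occ N * occ N) : R[i] :=
  psi Z p.1 * (psi Z p.2)^*.

(* D is the (Hilbert-Schmidt-norm) derivative dP(X) of Z |-> P_Z at Z
   in the direction of the tangent vector X *)
Definition is_dP (R : realType) (N : nat) (Z X : 'M[R[i]]_N) (D : occ N * occ N -> R[i]) : Prop :=
  (fun t : R => l2sq (fun p => (Pker (Z + (t%:C)%C *: X) p - Pker Z p) / (t%:C)%C - D p))
    @ 0^' --> 0%E.

(* kernel of A(X) = (1 - P) dP(X) *)
Definition Aconn (R : realType) (N : nat) (Z : 'M[R[i]]_N) (D : occ N * occ N -> R[i])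
  (p : occ N * occ N) : R[i] :=
  D p - csum (fun k : occ N => Pker Z (p.1, k) * D (k, p.2)).

(* h(X,Y) = 2 tr (A(X) A(Y)^* ), with DX = dP(X), DY = dP(Y) *)
Definition hP (R : realType) (N : nat) (Z : 'M[R[i]]_N) (DX DY : occ N * occ N -> R[i]) : R[i] :=
  2 * csum (fun p => Aconn Z DX p * (Aconn Z DY p)^*).

(* ---------- the explicit formulas ---------- *)

(* tr((1 - Z Z^* )^{-1} dZ (1 - Z^* Z)^{-1} dZ^* ) evaluated on (X, Y) *)
Definition hform (R : realType) (N : nat) (Z X Y : 'M[R[i]]_N) : R[i] :=
  \tr (invmx (1%:M - Z *m adjmx Z) *m X *m invmx (1%:M - adjmx Z *m Z) *m adjmx Y).

(* g = Re h, omega = - Im h  (h = g - i omega) *)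
Definition gform (R : realType) (N : nat) (Z X Y : 'M[R[i]]_N) : R := complex.Re (hform Z X Y).
Definition omegaform (R : realType) (N : nat) (Z X Y : 'M[R[i]]_N) : R := - complex.Im (hform Z X Y).

(* the Kahler potential tr log(1 - Z Z^* ) = log det(1 - Z Z^* ) *)
Definition potential (R : realType) (N : nat) (Z : 'M[R[i]]_N) : R :=
  ln (complex.Re (\det (1%:M - Z *m adjmx Z))).

(* real second directional derivative D_X D_Y F (Z) *)
Definition D2 (R : realType) (N : nat) (F : 'M[R[i]]_N -> R) (Z X Y : 'M[R[i]]_N) : R :=
  derive1 (fun s : R => derive1 (fun t : R => F (Z + (s%:C)%C *: X + (t%:C)%C *: Y)) 0) 0.

(* (d (x) dbar F)(X, Y) = sum_{a,b} X_a conj(Y_b) d_a dbar_b F, written with real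
   directional derivatives: 1/4 (D_X - i D_{iX})(D_Y + i D_{iY}) F *)
Definition ddbar (R : realType) (N : nat) (F : 'M[R[i]]_N -> R) (Z X Y : 'M[R[i]]_N) : R[i] :=
  4^-1 * Complex (D2 F Z X Y + D2 F Z ('i%C *: X) ('i%C *: Y))
                 (D2 F Z X ('i%C *: Y) - D2 F Z ('i%C *: X) Y).

(* Main.v *)
Require Import Defs.
From HB Require Import structures.
From mathcomp Require Import all_boot all_order all_algebra.
From mathcomp Require Import all_classical all_reals all_analysis.
From mathcomp Require Import complex perm ring lra zify.
Set Implicit Arguments. Unset Strict Implicit. Unset Printing Implicit Defensive.
Import Order.TTheory GRing.Theory Num.Theory.
Import numFieldNormedType.Exports.
Local Open Scope classical_set_scope.
Local Open Scope ring_scope.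

(** Write [phi_Z] for the unnormalized squeezed vector and [c_k] for the squared norm of
its component of particle number [2k].  Moving annihilators through [phi_Z] yields
[2 k c_k = sum_(j >= 1) c_(k-j) tr((Z Z^* )^j)], so [sum_k c_k t^k] is
[det(1 - t Z Z^* )^(-1/2)], whence the normalization.  The map [z |-> phi_(Z + z X)] is
coefficientwise polynomial and bounded in l^2 on a disc; Parseval on circles gives Cauchy
estimates, hence differentiability in l^2, with derivative [- (a^*, X a^* ) phi_Z / 2].

The operators [b = a + Z a^*] annihilate [psi_Z] and have commutators
[[b_q, b_p^*] = (1 - Z Z^* )_qp].  Modulo [psi_Z], the vector [(a^*, X a^* ) psi_Z] equals
[(b^*, T b^* ) psi_Z] with [T = (1 - Z Z^* )^-1 X (1 - Z^* Z)^-1], so Wick's formula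
evaluates [h].  The potential is differentiated twice with Jacobi's formula, and omega is
closed because the holomorphic derivative [(d_X h)(Y, W)] is symmetric in [X] and [Y]. *)

(** The obstacle is infinite dimension: differentiability of [P_Z] in Hilbert-Schmidt norm asks for
    remainders that are square summable over all coefficients at once. The closed form of the norm
    supplies this: the determinant stays away from 0 on a small disc, so the norms stay bounded
    there, and Parseval, applied to finite families of polynomials, is obtained by separating even
    from odd parts, with no integration. The operators [a] and [a^*] are unbounded, so they act on
    rapidly decaying vectors; [phi_Z] is one because [phi_((1 + r) Z)] is still square summable for
    some [r > 0]. To avoid the square root of a power series, the square of [sum_k c_k t^k] is
    compared with [prod_l (1 - l t)^-1], where [l] runs over the eigenvalues of [Z Z^*]. The
    normalization factor is not holomorphic in [Z], but it affects the derivative of [psi_Z] only by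
    a multiple of [psi_Z], which [1 - P] removes. The factor 2 in [h] balances the [(1/2)^2] from
    two derivatives against the two Wick pairings, which coincide for symmetric [X]. *)

Section ComplexNorm.
Variable R : realType.
Local Notation C := R[i].
Implicit Types z w : C.

Lemma conjCE z : (z^* : C) = conjc z. Proof. by []. Qed.

Lemma cReM z w : complex.Re (z * w) =
  complex.Re z * complex.Re w - complex.Im z * complex.Im w.
Proof. by case: z w => ? ? [? ?]. Qed.
Lemma cImM z w : complex.Im (z * w) =
  complex.Re z * complex.Im w + complex.Im z * complex.Re w.
Proof. by case: z w => ? ? [? ?]. Qed.
Lemma cReD z w : complex.Re (z + w) = complex.Re z + complex.Re w.
Proof. by case: z w => ? ? [? ?]. Qed.
Lemma cImD z w : complex.Im (z + w) = complex.Im z + complex.Im w.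
Proof. by case: z w => ? ? [? ?]. Qed.
Lemma cReN z : complex.Re (- z) = - complex.Re z. Proof. by case: z. Qed.
Lemma cImN z : complex.Im (- z) = - complex.Im z. Proof. by case: z. Qed.
Lemma cReJ z : complex.Re (z^*) = complex.Re z. Proof. by case: z. Qed.
Lemma cImJ z : complex.Im (z^*) = - complex.Im z. Proof. by case: z. Qed.
Lemma complex_ext z w :
  complex.Re z = complex.Re w -> complex.Im z = complex.Im w -> z = w.
Proof. by case: z w => ? ? [? ?] /= -> ->. Qed.

Lemma normR_sq z : normR z ^+ 2 = complex.Re z ^+ 2 + complex.Im z ^+ 2.
Proof.
by rewrite /normR normc_def /= sqr_sqrtr // addr_ge0 ?sqr_ge0.
Qed.

Lemma normR_ge0 z : 0 <= normR z.
Proof. by rewrite /normR normc_def /= sqrtr_ge0. Qed.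

Lemma normR_C z : (normR z)%:C%C = `|z|.
Proof. by rewrite /normR RRe_real // normr_real. Qed.

Lemma normR_sqC z : (normR z ^+ 2)%:C%C = z * z^*.
Proof. by rewrite rmorphXn /= normR_C normCK. Qed.

Lemma normRM z w : normR (z * w) = normR z * normR w.
Proof. by apply: complexI; rewrite rmorphM /= !normR_C normrM. Qed.

Lemma normRN z : normR (- z) = normR z.
Proof. by rewrite /normR normrN. Qed.

Lemma normRJ z : normR (z^*) = normR z.
Proof. by apply: complexI; rewrite !normR_C norm_conjC. Qed.

Lemma normRD_sq z w : normR (z + w) ^+ 2 <= 2 * (normR z ^+ 2 + normR w ^+ 2).
Proof.
rewrite !normR_sq cReD cImD.
have h (a b : R) : (a + b) ^+ 2 <= 2 * (a ^+ 2 + b ^+ 2).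
  by have := sqr_ge0 (a - b); rewrite !sqrrD sqrrN mulrN; lra.
have := h (complex.Re z) (complex.Re w); have := h (complex.Im z) (complex.Im w).
lra.
Qed.

Lemma normR_conjM z w : `|complex.Re (z * w)| <= normR z * normR w /\
  `|complex.Im (z * w)| <= normR z * normR w.
Proof.
rewrite -normRM.
have h (a b : R) : `|a| <= Num.sqrt (a ^+ 2 + b ^+ 2).
  by rewrite -sqrtr_sqr ler_wsqrtr // lerDl sqr_ge0.
move: (z * w) => [a b]; rewrite /normR normc_def /=; split; first exact: h.
by rewrite addrC; exact: h.
Qed.

End ComplexNorm.

(** * Unconditional sums of real and complex families *)

Section Sums.
Variables (R : realType).
Local Notation C := R[i].
Local Open Scope ereal_scope.

(** The domain on which [rsum] is additive: [rsum] goes through [fine], which sends an infinite sum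
    to 0. *)
Definition asummable (T : choiceType) (f : T -> R) :=
  \esum_(x in [set: T]) `|f x|%:E < +oo.

Lemma asummable_le (T : choiceType) (f g : T -> R) :
  (forall x, `|f x| <= `|g x|)%R -> asummable g -> asummable f.
Proof. by move=> h; apply: le_lt_trans; apply: le_esum => x _; rewrite lee_fin. Qed.

Lemma esum_fin (T : choiceType) (f g : T -> R) : asummable g ->
  (forall x, 0 <= f x <= `|g x|)%R ->
  \esum_(x in [set: T]) (f x)%:E \is a fin_num.
Proof.
move=> sg h; rewrite ge0_fin_numE; last first.
  by apply: esum_ge0 => x _; rewrite lee_fin; case/andP: (h x).
apply: le_lt_trans sg; apply: le_esum => x _; rewrite lee_fin.
by case/andP: (h x).
Qed.

Lemma esum_pos_fin (T : choiceType) (f : T -> R) : asummable f ->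
  \esum_(x in [set: T]) (Num.max (f x) 0)%:E \is a fin_num.
Proof.
move=> sf; apply: esum_fin sf _ => x.
by rewrite le_max lexx orbT ge_max ler_norm normr_ge0.
Qed.

Lemma esum_neg_fin (T : choiceType) (f : T -> R) : asummable f ->
  \esum_(x in [set: T]) (Num.max (- f x) 0)%:E \is a fin_num.
Proof.
move=> sf; apply: esum_fin sf _ => x.
by rewrite le_max lexx orbT ge_max -normrN ler_norm normr_ge0.
Qed.

Lemma eq_rsum (T : choiceType) (f g : T -> R) : f =1 g -> rsum f = rsum g.
Proof. by move=> h; congr rsum; apply: funext. Qed.

Lemma rsumN (T : choiceType) (f : T -> R) : rsum (fun x => - f x)%R = (- rsum f)%R.
Proof.
rewrite /rsum opprB; congr (_ - fine _)%R.
by apply: eq_esum => x _; rewrite opprK.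
Qed.

Lemma asummableD (T : choiceType) (f g : T -> R) :
  asummable f -> asummable g -> asummable (fun x => f x + g x)%R.
Proof.
move=> sf sg; apply: le_lt_trans (lte_add_pinfty sf sg).
rewrite -esumD; [|by move=> *; rewrite lee_fin..].
by apply: le_esum => x _; rewrite -EFinD lee_fin ler_normD.
Qed.

Lemma asummableN (T : choiceType) (f : T -> R) :
  asummable f -> asummable (fun x => - f x)%R.
Proof. by apply: asummable_le => x; rewrite normrN. Qed.

(** Finite partial sums give [<=] for any positive factor; the reverse is the same inequality for
    [c^-1] applied to the scaled family. *)
Lemma esumZ (T : choiceType) (c : R) (f : T -> R) : (0 <= c)%R ->
  (forall x, 0 <= f x)%R ->
  \esum_(x in [set: T]) (c * f x)%:E = c%:E * \esum_(x in [set: T]) (f x)%:E.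
Proof.
move=> c0 f0; rewrite le_eqVlt in c0; case/predU1P: c0 => [<-|c0].
  by rewrite mul0e; apply: esum1 => x _; rewrite mul0r.
have le (d : R) (h : T -> R) : (0 < d)%R -> (forall x, 0 <= h x)%R ->
    \esum_(x in [set: T]) (d * h x)%:E <= d%:E * \esum_(x in [set: T]) (h x)%:E.
  move=> d0 h0; apply: ge_ereal_sup => _ [X [finX _]] <-.
  under eq_fsbigr do rewrite EFinM.
  rewrite -ge0_mule_fsumr; last by move=> *; rewrite lee_fin.
  by rewrite lee_pmul2l // ?lte_fin //; apply: esum_ge; exists X.
apply/eqP; rewrite eq_le le //=.
rewrite -lee_pdivlMl //.
have := le (c^-1)%R (fun x => c * f x)%R; rewrite invr_gt0 c0.
have cf x : (0 <= c * f x)%R by rewrite mulr_ge0 // ltW.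
move=> /(_ isT cf); apply: le_trans; apply: le_esum => x _.
by rewrite mulrA mulVf ?mul1r // gt_eqF.
Qed.

Lemma asummableZ (T : choiceType) (c : R) (f : T -> R) :
  asummable f -> asummable (fun x => c * f x)%R.
Proof.
move=> sf; rewrite /asummable; under eq_esum do rewrite normrM.
rewrite esumZ // lte_mul_pinfty //; exact: sf.
Qed.

(** Positive and negative parts satisfy [(f + g)^+ + f^- + g^- = (f + g)^- + f^+ + g^+], an identity
    between nonnegative families, which can be summed before any subtraction. *)
Lemma rsumD (T : choiceType) (f g : T -> R) : asummable f -> asummable g ->
  rsum (fun x => f x + g x)%R = (rsum f + rsum g)%R.
Proof.
move=> sf sg; have sfg := asummableD sf sg; rewrite /rsum.
have pf := esum_pos_fin sf; have nf := esum_neg_fin sf.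
have pg := esum_pos_fin sg; have ng := esum_neg_fin sg.
have pfg := esum_pos_fin sfg; have nfg := esum_neg_fin sfg.
have m0 (a : R) : 0 <= (Num.max a 0)%:E by rewrite lee_fin le_max lexx orbT.
have maxE (a : R) : (Num.max a 0 = a + Num.max (- a) 0)%R.
  by rewrite /Num.max oppr_lt0; case: ltgtP => h; lra.
have : \esum_(x in [set: T]) (Num.max (f x + g x)%R 0)%:E
    + (\esum_(x in [set: T]) (Num.max (- f x) 0)%:E +
       \esum_(x in [set: T]) (Num.max (- g x) 0)%:E)
    = \esum_(x in [set: T]) (Num.max (- (f x + g x)) 0)%:E
    + (\esum_(x in [set: T]) (Num.max (f x) 0)%:E +
       \esum_(x in [set: T]) (Num.max (g x) 0)%:E).
  rewrite -!esumD; try by move=> *; rewrite ?adde_ge0.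
  apply: eq_esum => x _; rewrite -!EFinD; congr EFin.
  rewrite !(maxE (_ + _)%R) (maxE (f x)) (maxE (g x)); lra.
rewrite -[X in X + _ = _]fineK // -[X in X + _ = _]fineK //.
rewrite -(fineK pf) -(fineK pg) -(fineK nf) -(fineK ng) -(fineK pfg) -(fineK nfg).
rewrite /= -!EFinD => -[]; lra.
Qed.

Lemma rsumZ (T : choiceType) (c : R) (f : T -> R) :
  rsum (fun x => c * f x)%R = (c * rsum f)%R.
Proof.
have pos (d : R) (h : T -> R) : (0 <= d)%R ->
    rsum (fun x => d * h x)%R = (d * rsum h)%R.
  move=> d0; rewrite /rsum mulrBr.
  have e (k : T -> R) : fine (\esum_(x in [set: T]) (Num.max (d * k x)%R 0)%:E) =
      (d * fine (\esum_(x in [set: T]) (Num.max (k x) 0)%:E))%R.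
    rewrite [X in fine X](_ : _ =
      \esum_(x in [set: T]) (d * Num.max (k x) 0)%:E); last first.
      by apply: eq_esum => x _; rewrite maxr_pMr // mulr0.
    rewrite esumZ // ; last by move=> x; rewrite le_max lexx orbT.
    have : 0 <= \esum_(x in [set: T]) (Num.max (k x) 0)%:E.
      by apply: esum_ge0 => x _; rewrite lee_fin le_max lexx orbT.
    case: (\esum_(x in _) _) => [r _||] //=.
    move=> _; rewrite mulr0; have [->|d1] := eqVneq d 0%R; first by rewrite mul0e.
    by rewrite gt0_muley // lte_fin lt_def d1.
  rewrite e; congr (_ - _)%R; rewrite -e; congr fine; apply: eq_esum => x _.
  by rewrite mulrN.
have [c0|c0] := leP 0%R c; first exact: pos.
rewrite -[c in RHS]opprK mulNr -pos; last by rewrite oppr_ge0 ltW.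
by rewrite -rsumN; apply: eq_rsum => x; rewrite mulNr opprK.
Qed.

Lemma rsum_ge0E (T : choiceType) (f : T -> R) : (forall x, 0 <= f x)%R ->
  rsum f = fine (\esum_(x in [set: T]) (f x)%:E).
Proof.
move=> f0; rewrite /rsum [X in (_ - fine X)%R]esum1; last first.
  by move=> x _; rewrite max_r // oppr_le0.
by rewrite subr0; congr fine; apply: eq_esum => x _; rewrite max_l.
Qed.

Lemma esum_inj (T T' : choiceType) (e : T -> T') (f : T' -> R) :
  injective e -> (forall y, ~ range e y -> f y = 0%R) ->
  \esum_(y in [set: T']) (f y)%:E = \esum_(x in [set: T]) (f (e x))%:E.
Proof.
move=> ie f0; rewrite -(@esum_image _ _ _ setT e (fun y => (f y)%:E)); last by move=> x y _ _ /ie.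
rewrite [RHS]esum_mkcond; apply: eq_esum => y _; case: ifPn => //.
by rewrite notin_setE => /f0 ->.
Qed.

Lemma rsum_inj (T T' : choiceType) (e : T -> T') (f : T' -> R) :
  injective e -> (forall y, ~ range e y -> f y = 0%R) ->
  rsum f = rsum (f \o e).
Proof.
move=> ie f0; rewrite /rsum (esum_inj ie); last by move=> y /f0 ->; rewrite maxxx.
by rewrite (esum_inj ie) // => y /f0 ->; rewrite oppr0 maxxx.
Qed.

Lemma esum_prod (T1 T2 : choiceType) (f : T1 -> R) (g : T2 -> R) :
  (forall x, 0 <= f x)%R -> (forall x, 0 <= g x)%R ->
  \esum_(y in [set: T2]) (g y)%:E < +oo ->
  \esum_(p in [set: T1 * T2]) (f p.1 * g p.2)%:E =
  (\esum_(x in [set: T1]) (f x)%:E) * (\esum_(y in [set: T2]) (g y)%:E).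
Proof.
move=> f0 g0 gfin.
have -> : [set: T1 * T2] = [set: T1] `*`` (fun=> [set: T2]).
  by apply/seteqP; split.
rewrite -(@esum_esum _ _ _ _ _ (fun x y => (f x * g y)%:E)); last first.
  by move=> *; rewrite lee_fin mulr_ge0.
have gge : 0 <= \esum_(y in [set: T2]) (g y)%:E.
  by apply: esum_ge0 => *; rewrite lee_fin.
rewrite -(fineK (x := \esum_(y in [set: T2]) (g y)%:E)) ?ge0_fin_numE //.
set G := fine _; have G0 : (0 <= G)%R by rewrite fine_ge0.
rewrite muleC -esumZ //; apply: eq_esum => x _.
by rewrite esumZ // -(fineK (x := \esum_(y in [set: T2]) (g y)%:E)) ?ge0_fin_numE // mulrC.
Qed.

Lemma rsum_prod (T1 T2 : choiceType) (f : T1 -> R) (g : T2 -> R) :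
  asummable f -> (forall x, 0 <= g x)%R ->
  \esum_(y in [set: T2]) (g y)%:E < +oo ->
  rsum (fun p : T1 * T2 => f p.1 * g p.2)%R = (rsum f * rsum g)%R.
Proof.
move=> sf g0 gfin; rewrite (rsum_ge0E g0) /rsum mulrBl.
have gge : 0 <= \esum_(y in [set: T2]) (g y)%:E.
  by apply: esum_ge0 => *; rewrite lee_fin.
have gf : \esum_(y in [set: T2]) (g y)%:E \is a fin_num by rewrite ge0_fin_numE.
have e (k : T1 -> R) : asummable k ->
    fine (\esum_(p in [set: T1 * T2]) (Num.max (k p.1 * g p.2)%R 0)%:E) =
    (fine (\esum_(x in [set: T1]) (Num.max (k x) 0)%:E) *
     fine (\esum_(y in [set: T2]) (g y)%:E))%R.
  move=> sk; rewrite -fineM ?esum_pos_fin //; congr fine.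
  rewrite -esum_prod //; last by move=> x; rewrite le_max lexx orbT.
  by apply: eq_esum => p _; rewrite maxr_pMl // mul0r.
rewrite e // -(e (fun x => - f x)%R) //; last exact: asummableN.
by congr (_ - fine _)%R; apply: eq_esum => p _; rewrite mulNr.
Qed.

Definition csummable (T : choiceType) (f : T -> C) :=
  asummable (fun x => complex.Re (f x)) /\ asummable (fun x => complex.Im (f x)).

Lemma eq_csum (T : choiceType) (f g : T -> C) : f =1 g -> csum f = csum g.
Proof. by move=> h; congr csum; apply: funext. Qed.

Lemma csummableD (T : choiceType) (f g : T -> C) :
  csummable f -> csummable g -> csummable (fun x => f x + g x)%R.
Proof.
move=> [f1 f2] [g1 g2]; split.
  by apply: asummable_le (asummableD f1 g1) => x; rewrite cReD.
by apply: asummable_le (asummableD f2 g2) => x; rewrite cImD.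
Qed.

Lemma csummableZ (T : choiceType) (c : C) (f : T -> C) :
  csummable f -> csummable (fun x => c * f x)%R.
Proof.
move=> [f1 f2]; split.
  apply: asummable_le (asummableD (asummableZ (complex.Re c) f1)
    (asummableZ (- complex.Im c)%R f2)) => x; rewrite cReM mulNr //.
by apply: asummable_le (asummableD (asummableZ (complex.Re c) f2)
    (asummableZ (complex.Im c)%R f1)) => x; rewrite cImM.
Qed.

Lemma csumD (T : choiceType) (f g : T -> C) : csummable f -> csummable g ->
  csum (fun x => f x + g x)%R = (csum f + csum g)%R.
Proof.
move=> [f1 f2] [g1 g2]; apply: complex_ext; rewrite ?cReD ?cImD /=.
  by rewrite -rsumD //; apply: eq_rsum => x; rewrite cReD.
by rewrite -rsumD //; apply: eq_rsum => x; rewrite cImD.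
Qed.

Lemma csumZ (T : choiceType) (c : C) (f : T -> C) : csummable f ->
  csum (fun x => c * f x)%R = (c * csum f)%R.
Proof.
move=> [f1 f2]; apply: complex_ext; rewrite ?cReM ?cImM /=.
  rewrite -mulNr -!rsumZ -rsumD; [|exact: asummableZ..].
  by apply: eq_rsum => x; rewrite cReM mulNr.
rewrite -!rsumZ -rsumD; [|exact: asummableZ..].
by apply: eq_rsum => x; rewrite cImM.
Qed.

Lemma csum0 (T : choiceType) : csum (fun _ : T => 0%R : C) = 0%R.
Proof.
apply: complex_ext => /=; rewrite rsum_ge0E //=; by rewrite esum1.
Qed.

Lemma csummable0 (T : choiceType) : csummable (fun _ : T => 0%R : C).
Proof. by split; rewrite /asummable esum1 //= => *; rewrite normr0. Qed.

Lemma csum_sum (I : Type) (r : seq I) (T : choiceType) (f : I -> T -> C) :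
  (forall i, csummable (f i)) ->
  csummable (fun x => \sum_(i <- r) f i x)%R /\
  csum (fun x => \sum_(i <- r) f i x)%R = (\sum_(i <- r) csum (f i))%R.
Proof.
move=> sf; elim: r => [|i r [IH1 IH2]].
  rewrite big_nil (_ : (fun _ => _) = (fun _ : T => 0%R : C)).
    by split; [exact: csummable0|exact: csum0].
  by apply: funext => x; rewrite big_nil.
rewrite (_ : (fun _ => _) = (fun x => f i x + \sum_(j <- r) f j x)%R); last first.
  by apply: funext => x; rewrite big_cons.
by rewrite big_cons csumD // IH2; split=> //; exact: csummableD.
Qed.

Lemma csumJ (T : choiceType) (f : T -> C) : csum (fun x => (f x)^*)%R = ((csum f)^*)%R.
Proof.
apply: complex_ext; rewrite ?cReJ ?cImJ /=.
  by apply: eq_rsum => x; rewrite cReJ.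
by rewrite -rsumN; apply: eq_rsum => x; rewrite cImJ.
Qed.

Lemma csum_inj (T T' : choiceType) (e : T -> T') (f : T' -> C) :
  injective e -> (forall y, ~ range e y -> f y = 0%R) ->
  csum f = csum (f \o e).
Proof.
move=> ie f0; apply: complex_ext => /=.
  by rewrite (rsum_inj ie) // => y /f0 ->.
by rewrite (rsum_inj ie) // => y /f0 ->.
Qed.

(** The second factor is real and nonnegative because it will be [normR (psi Z m) ^+ 2]; signs are
    then carried by [f] alone and the double sum factors part by part. *)
Lemma csum_prod (T1 T2 : choiceType) (f : T1 -> C) (g : T2 -> R) :
  csummable f -> (forall x, 0 <= g x)%R ->
  \esum_(y in [set: T2]) (g y)%:E < +oo ->
  csum (fun p : T1 * T2 => f p.1 * (g p.2)%:C%C)%R =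
  (csum f * (fine (\esum_(y in [set: T2]) (g y)%:E))%:C%C)%R.
Proof.
move=> [f1 f2] g0 gfin; rewrite -(rsum_ge0E g0).
apply: complex_ext; rewrite ?cReM ?cImM /= ?mulr0 ?subr0 ?add0r -rsum_prod //.
  by apply: eq_rsum => p; rewrite cReM /= mulr0 subr0.
by apply: eq_rsum => p; rewrite cImM /= mulr0 add0r.
Qed.

Lemma csum_normR (T : choiceType) (f : T -> C) :
  csum (fun x => f x * (f x)^*)%R = ((fine (l2sq f))%:C%C).
Proof.
rewrite /l2sq -rsum_ge0E; last by move=> x; rewrite sqr_ge0.
apply: complex_ext => /=.
  by apply: eq_rsum => x; rewrite -normR_sqC.
rewrite rsum_ge0E ?esum1 //= => x *; by rewrite -normR_sqC.
Qed.

Lemma l2sq_ge0 (T : choiceType) (f : T -> C) : 0 <= l2sq f.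
Proof. by apply: esum_ge0 => x _; rewrite lee_fin sqr_ge0. Qed.

(** The products are dominated through [a * b <= a^2 + b^2], which does the work of Cauchy-Schwarz
    here. *)
Lemma csummable_mul (T : choiceType) (f g : T -> C) :
  l2sq f < +oo -> l2sq g < +oo -> csummable (fun x => f x * (g x)^*)%R.
Proof.
move=> sf sg.
have s : asummable (fun x => normR (f x) ^+ 2 + normR (g x) ^+ 2)%R.
  apply: asummableD; rewrite /asummable.
    by rewrite (eq_esum (b := fun x => (normR (f x) ^+ 2)%:E)) // => x _; rewrite ger0_norm ?sqr_ge0.
  by rewrite (eq_esum (b := fun x => (normR (g x) ^+ 2)%:E)) // => x _; rewrite ger0_norm ?sqr_ge0.
have am (a b : R) : (0 <= a -> 0 <= b -> a * b <= `|a ^+ 2 + b ^+ 2|)%R.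
  move=> a0 b0; rewrite ger0_norm ?addr_ge0 ?sqr_ge0 //.
  have := sqr_ge0 (a - b)%R; have := sqr_ge0 (a + b)%R; rewrite !sqrrD mulrN sqrrN; lra.
split; apply: asummable_le s => x.
  apply: le_trans (proj1 (normR_conjM _ _)) _.
  by rewrite normRJ am ?normR_ge0.
apply: le_trans (proj2 (normR_conjM _ _)) _.
by rewrite normRJ am ?normR_ge0.
Qed.

(** The constant 2 is harmless: the bound serves to let remainders tend to 0. *)
Lemma l2sqD (T : choiceType) (f g : T -> C) :
  l2sq (fun x => f x + g x)%R <= (2%R : R)%:E * (l2sq f + l2sq g).
Proof.
rewrite /l2sq -esumD; [|by move=> *; rewrite lee_fin sqr_ge0..].
have e : ((2%R : R)%:E * \esum_(i in [set: T]) ((normR (f i) ^+ 2)%:E + (normR (g i) ^+ 2)%:E))%E =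
  \esum_(i in [set: T]) (2 * (normR (f i) ^+ 2 + normR (g i) ^+ 2))%:E.
  by rewrite esumZ // => x; rewrite addr_ge0 ?sqr_ge0.
by rewrite e; apply: le_esum => x _; rewrite lee_fin normRD_sq.
Qed.

Lemma l2sqZ (T : choiceType) (c : C) (f : T -> C) :
  l2sq (fun x => c * f x)%R = (normR c ^+ 2)%:E * l2sq f.
Proof.
rewrite /l2sq -esumZ ?sqr_ge0 //; last by move=> x; rewrite sqr_ge0.
by apply: eq_esum => x _; rewrite normRM exprMn.
Qed.

Lemma l2sq_tensor (T1 T2 : choiceType) (f : T1 -> C) (g : T2 -> C) :
  l2sq g < +oo ->
  l2sq (fun p : T1 * T2 => f p.1 * (g p.2)^*)%R = l2sq f * l2sq g.
Proof.
move=> gf; rewrite /l2sq -esum_prod //; [|by move=> x; rewrite sqr_ge0..].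
by apply: eq_esum => p _; rewrite normRM normRJ exprMn.
Qed.

Lemma l2sq_ge (T : choiceType) (f : T -> C) x : ((normR (f x)) ^+ 2)%:E <= l2sq f.
Proof.
apply: esum_ge; exists [set x]; first by split.
by rewrite fsbig_set1.
Qed.

End Sums.

(** * Hermitian matrices and their quadratic forms *)

Section Adjoint.
Variable R : realType.
Local Notation C := R[i].

Lemma adjmxE m n (A : 'M[C]_(m, n)) i j : adjmx A i j = (A j i)^*.
Proof. by rewrite /adjmx !mxE. Qed.

Lemma adjmxK m n (A : 'M[C]_(m, n)) : adjmx (adjmx A) = A.
Proof. by apply/matrixP => i j; rewrite !adjmxE conjCK. Qed.

Lemma adjmxM m n p (A : 'M[C]_(m, n)) (B : 'M[C]_(n, p)) :
  adjmx (A *m B) = adjmx B *m adjmx A.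
Proof. by rewrite /adjmx map_mxM trmx_mul. Qed.

Lemma adjmxD m n (A B : 'M[C]_(m, n)) : adjmx (A + B) = adjmx A + adjmx B.
Proof. by rewrite /adjmx map_mxD linearD. Qed.

Lemma adjmxB m n (A B : 'M[C]_(m, n)) : adjmx (A - B) = adjmx A - adjmx B.
Proof. by rewrite /adjmx map_mxB linearB. Qed.

Lemma adjmxZ m n c (A : 'M[C]_(m, n)) : adjmx (c *: A) = c^* *: adjmx A.
Proof. by rewrite /adjmx map_mxZ linearZ. Qed.

Lemma adjmx1 n : adjmx (1%:M : 'M[C]_n) = 1%:M.
Proof. by rewrite /adjmx map_mx1 trmx1. Qed.

Lemma adjmxV n (A : 'M[C]_n) : adjmx (invmx A) = invmx (adjmx A).
Proof. by rewrite /adjmx map_invmx trmx_inv. Qed.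

Lemma tr_adjmx n (A : 'M[C]_n) : \tr (adjmx A) = (\tr A)^*.
Proof. by rewrite /adjmx mxtrace_tr trace_map_mx. Qed.

Lemma det_adjmx n (A : 'M[C]_n) : \det (adjmx A) = (\det A)^*.
Proof. by rewrite /adjmx det_tr det_map_mx. Qed.

Lemma quadE n (A : 'M[C]_n) (v : 'cV[C]_n) :
  (adjmx v *m A *m v) 0 0 = \sum_i \sum_j (v i 0)^* * A i j * v j 0.
Proof.
rewrite mxE exchange_big; apply: eq_bigr => j _; rewrite mxE mulr_suml.
by apply: eq_bigr => i _; rewrite adjmxE.
Qed.

Lemma quadD n (A B : 'M[C]_n) (v : 'cV[C]_n) :
  (adjmx v *m (A + B) *m v) 0 0 = (adjmx v *m A *m v) 0 0 + (adjmx v *m B *m v) 0 0.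
Proof. by rewrite mulmxDr mulmxDl mxE. Qed.

Lemma quadB n (A B : 'M[C]_n) (v : 'cV[C]_n) :
  (adjmx v *m (A - B) *m v) 0 0 = (adjmx v *m A *m v) 0 0 - (adjmx v *m B *m v) 0 0.
Proof. by rewrite mulmxBr mulmxBl !mxE. Qed.

Lemma quadZ n c (A : 'M[C]_n) (v : 'cV[C]_n) :
  (adjmx v *m (c *: A) *m v) 0 0 = c * (adjmx v *m A *m v) 0 0.
Proof. by rewrite -scalemxAr -scalemxAl mxE. Qed.

Lemma quad_comb3 n c1 c2 c3 (A1 A2 A3 : 'M[C]_n) (v : 'cV[C]_n) :
  (adjmx v *m (c1 *: A1 + c2 *: A2 + c3 *: A3) *m v) 0 0 =
  c1 * (adjmx v *m A1 *m v) 0 0 + c2 * (adjmx v *m A2 *m v) 0 0 +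
  c3 * (adjmx v *m A3 *m v) 0 0.
Proof. by rewrite !quadD !quadZ. Qed.

Lemma quad_adj n (A : 'M[C]_n) (v : 'cV[C]_n) :
  (adjmx v *m adjmx A *m v) 0 0 = ((adjmx v *m A *m v) 0 0)^*.
Proof. by rewrite -adjmxE !adjmxM adjmxK mulmxA. Qed.

Lemma quad1E n (v : 'cV[C]_n) : (adjmx v *m v) 0 0 = \sum_i `|v i 0| ^+ 2.
Proof. by rewrite mxE; apply: eq_bigr => i _; rewrite adjmxE normCK mulrC. Qed.

Lemma hermitian_diag n (A : 'M[C]_n) : adjmx A = A ->
  exists (P : 'M[C]_n) (l : 'I_n -> R),
    [/\ P *m adjmx P = 1%:M, adjmx P *m P = 1%:M &
        A = adjmx P *m diag_mx (\row_i (l i)%:C%C) *m P].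
Proof.
move=> hA; have hs : A \is hermsymmx.
  by apply/is_hermitianmxP; rewrite expr0 scale1r -[LHS]hA /adjmx map_trmx.
have /orthomx_spectralP eA := hermitian_normalmx hs.
have /mxOverP dr := hermitian_spectral_diag_real hs.
have Pu := spectral_unitarymx A.
have eP : adjmx (spectralmx A) = invmx (spectralmx A).
  by rewrite invmx_unitary // /adjmx map_trmx.
exists (spectralmx A), (fun i => complex.Re (spectral_diag A 0 i)).
have uP := spectral_unit A.
rewrite eP (mulmxV uP) (mulVmx uP); split; [by []|by []|].
rewrite [LHS]eA; congr (_ *m diag_mx _ *m _); apply/rowP => i.
by rewrite !mxE RRe_real.
Qed.

Lemma det_hermitian_diag n (P : 'M[C]_n) (l : 'I_n -> R) :
  adjmx P *m P = 1%:M ->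
  \det (adjmx P *m diag_mx (\row_i (l i)%:C%C) *m P) = (\prod_i l i)%:C%C.
Proof.
move=> h; rewrite !det_mulmx mulrAC -det_mulmx h det1 mul1r det_diag.
by rewrite rmorph_prod; apply: eq_bigr => i _; rewrite mxE.
Qed.

(** Testing the form on the unit eigenvector [v] converts bounds on the form into bounds on the real
    number [l i]. *)
Lemma hermitian_diag_eigen n (P : 'M[C]_n) (l : 'I_n -> R) i :
  P *m adjmx P = 1%:M ->
  let A := adjmx P *m diag_mx (\row_i (l i)%:C%C) *m P in
  let v := adjmx P *m (delta_mx i 0 : 'cV_n) in
  (adjmx v *m A *m v) 0 0 = (l i)%:C%C /\ (adjmx v *m v) 0 0 = 1.
Proof.
move=> h A v.
have ev : adjmx v = (delta_mx 0 i : 'rV_n) *m P.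
  rewrite /v adjmxM adjmxK; congr (_ *m _).
  by apply/matrixP => a b; rewrite adjmxE !mxE andbC rmorph_nat.
have Pv : P *m v = delta_mx i 0 by rewrite /v mulmxA h mul1mx.
split.
  rewrite ev /A -!mulmxA Pv !mulmxA -[_ *m P *m adjmx P]mulmxA h mulmx1.
  by rewrite -mulmxA -rowE mxE mul_diag_mx !mxE !eqxx mulr1.
by rewrite ev -mulmxA Pv -rowE !mxE !eqxx.
Qed.

Lemma quad_le n (A : 'M[C]_n) (v : 'cV[C]_n) :
  `|(adjmx v *m A *m v) 0 0| <= (\sum_i \sum_j `|A i j|) * (adjmx v *m v) 0 0.
Proof.
rewrite quadE quad1E; apply: le_trans (ler_norm_sum _ _ _) _.
rewrite mulr_suml; apply: ler_sum => i _.
apply: le_trans (ler_norm_sum _ _ _) _.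
rewrite mulr_suml; apply: ler_sum => j _.
rewrite !normrM norm_conjC mulrAC mulrC; apply: ler_wpM2l => //.
set q := \sum_i _.
have hq k : `|v k 0| ^+ 2 <= q.
  by rewrite /q (bigD1 k) //= lerDl sumr_ge0 // => ? _; apply: exprn_ge0.
have [h|h] : `|v i 0| <= `|v j 0| \/ `|v j 0| <= `|v i 0|.
  by apply/orP; apply: real_leVge; apply: normr_real.
  by apply: le_trans (hq j); rewrite expr2 ler_wpM2r.
by apply: le_trans (hq i); rewrite expr2 ler_wpM2l.
Qed.

End Adjoint.

Lemma sub4 (V : zmodType) (i a b c d : V) :
  i - (a + b + (c + d)) = i - a - (c + b + d).
Proof.
rewrite -[RHS]addrA -opprD; congr (i - _); rewrite !addrA; congr (_ + d).
by rewrite -!addrA; congr (a + _); rewrite addrC.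
Qed.

(** * The domain of [Z], the factor [U] and positivity of the metric *)

Section Domain.
Variables (R : realType) (N : nat).
Local Notation C := R[i].
Implicit Types Z X Y U V : 'M[C]_N.

Lemma herm_ZZ Z : adjmx (1%:M - Z *m adjmx Z) = 1%:M - Z *m adjmx Z.
Proof. by rewrite adjmxB adjmx1 adjmxM adjmxK. Qed.

Lemma tr_sym_ZZ Z : Z^T = Z -> (1%:M - Z *m adjmx Z)^T = 1%:M - adjmx Z *m Z.
Proof.
move=> sZ; rewrite linearB /= trmx1 trmx_mul sZ; congr (1%:M - _ *m _).
by rewrite /adjmx trmxK -{2}sZ map_trmx trmxK.
Qed.

Lemma posdef_bound (A : 'M[C]_N) : adjmx A = A -> posdefmx A ->
  exists2 d : R, 0 < d & forall v : 'cV[C]_N, d%:C%C * (adjmx v *m v) 0 0 <= (adjmx v *m A *m v) 0 0.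
Proof.
move=> hA pA; have [P [l [P1 P2 eA]]] := hermitian_diag hA.
have lpos i : 0 < l i.
  have [] := hermitian_diag_eigen l i P1; rewrite -eA.
  set v := _ *m _ => e1 e2; rewrite -(@ltcR R) -e1; apply: pA.
  by apply/eqP => v0; move/eqP: e2; rewrite v0 mulmx0 mxE eq_sym oner_eq0.
(* The smallest eigenvalue, capped at 1 so that [d] makes sense and is positive for [N = 0] as
   well. *)
pose d := \big[Num.min/1]_i l i.
have d0 : 0 < d by rewrite /d; elim/big_ind: _ => // x y; rewrite lt_min => -> ->.
have dl i : d <= l i by apply: bigmin_le_cond.
exists d => // v; pose w := P *m v.
have -> : (adjmx v *m A *m v) 0 0 = \sum_i (l i)%:C%C * `|w i 0| ^+ 2.
  rewrite eA !mulmxA -(adjmxM P v) -/w -mulmxA -/w -mulmxA mul_diag_mx mxE.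
  apply: eq_bigr => i _; rewrite adjmxE !mxE normCK mulrCA; congr (_ * _).
  by rewrite mulrC.
have -> : adjmx v *m v = adjmx w *m w.
  by rewrite /w adjmxM !mulmxA -[_ *m adjmx P *m P]mulmxA P2 mulmx1.
rewrite quad1E mulr_sumr; apply: ler_sum => i _.
by apply: ler_wpM2r; [apply: exprn_ge0|rewrite lecR].
Qed.

Lemma bound_det (A : 'M[C]_N) (d : R) : adjmx A = A -> 0 < d ->
  (forall v : 'cV[C]_N, d%:C%C * (adjmx v *m v) 0 0 <= (adjmx v *m A *m v) 0 0) ->
  (d ^+ N)%:C%C <= \det A.
Proof.
move=> hA d0 dA; have [P [l [P1 P2 eA]]] := hermitian_diag hA.
have dl i : d <= l i.
  have [] := hermitian_diag_eigen l i P1; rewrite -eA.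
  by move=> e1 e2; have := dA (adjmx P *m delta_mx i 0); rewrite e1 e2 mulr1 lecR.
rewrite eA det_hermitian_diag // lecR -[N in d ^+ N]card_ord -prodr_const.
by apply: ler_prod => i _; rewrite (ltW d0) dl.
Qed.

Lemma posdef_det_gt0 (A : 'M[C]_N) : adjmx A = A -> posdefmx A -> 0 < \det A.
Proof.
move=> hA pA; have [d d0 dA] := posdef_bound hA pA.
by apply: lt_le_trans (bound_det hA d0 dA); rewrite ltcR exprn_gt0.
Qed.

Lemma inM_det_gt0 Z : inM Z -> 0 < \det (1%:M - Z *m adjmx Z).
Proof. by case=> _; apply/posdef_det_gt0/herm_ZZ. Qed.

Lemma inM_unit Z : inM Z -> 1%:M - Z *m adjmx Z \in unitmx.
Proof. by move=> /inM_det_gt0 h; rewrite unitmxE unitfE gt_eqF. Qed.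

Lemma inM_unit' Z : inM Z -> 1%:M - adjmx Z *m Z \in unitmx.
Proof. by move=> hZ; rewrite -tr_sym_ZZ ?unitmx_tr ?inM_unit //; case: hZ. Qed.

(** With [1 - Z Z^* = P^* diag(l) P], the choice is [U = P^* diag(l)^(-1/2)]. *)
Lemma exists_U Z : inM Z ->
  exists U, U *m adjmx U = invmx (1%:M - Z *m adjmx Z).
Proof.
move=> hZ; set A := _ - _.
have hA : adjmx A = A by exact: herm_ZZ.
have [P [l [P1 P2 eA]]] := hermitian_diag hA.
have lpos i : 0 < l i.
  have [] := hermitian_diag_eigen l i P1; rewrite -eA.
  set v := _ *m _ => e1 e2; rewrite -(@ltcR R) -e1; apply: hZ.2.
  by apply/eqP => v0; move/eqP: e2; rewrite v0 mulmx0 mxE eq_sym oner_eq0.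
pose D := diag_mx (\row_i ((Num.sqrt (l i))^-1)%:C%C) : 'M[C]_N.
have hD : adjmx D = D.
  apply/matrixP => i j; rewrite adjmxE !mxE eq_sym; case: eqP => [->|_].
    by rewrite !mulr1n; apply: conjc_real.
  by rewrite !mulr0n conjC0.
exists (adjmx P *m D); apply: (can_inj (mulKmx (inM_unit hZ))).
rewrite mulmxV ?inM_unit // adjmxM adjmxK hD -/A eA.
rewrite !mulmxA -[_ *m P *m adjmx P]mulmxA P1 mulmx1.
set E := diag_mx _.
suff h : E *m (D *m D) = 1%:M by rewrite -(mulmxA _ E) -(mulmxA _ (E *m D)) -(mulmxA E) h mulmx1.
rewrite !mulmx_diag; apply/matrixP => i j; rewrite !mxE; congr (_ *+ _).
rewrite -!rmorphM -invfM -expr2 sqr_sqrtr ?ltW // mulfV ?rmorph1 //.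
by rewrite gt_eqF.
Qed.

Lemma U_unique Z U V : inM Z ->
  U *m adjmx U = invmx (1%:M - Z *m adjmx Z) ->
  V *m adjmx V = invmx (1%:M - Z *m adjmx Z) ->
  exists W : 'M[C]_N, W *m adjmx W = 1%:M /\ V = U *m W.
Proof.
move=> hZ hU hV.
have uU : U \in unitmx.
  have : U *m adjmx U \in unitmx by rewrite hU unitmx_inv inM_unit.
  by rewrite unitmx_mul => /andP[].
exists (invmx U *m V); rewrite mulKVmx //; split=> //.
rewrite adjmxM mulmxA -[_ *m V *m adjmx V]mulmxA hV -hU mulmxA mulVmx // mul1mx.
by rewrite adjmxV mulmxV // /adjmx unitmx_tr map_unitmx.
Qed.

(** Symmetry of [Z] makes [1 - Z^* Z] the transpose of [1 - Z Z^*], so its inverse is [mxconj U]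
    times the adjoint of [mxconj U]; cyclicity of the trace does the rest. *)
Lemma hform_U Z U X Y : inM Z ->
  U *m adjmx U = invmx (1%:M - Z *m adjmx Z) ->
  hform Z X Y = \tr ((adjmx U *m X *m mxconj U)
                              *m adjmx (adjmx U *m Y *m mxconj U)).
Proof.
move=> hZ hU; rewrite /hform -hU.
have -> : invmx (1%:M - adjmx Z *m Z) = mxconj U *m adjmx (mxconj U).
  have {1}<- := tr_sym_ZZ hZ.1; rewrite -trmx_inv -hU trmx_mul; congr (_ *m _).
    by rewrite /adjmx trmxK.
  by apply/matrixP => i j; rewrite adjmxE !mxE conjCK.
rewrite !adjmxM adjmxK; move: (adjmx U) (mxconj U) (adjmx Y) => A B D.
by rewrite !mulmxA [RHS]mxtrace_mulC !mulmxA.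
Qed.

Lemma hform_herm Z X Y : hform Z Y X = (hform Z X Y)^*.
Proof.
rewrite /hform -tr_adjmx !adjmxM !adjmxK !adjmxV herm_ZZ.
have -> : adjmx (1%:M - adjmx Z *m Z) = 1%:M - adjmx Z *m Z.
  by rewrite adjmxB adjmx1 adjmxM adjmxK.
move: (invmx _) (invmx _) (adjmx X) => A B D.
by rewrite -!(mulmxA B) mxtrace_mulC !mulmxA.
Qed.

Lemma hformZl Z c X Y : hform Z (c *: X) Y = c * hform Z X Y.
Proof. by rewrite /hform -scalemxAr -!scalemxAl mxtraceZ. Qed.

(** The value is the squared Hilbert-Schmidt norm of [adjmx U *m X *m mxconj U], nonzero since [U]
    is invertible. *)
Lemma gform_gt0 Z X : inM Z -> X != 0 -> 0 < gform Z X X.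
Proof.
move=> hZ X0; have [U hU] := exists_U hZ.
rewrite /gform (hform_U X X hZ hU); set T := adjmx U *m X *m mxconj U.
have uU : U \in unitmx.
  have : U *m adjmx U \in unitmx by rewrite hU unitmx_inv inM_unit.
  by rewrite unitmx_mul => /andP[].
have T0 : T != 0.
  apply: contra_neq X0 => T0.
  have ua : adjmx U \in unitmx by rewrite /adjmx unitmx_tr map_unitmx.
  have uc : mxconj U \in unitmx by rewrite /mxconj map_unitmx.
  by rewrite -(mulKmx ua X) -(mulmxK uc (adjmx U *m X)) -/T T0 mul0mx mulmx0.
suff : 0 < \tr (T *m adjmx T) by rewrite ltcE => /andP[].
have -> : \tr (T *m adjmx T) = \sum_i \sum_j `|T i j| ^+ 2.
  by apply: eq_bigr => i _; rewrite mxE; apply: eq_bigr => j _; rewrite adjmxE normCK.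
have [i [j Tij]] : exists i j, T i j != 0.
  apply: contrapT => h; move/eqP: T0; apply; apply/matrixP => i j; rewrite [RHS]mxE.
  by apply: contrapT => /eqP ?; apply: h; exists i, j.
rewrite (bigD1 i) //= (bigD1 j) //=.
rewrite -addrA ltr_pwDl ?exprn_gt0 ?normr_gt0 //.
rewrite addr_ge0 ?sumr_ge0 // => *; rewrite ?sumr_ge0 // => *; exact: exprn_ge0.
Qed.

(** Openness along complex lines, with a lower bound for the determinant that is uniform on the
    disc; it later becomes the uniform norm bound for the squeezed vectors. *)
Lemma inM_line Z X : inM Z -> X^T = X ->
  exists2 r : R, 0 < r & exists2 m : R, 0 < m & forall z : C, `|z| <= r%:C%C ->
    inM (Z + z *: X) /\ m%:C%C <= \det (1%:M - (Z + z *: X) *m adjmx (Z + z *: X)).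
Proof.
move=> [sZ pZ] sX; have [d d0 dA] := posdef_bound (herm_ZZ Z) pZ.
pose nrm (A : 'M[C]_N) : R := \sum_i \sum_j complex.Re `|A i j|.
have nrmE A : (nrm A)%:C%C = \sum_i \sum_j `|A i j|.
  rewrite /nrm rmorph_sum; apply: eq_bigr => i _; rewrite rmorph_sum.
  by apply: eq_bigr => j _; exact: normR_C.
have nrm0 A : 0 <= nrm A.
  by rewrite -(@lecR R) nrmE; apply: sumr_ge0 => i _; apply: sumr_ge0.
pose B1 := nrm (X *m adjmx Z); pose B2 := nrm (Z *m adjmx X).
pose B3 := nrm (X *m adjmx X).
pose B := B1 + B2 + B3.
have B0 : 0 <= B by rewrite !addr_ge0 // /B1 /B2 /B3; apply: nrm0.
(* For [|z| <= r <= 1] the three perturbation terms add up to at most [r B <= d / 2], half of the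
   gap [d]; the denominator [B + 1] cannot vanish. *)
pose r := Num.min 1 (d / 2 / (B + 1)).
have r0 : 0 < r.
  by rewrite lt_min ltr01 /= divr_gt0 ?divr_gt0 // ltr_wpDl.
exists r => //; exists ((d / 2) ^+ N); first by rewrite exprn_gt0 // divr_gt0.
move=> z zr; set W := Z + _.
have sW : W^T = W by rewrite linearD linearZ /= sZ sX.
have bound (v : 'cV[C]_N) : (d / 2)%:C%C * (adjmx v *m v) 0 0 <=
    (adjmx v *m (1%:M - W *m adjmx W) *m v) 0 0.
  set q := (adjmx v *m v) 0 0.
  have q0 : 0 <= q by rewrite /q quad1E; apply: sumr_ge0 => *; exact: exprn_ge0.
  pose E := z *: (X *m adjmx Z) + z^* *: (Z *m adjmx X) + (z * z^*) *: (X *m adjmx X).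
  have eW : 1%:M - W *m adjmx W = (1%:M - Z *m adjmx Z) - E.
    rewrite /W /E adjmxD adjmxZ mulmxDl !mulmxDr -!scalemxAl -!scalemxAr !scalerA.
    exact: sub4.
  have z1 : `|z| <= 1 by apply: le_trans zr _; rewrite lecR ge_min lexx.
  have hE : `|(adjmx v *m E *m v) 0 0| <= (r * B)%:C%C * q.
    rewrite [(_ *m E *m _) 0 0]quad_comb3.
    apply: le_trans (ler_normD _ _) _.
    rewrite /B mulrDr rmorphD /= mulrDl; apply: lerD.
      apply: le_trans (ler_normD _ _) _.
      rewrite mulrDr rmorphD /= mulrDl; apply: lerD;
        rewrite normrM ?norm_conjC rmorphM /= -mulrA nrmE; apply: ler_pM => //;
        exact: quad_le.
    rewrite normrM rmorphM /= -mulrA nrmE; apply: ler_pM => //; last exact: quad_le.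
    by rewrite normrM norm_conjC; apply: le_trans zr; rewrite ler_piMr.
  have rB : r * B <= d / 2.
    have h : r <= d / 2 / (B + 1) by rewrite ge_min lexx orbT.
    apply: le_trans (_ : r * (B + 1) <= _); first by rewrite ler_wpM2l ?ltW // ltrDl.
    by rewrite -ler_pdivlMr // ltr_wpDl.
  rewrite eW quadB.
  have rE : (adjmx v *m E *m v) 0 0 <= (d / 2)%:C%C * q.
    apply: le_trans (_ : (r * B)%:C%C * q <= _).
      apply: le_trans hE; apply: real_ler_norm.
      have real A : adjmx A = A -> (adjmx v *m A *m v) 0 0 \is Num.real.
        by move=> hA; rewrite CrealE -quad_adj hA.
      have -> : (adjmx v *m E *m v) 0 0 = (adjmx v *m (1%:M - Z *m adjmx Z) *m v) 0 0
          - (adjmx v *m (1%:M - W *m adjmx W) *m v) 0 0.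
        by rewrite eW (quadB _ E) opprB addrCA subrr addr0.
      by apply: rpredB; apply: real; exact: herm_ZZ.
    by rewrite ler_wpM2r // lecR.
  apply: le_trans (lerB (dA v) rE).
  rewrite -/q -mulrBl -rmorphB /=.
  by rewrite (_ : d - d / 2 = d / 2) //; lra.
split; last by apply: bound_det => //; [exact: herm_ZZ|rewrite divr_gt0].
split; [exact: sW|move=> v v0]; apply: lt_le_trans (bound v) => {bound}.
rewrite mulr_gt0 ?ltcR ?divr_gt0 // quad1E.
have [i vi] : exists i, v i 0 != 0.
  apply: contrapT => h; move/eqP: v0; apply; apply/matrixP => i j.
  by rewrite mxE ord1; apply: contrapT => /eqP ?; apply: h; exists i.
rewrite (bigD1 i) //= ltr_pwDl ?exprn_gt0 ?normr_gt0 // sumr_ge0 // => *; exact: exprn_ge0.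
Qed.

End Domain.

(** * Derivatives at 0 of complex-valued curves *)

Section ComplexDerivative.
Variable R : realType.
Local Notation C := R[i].

(** The variable is real and the components are differentiated separately, since the curves involve
    conjugates and are not holomorphic. *)
Definition cderiv (f : R -> C) (l : C) : Prop :=
  is_derive (0 : R) (1 : R) (fun t => complex.Re (f t)) (complex.Re l) /\
  is_derive (0 : R) (1 : R) (fun t => complex.Im (f t)) (complex.Im l).

Lemma cderiv_eq f l m : cderiv f l -> l = m -> cderiv f m.
Proof. by move=> + <-. Qed.

Lemma cderiv_cst c : cderiv (fun=> c) 0.
Proof. by split; exact: is_derive_cst. Qed.

Lemma cderiv_real : cderiv (fun t => t%:C%C) 1.
Proof. by split; [exact: is_derive_id|exact: is_derive_cst]. Qed.

Lemma cderivD f g l m : cderiv f l -> cderiv g m ->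
  cderiv (fun t => f t + g t) (l + m).
Proof.
move=> [f1 f2] [g1 g2]; split; rewrite ?cReD ?cImD.
  under eq_fun do rewrite cReD; exact: is_deriveD.
under eq_fun do rewrite cImD; exact: is_deriveD.
Qed.

Lemma cderivN f l : cderiv f l -> cderiv (fun t => - f t) (- l).
Proof.
move=> [f1 f2]; split; rewrite ?cReN ?cImN.
  under eq_fun do rewrite cReN; exact: is_deriveN.
under eq_fun do rewrite cImN; exact: is_deriveN.
Qed.

Lemma cderivJ f l : cderiv f l -> cderiv (fun t => (f t)^*) (l^*).
Proof.
move=> [f1 f2]; split; rewrite ?cReJ ?cImJ.
  by under eq_fun do rewrite cReJ.
by under eq_fun do rewrite cImJ; exact: is_deriveN.
Qed.

Lemma is_deriveM0 (f g : R -> R) l m : is_derive (0 : R) (1 : R) f l ->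
  is_derive (0 : R) (1 : R) g m ->
  is_derive (0 : R) (1 : R) (fun t => f t * g t) (l * g 0 + f 0 * m).
Proof.
move=> df dg; apply: (@is_derive_eq _ _ _ (f * g)).
rewrite /GRing.scale /= addrC mulrC //.
Qed.

Lemma cderivM f g l m : cderiv f l -> cderiv g m ->
  cderiv (fun t => f t * g t) (l * g 0 + f 0 * m).
Proof.
move=> [f1 f2] [g1 g2]; split; rewrite ?cReD ?cImD ?cReM ?cImM.
  under eq_fun do rewrite cReM.
  apply: is_derive_eq (is_deriveB (is_deriveM0 f1 g1) (is_deriveM0 f2 g2)) _.
  by ring.
under eq_fun do rewrite cImM.
apply: is_derive_eq (is_deriveD (is_deriveM0 f1 g2) (is_deriveM0 f2 g1)) _.
by ring.
Qed.

Lemma cderiv_sum (I : Type) (r : seq I) (f : I -> R -> C) (l : I -> C) :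
  (forall i, cderiv (f i) (l i)) ->
  cderiv (fun t => \sum_(i <- r) f i t) (\sum_(i <- r) l i).
Proof.
move=> h; elim: r => [|i r IH].
  by rewrite big_nil; under eq_fun do rewrite big_nil; exact: cderiv_cst.
rewrite big_cons; under eq_fun do rewrite big_cons; exact: cderivD.
Qed.

Lemma cderiv_prod (I : eqType) (r : seq I) (f : I -> R -> C) (l : I -> C) :
  uniq r -> (forall i, cderiv (f i) (l i)) ->
  cderiv (fun t => \prod_(i <- r) f i t)
    (\sum_(i <- r) l i * \prod_(j <- r | j != i) f j 0).
Proof.
move=> + h; elim: r => [_|i r IH /= /andP[ir /IH {}IH]].
  by rewrite big_nil; under eq_fun do rewrite big_nil; exact: cderiv_cst.
under eq_fun do rewrite big_cons.
apply: cderiv_eq (cderivM (h i) IH) _.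
rewrite big_cons big_cons eqxx /=; congr (_ * _ + _).
  rewrite big_seq [RHS]big_seq_cond; apply: eq_bigl => j; case: (boolP (j \in r)) => //= jr.
  by apply/esym; apply: contraNneq ir => <-.
rewrite mulr_sumr; apply: eq_big_seq => j jr.
rewrite big_cons; have -> : (i != j) by apply: contraNneq ir => ->.
by rewrite mulrCA.
Qed.

Lemma cderiv_near f g l : (\forall t \near (0 : R), f t = g t) ->
  cderiv f l -> cderiv g l.
Proof.
move=> fg [f1 f2]; split.
  by apply: near_eq_is_derive f1; apply: filterS fg => t ->.
by apply: near_eq_is_derive f2; apply: filterS fg => t ->.
Qed.

Lemma cderiv_uniq f l m : cderiv f l -> cderiv f m -> l = m.
Proof.
move=> [f1 f2] [g1 g2]; apply: complex_ext.
  by rewrite -(@derive_val _ _ _ _ _ _ _ f1) -(@derive_val _ _ _ _ _ _ _ g1).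
by rewrite -(@derive_val _ _ _ _ _ _ _ f2) -(@derive_val _ _ _ _ _ _ _ g2).
Qed.

Lemma is_derive_continuous0 (f : R -> R) l : is_derive (0 : R) (1 : R) f l ->
  {for (0 : R), continuous f}.
Proof.
move=> df; apply/differentiable_continuous/derivable1_diffP.
exact: ex_derive.
Qed.

Lemma is_derive_alt3 (f1 f2 f3 : R -> R) (l1 l2 l3 : R) :
  is_derive (0 : R) (1 : R) f1 l1 -> is_derive (0 : R) (1 : R) f2 l2 ->
  is_derive (0 : R) (1 : R) f3 l3 -> l1 - l2 + l3 = 0 ->
  [/\ derivable f1 0 1, derivable f2 0 1, derivable f3 0 1 &
      derive1 f1 0 - derive1 f2 0 + derive1 f3 0 = 0].
Proof.
move=> d1 d2 d3 e; split; [exact: (@ex_derive _ _ _ _ _ _ _ d1)|exact: (@ex_derive _ _ _ _ _ _ _ d2)|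
  exact: (@ex_derive _ _ _ _ _ _ _ d3)|].
by rewrite !derive1E (@derive_val _ _ _ _ _ _ _ d1) (@derive_val _ _ _ _ _ _ _ d2)
  (@derive_val _ _ _ _ _ _ _ d3) e.
Qed.

(** Each of the six imaginary parts cancels against the one with its first two arguments exchanged;
    conjugation and the alternating signs fit together. *)
Lemma im_cyclic (T : Type) (S : T -> T -> T -> C) (X Y W : T) :
  (forall A B D, S A B D = S B A D) ->
  - complex.Im (S X Y W + (S X W Y)^*) - - complex.Im (S Y X W + (S Y W X)^*)
  + - complex.Im (S W X Y + (S W Y X)^*) = 0.
Proof.
by move=> sS; rewrite (sS Y X) (sS W X) (sS W Y) !cImD !cImJ; ring.
Qed.

Lemma cderiv_near_neq0 f l : cderiv f l -> f 0 != 0 -> \forall t \near (0 : R), f t != 0.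
Proof.
move=> [f1 f2] f0.
have [r0|r0] := eqVneq (complex.Re (f 0)) 0.
  have i0 : complex.Im (f 0) != 0.
    by apply: contraNneq f0 => i0; apply/eqP; exact: complex_ext.
  have /cvgr_neq0 : complex.Im (f t) @[t --> (0:R)] --> complex.Im (f 0).
    exact: is_derive_continuous0 f2.
  move=> /(_ i0); apply: filterS => t; apply: contraNneq => ->; by [].
have /cvgr_neq0 : complex.Re (f t) @[t --> (0:R)] --> complex.Re (f 0).
  exact: is_derive_continuous0 f1.
move=> /(_ r0); apply: filterS => t; apply: contraNneq => ->; by [].
Qed.

(** Uses [1 / f = conj f / |f|^2]. The value is left existential: the derivative of an inverse
    matrix is read off later from [M M^-1 = 1]. *)
Lemma cderivV f l : cderiv f l -> f 0 != 0 -> exists m, cderiv (fun t => (f t)^-1) m.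
Proof.
move=> [f1 f2] f0.
pose n t := complex.Re (f t) * complex.Re (f t) + complex.Im (f t) * complex.Im (f t).
have n0 : n 0 != 0.
  apply: contraNneq f0 => /eqP; rewrite /n paddr_eq0 -?expr2 ?sqr_ge0 //.
  by rewrite !sqrf_eq0 => /andP[/eqP ? /eqP ?]; apply/eqP; exact: complex_ext.
have dn := is_deriveD (is_deriveM0 f1 f1) (is_deriveM0 f2 f2).
have dV := @is_deriveV _ n _ _ _ n0 dn.
have d1 := is_deriveM0 f1 dV.
have fN : is_derive (0 : R) (1 : R) (fun t => - complex.Im (f t)) (- complex.Im l).
  exact: is_deriveN f2.
have d2 := is_deriveM0 fN dV.
eexists (Complex _ _); split => /=.
  apply: near_eq_is_derive d1; near=> t.
  by rewrite /n; case: (f t) => a b /=; rewrite -!expr2.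
apply: near_eq_is_derive d2; near=> t.
by rewrite /n; case: (f t) => a b /=; rewrite -!expr2 mulNr.
Unshelve. all: by end_near. Qed.

End ComplexDerivative.

(** * Jacobi's formula and the derivative of the inverse matrix *)

Section MatrixDerivative.
Variable R : realType.
Local Notation C := R[i].

Definition mxderiv m n (M : R -> 'M[C]_(m, n)) (L : 'M[C]_(m, n)) :=
  forall i j, cderiv (fun t => M t i j) (L i j).

Lemma mxderiv_eq m n (M : R -> 'M[C]_(m, n)) L L' :
  mxderiv M L -> L = L' -> mxderiv M L'.
Proof. by move=> + <-. Qed.

Lemma mxderiv_cst m n (A : 'M[C]_(m, n)) : mxderiv (fun=> A) 0.
Proof. by move=> i j; rewrite mxE; exact: cderiv_cst. Qed.

Lemma mxderiv_line m n (Z X : 'M[C]_(m, n)) :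
  mxderiv (fun t => Z + (t%:C)%C *: X) X.
Proof.
move=> i j; under eq_fun do rewrite !mxE.
apply: cderiv_eq (cderivD (cderiv_cst _) (cderivM (@cderiv_real R) (cderiv_cst _))) _.
by rewrite mul1r mulr0 addr0 add0r.
Qed.

Lemma mxderivD m n (M N : R -> 'M[C]_(m, n)) L K : mxderiv M L -> mxderiv N K ->
  mxderiv (fun t => M t + N t) (L + K).
Proof.
move=> dM dN i j; under eq_fun do rewrite mxE; rewrite mxE; exact: cderivD.
Qed.

Lemma mxderivN m n (M : R -> 'M[C]_(m, n)) L : mxderiv M L ->
  mxderiv (fun t => - M t) (- L).
Proof. by move=> dM i j; under eq_fun do rewrite mxE; rewrite mxE; exact: cderivN. Qed.

Lemma mxderivM m n p (M : R -> 'M[C]_(m, n)) (N : R -> 'M[C]_(n, p)) L K :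
  mxderiv M L -> mxderiv N K ->
  mxderiv (fun t => M t *m N t) (L *m N 0 + M 0 *m K).
Proof.
move=> dM dN i j; under eq_fun do rewrite mxE.
apply: cderiv_eq (cderiv_sum _ (fun k => cderivM (dM i k) (dN k j))) _.
by rewrite !mxE -big_split.
Qed.

Lemma mxderiv_adj m n (M : R -> 'M[C]_(m, n)) L : mxderiv M L ->
  mxderiv (fun t => adjmx (M t)) (adjmx L).
Proof.
by move=> dM i j; under eq_fun do rewrite adjmxE; rewrite adjmxE; exact: cderivJ.
Qed.

Lemma cderiv_tr n (M : R -> 'M[C]_n) L : mxderiv M L ->
  cderiv (fun t => \tr (M t)) (\tr L).
Proof. by move=> dM; exact: cderiv_sum. Qed.

(** Both sides are the determinant of [M] with row [i] taken from [L]: by the Leibniz formula on the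
    left, by expansion along that row on the right. *)
Lemma det_row_replace n (M L : 'M[C]_n) i :
  \sum_(s : 'S_n) (-1) ^+ s * (L i (s i) * \prod_(j | j != i) M j (s j)) =
  \sum_j L i j * cofactor M i j.
Proof.
pose T := \matrix_(a, b) if a == i then L i b else M a b.
have -> : \sum_(s : 'S_n) (-1) ^+ s * (L i (s i) * \prod_(j | j != i) M j (s j)) = \det T.
  apply: eq_bigr => s _; congr (_ * _).
  rewrite [RHS](bigD1 i) //= mxE eqxx; congr (_ * _).
  by apply: eq_bigr => j ji; rewrite mxE (negbTE ji).
rewrite (expand_det_row T i); apply: eq_bigr => j _; rewrite mxE eqxx; congr (_ * _).
rewrite /cofactor; congr (_ * \det _); apply/matrixP => a b.
by rewrite !mxE eq_sym (negbTE (neq_lift _ _)).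
Qed.

Lemma cderiv_det n (M : R -> 'M[C]_n) L : mxderiv M L ->
  cderiv (fun t => \det (M t)) (\tr (L *m \adj (M 0))).
Proof.
move=> dM.
have h (s : 'S_n) : cderiv (fun t => (-1) ^+ s * \prod_i M t i (s i))
    ((-1) ^+ s * \sum_i (L i (s i) * \prod_(j | j != i) M 0 j (s j))).
  have dp := cderiv_prod (index_enum_uniq _) (fun i => dM i (s i)).
  by apply: cderiv_eq (cderivM (cderiv_cst _) dp) _; rewrite mul0r add0r.
apply: cderiv_eq (cderiv_sum _ h) _.
under eq_bigr do rewrite mulr_sumr.
rewrite exchange_big; apply: eq_bigr => i _ /=.
rewrite det_row_replace mxE; apply: eq_bigr => j _; by rewrite mxE.
Qed.

Lemma mxderiv_adjugate n (M : R -> 'M[C]_n) L : mxderiv M L ->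
  exists K, mxderiv (fun t => \adj (M t)) K.
Proof.
move=> dM.
suff h i j : exists l, cderiv (fun t => \adj (M t) i j) l.
  exists (\matrix_(i, j) projT1 (cid (h i j))) => i j.
  by rewrite mxE; exact: projT2 (cid (h i j)).
eexists; under eq_fun do rewrite mxE.
apply: cderivM; first exact: cderiv_cst.
apply: (cderiv_det (L := row' j (col' i L))) => a b.
under eq_fun do rewrite !mxE; rewrite !mxE; exact: dM.
Qed.

(** Cramer's rule gives differentiability with an unknown value; differentiating [M M^-1 = 1] then
    determines it. *)
Lemma mxderiv_inv n (M : R -> 'M[C]_n) L : mxderiv M L -> M 0 \in unitmx ->
  mxderiv (fun t => invmx (M t)) (- (invmx (M 0) *m L *m invmx (M 0))).
Proof.
move=> dM uM.
have d0 : \det (M 0) != 0 by rewrite -unitfE -unitmxE.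
have dd := cderiv_det dM; have [K dK] := mxderiv_adjugate dM.
have [l dl] := cderivV dd d0.
have nu : \forall t \near (0 : R), M t \in unitmx.
  apply: filterS (cderiv_near_neq0 dd d0) => t; by rewrite unitmxE unitfE.
have dI : mxderiv (fun t => invmx (M t)) (l *: \adj (M 0) + (\det (M 0))^-1 *: K).
  move=> i j; apply: cderiv_near; last first.
    apply: cderiv_eq (cderivM dl (dK i j)) _.
    by rewrite [RHS]mxE; congr (_ + _); rewrite [RHS]mxE.
  by near=> t; rewrite /invmx (near nu) // [RHS]mxE.
set I' := _ + _ in dI.
have e : L *m invmx (M 0) + M 0 *m I' = 0.
  apply/matrixP => i j; rewrite [RHS]mxE; apply: cderiv_uniq (mxderivM dM dI i j) _.
  apply: cderiv_near (cderiv_cst ((1%:M : 'M[C]_n) i j)).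
  near=> t; have ut : M t \in unitmx by near: t.
  by rewrite (mulmxV ut).
apply: mxderiv_eq dI _; rewrite -[I'](mulKmx uM).
move/eqP: e; rewrite addrC addr_eq0 => /eqP ->.
by rewrite mulmxN mulmxA.
Unshelve. all: by end_near. Qed.

End MatrixDerivative.

(** * Trace identities over a commutative ring *)

Section TraceIdentities.
Variables (F : comNzRingType) (n : nat).
Implicit Types k l X Y Z W x y z w : 'M[F]_n.

Lemma trace_conj k l Z Y w x : k *m Z = Z *m l ->
  \tr (Y *m (l *m (w *m (Z *m (l *m (x *m k)))))) =
  \tr (k *m Z *m x *m k *m Y *m l *m w).
Proof.
move=> e1; rewrite (mulmxA Z l) -e1 (mulmxA Y) (mulmxA (Y *m l)).
by rewrite mxtrace_mulC !mulmxA.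
Qed.

(** Read with [k = (1 - Z Z^* )^-1], [l = (1 - Z^* Z)^-1] and [z], [x], [w] the adjoints of [Z],
    [X], [W]: the left side is the derivative of [h(Y, W)] along [X], as the product rule delivers
    it. The two intertwining relations bring its four terms to a common shape. *)
Lemma trace_dh k l X z Z x Y w : z *m k = l *m z -> k *m Z = Z *m l ->
  \tr (((k *m (X *m z + Z *m x) *m k *m Y + k *m 0) *m l +
    k *m Y *m (l *m (x *m Z + z *m X) *m l)) *m w + k *m Y *m l *m 0) =
  (\tr (k *m X *m l *m z *m Y *m l *m w) + \tr (k *m Y *m l *m z *m X *m l *m w)) +
  (\tr (k *m Z *m x *m k *m Y *m l *m w) + \tr (k *m Z *m w *m k *m Y *m l *m x)).
Proof.
move=> e2 e1; rewrite !mulmx0 !addr0.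
rewrite !(mulmxDl, mulmxDr) !mulmxA -(mulmxA (k *m X) z k) e2 !mulmxA.
rewrite -(mulmxA (k *m Y *m l *m x) Z l) -e1 !mulmxA !mxtraceD.
have -> : \tr (k *m Y *m l *m x *m k *m Z *m w) = \tr (k *m Z *m w *m k *m Y *m l *m x).
  rewrite -(mulmxA _ k Z) -(mulmxA _ (k *m Z) w) -(mulmxA _ l x) -(mulmxA k Y (l *m x)).
  by rewrite mxtrace_mulC !mulmxA.
by rewrite [X in _ + X = _]addrC addrACA.
Qed.

(** The expansion of [l] merges the two terms linear in [X] into a single one. *)
Lemma trace_dpot k l X z Z x y : l = 1%:M + z *m k *m Z ->
  \tr ((k *m (X *m z + Z *m x) *m k *m Z + k *m X) *m y) =
  \tr (k *m X *m l *m y) + \tr (k *m Z *m x *m k *m Z *m y).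
Proof.
move=> ->; rewrite !(mulmxDl, mulmxDr) !mulmxA mulmx1 !mxtraceD.
by rewrite addrC addrA.
Qed.

Lemma trace_hermitian_part k Y w W y :
  \tr (- (Y *m w + W *m y) *m k) = - (\tr (Y *m w *m k) + \tr (k *m W *m y)).
Proof. by rewrite mulNmx mulmxDl linearN linearD /= (mxtrace_mulC (W *m y)) mulmxA. Qed.

Lemma trace_scale2 c d k x l Z y :
  \tr (k *m (c *: x) *m l *m Z *m (d *: y)) = c * d * \tr (k *m x *m l *m Z *m y).
Proof. by rewrite -!(scalemxAr, scalemxAl) scalerA mxtraceZ mulrC [d * c]mulrC mulrC. Qed.

End TraceIdentities.

(** * Closedness of omega and the Kahler potential *)

Section KahlerCalculus.
Variables (R : realType) (N : nat).
Local Notation C := R[i].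
Implicit Types Z X Y W : 'M[C]_N.

Let K Z := invmx (1%:M - Z *m adjmx Z).
Let L Z := invmx (1%:M - adjmx Z *m Z).

Lemma mxderiv_ZZ Z X :
  mxderiv (fun t => 1%:M - (Z + (t%:C)%C *: X) *m adjmx (Z + (t%:C)%C *: X))
    (- (X *m adjmx Z + Z *m adjmx X)).
Proof.
have d := mxderiv_line Z X.
apply: mxderiv_eq (mxderivD (mxderiv_cst _) (mxderivN (mxderivM d (mxderiv_adj d)))) _.
by rewrite add0r scale0r addr0.
Qed.

Lemma mxderiv_ZZ' Z X :
  mxderiv (fun t => 1%:M - adjmx (Z + (t%:C)%C *: X) *m (Z + (t%:C)%C *: X))
    (- (adjmx X *m Z + adjmx Z *m X)).
Proof.
have d := mxderiv_line Z X.
apply: mxderiv_eq (mxderivD (mxderiv_cst _) (mxderivN (mxderivM (mxderiv_adj d) d))) _.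
by rewrite add0r scale0r addr0.
Qed.

Lemma mxderiv_K Z X : inM Z ->
  mxderiv (fun t => invmx (1%:M - (Z + (t%:C)%C *: X) *m adjmx (Z + (t%:C)%C *: X)))
    (K Z *m (X *m adjmx Z + Z *m adjmx X) *m K Z).
Proof.
move=> hZ; have u := inM_unit hZ.
have d := mxderiv_inv (mxderiv_ZZ Z X).
rewrite /= scale0r addr0 in d; apply: mxderiv_eq (d u) _.
by rewrite mulmxN mulNmx opprK.
Qed.

Lemma mxderiv_L Z X : inM Z ->
  mxderiv (fun t => invmx (1%:M - adjmx (Z + (t%:C)%C *: X) *m (Z + (t%:C)%C *: X)))
    (L Z *m (adjmx X *m Z + adjmx Z *m X) *m L Z).
Proof.
move=> hZ; have u := inM_unit' hZ.
have d := mxderiv_inv (mxderiv_ZZ' Z X).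
rewrite /= scale0r addr0 in d; apply: mxderiv_eq (d u) _.
by rewrite mulmxN mulNmx opprK.
Qed.

Lemma KZ_ZL Z : inM Z -> K Z *m Z = Z *m L Z.
Proof.
move=> hZ; have u := inM_unit hZ; have u' := inM_unit' hZ.
apply: (can_inj (mulKmx u)); rewrite mulKVmx // mulmxA.
rewrite (_ : (1%:M - Z *m adjmx Z) *m Z = Z *m (1%:M - adjmx Z *m Z)) ?mulmxK //.
by rewrite mulmxBl mulmxBr mul1mx mulmx1 mulmxA.
Qed.

Lemma ZK_LZ Z : inM Z -> adjmx Z *m K Z = L Z *m adjmx Z.
Proof.
move=> hZ; have u := inM_unit hZ; have u' := inM_unit' hZ.
apply: (can_inj (mulKmx u')); rewrite mulKVmx // mulmxA.
rewrite (_ : (1%:M - adjmx Z *m Z) *m adjmx Z = adjmx Z *m (1%:M - Z *m adjmx Z)) ?mulmxK //.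
by rewrite mulmxBl mulmxBr mul1mx mulmx1 mulmxA.
Qed.

Lemma L_ZKZ Z : inM Z -> L Z = 1%:M + adjmx Z *m K Z *m Z.
Proof.
move=> hZ; have u' := inM_unit' hZ.
rewrite ZK_LZ // -mulmxA -[1%:M](mulVmx u') -/(L Z) -mulmxDr subrK mulmx1 //.
Qed.

Lemma adj_K Z : adjmx (K Z) = K Z.
Proof. by rewrite /K adjmxV herm_ZZ. Qed.

Lemma adj_L Z : adjmx (L Z) = L Z.
Proof. by rewrite /L adjmxV adjmxB adjmx1 adjmxM adjmxK. Qed.

(* The holomorphic derivative of [hform] in the direction [X]; closedness of omega is
   its symmetry in [X] and [Y]. *)
Definition S3 Z X Y W : C :=
  \tr (K Z *m X *m L Z *m adjmx Z *m Y *m L Z *m adjmx W) +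
  \tr (K Z *m Y *m L Z *m adjmx Z *m X *m L Z *m adjmx W).

Lemma S3C Z X Y W : S3 Z X Y W = S3 Z Y X W.
Proof. exact: addrC. Qed.

Lemma tr_S3_conj Z X W Y : inM Z ->
  (\tr (K Z *m X *m L Z *m adjmx Z *m W *m L Z *m adjmx Y))^* =
  \tr (K Z *m Z *m adjmx X *m K Z *m Y *m L Z *m adjmx W).
Proof.
move=> hZ; have e1 := KZ_ZL hZ.
rewrite -tr_adjmx !adjmxM !adjmxK adj_K adj_L.
exact: trace_conj.
Qed.

(** [S3 Z X Y W] is the holomorphic part; since [h] is Hermitian, the antiholomorphic part is its
    conjugate with [Y] and [W] exchanged. *)
Lemma cderiv_hform Z X Y W : inM Z ->
  cderiv (fun t => hform (Z + (t%:C)%C *: X) Y W) (S3 Z X Y W + (S3 Z X W Y)^*).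
Proof.
move=> hZ; have dK := mxderiv_K X hZ; have dL := mxderiv_L X hZ.
have d := cderiv_tr (mxderivM (mxderivM (mxderivM dK (mxderiv_cst Y)) dL)
  (mxderiv_cst (adjmx W))).
rewrite /= scale0r addr0 in d; apply: cderiv_eq d _.
rewrite /S3 rmorphD /= (tr_S3_conj X W Y hZ) (tr_S3_conj W X Y hZ).
exact: trace_dh (ZK_LZ hZ) (KZ_ZL hZ).
Qed.

Lemma omega_deriv Z X Y W : inM Z ->
  is_derive (0 : R) (1 : R) (fun t => omegaform (Z + (t%:C)%C *: X) Y W)
   (- complex.Im (S3 Z X Y W + (S3 Z X W Y)^*)).
Proof. by move=> hZ; apply: is_deriveN; case: (cderiv_hform X Y W hZ). Qed.

Lemma omega_closed Z X Y W : inM Z ->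
  [/\ derivable (fun t : R => omegaform (Z + (t%:C)%C *: X) Y W) 0 1,
      derivable (fun t : R => omegaform (Z + (t%:C)%C *: Y) X W) 0 1,
      derivable (fun t : R => omegaform (Z + (t%:C)%C *: W) X Y) 0 1 &
      derive1 (fun t : R => omegaform (Z + (t%:C)%C *: X) Y W) 0
    - derive1 (fun t : R => omegaform (Z + (t%:C)%C *: Y) X W) 0
    + derive1 (fun t : R => omegaform (Z + (t%:C)%C *: W) X Y) 0 = 0].
Proof.
move=> hZ; have d1 := omega_deriv X Y W hZ; have d2 := omega_deriv Y X W hZ.
have d3 := omega_deriv W X Y hZ.
exact: (is_derive_alt3 d1 d2 d3 (im_cyclic _ _ _ (S3C Z))).
Qed.

Lemma im_det Z : complex.Im (\det (1%:M - Z *m adjmx Z)) = 0.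
Proof.
have := det_adjmx (1%:M - Z *m adjmx Z); rewrite herm_ZZ.
move=> /(congr1 (@complex.Im _)); rewrite cImJ => h; lra.
Qed.

(** Jacobi's formula for [log det]. The condition is positivity of the determinant because the base
    point [W] will itself move along a direction that may leave the symmetric matrices. *)
Lemma potential_deriv W Y : 0 < \det (1%:M - W *m adjmx W) ->
  is_derive (0 : R) (1 : R) (fun t => potential (W + (t%:C)%C *: Y))
    (- 2 * complex.Re (\tr (K W *m W *m adjmx Y))).
Proof.
move=> d0; have := cderiv_det (mxderiv_ZZ W Y); rewrite /= scale0r addr0 => -[dd _].
have u : 1%:M - W *m adjmx W \in unitmx by rewrite unitmxE unitfE gt_eqF.
have r0 : 0 < complex.Re (\det (1%:M - W *m adjmx W)) by move: d0; rewrite ltcE => /andP[].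
have := @is_derive1_comp _ (@ln R) (fun t : R =>
  complex.Re (\det (1%:M - (W + (t%:C)%C *: Y) *m adjmx (W + (t%:C)%C *: Y)))) 0
  (complex.Re (\det (1%:M - W *m adjmx W)))^-1 _ _ dd.
rewrite /= scale0r addr0 => /(_ (is_derive1_ln r0)) h.
apply: is_derive_eq h _.
have -> : \adj (1%:M - W *m adjmx W) = \det (1%:M - W *m adjmx W) *: K W.
  by rewrite /K /invmx u scalerA mulfV ?scale1r // gt_eqF.
rewrite -scalemxAr mxtraceZ cReM im_det mul0r subr0 mulrA mulVf ?gt_eqF // mul1r.
rewrite trace_hermitian_part.
have -> : \tr (Y *m adjmx W *m K W) = (\tr (K W *m W *m adjmx Y))^*.
  by rewrite -tr_adjmx !adjmxM !adjmxK adj_K mulmxA.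
rewrite cReN cReD cReJ; ring.
Qed.

Lemma near_det_gt0 Z X : inM Z ->
  \forall s \near (0 : R), 0 < \det (1%:M - (Z + (s%:C)%C *: X) *m adjmx (Z + (s%:C)%C *: X)).
Proof.
move=> hZ; have [dd _] := cderiv_det (mxderiv_ZZ Z X).
have /cvgr_gt := is_derive_continuous0 dd.
have r0 : 0 < complex.Re (\det (1%:M - Z *m adjmx Z)).
  by have := inM_det_gt0 hZ; rewrite ltcE => /andP[].
rewrite scale0r addr0 => /(_ _ r0).
by apply: filterS => s hs; rewrite ltcE im_det eqxx.
Qed.

(** The first-order formula holds at all points close to [Z], so it can be differentiated once more.
    In the result [hform] is linear in [X] and antilinear in [Y], while the other trace is
    antilinear in both; [ddbar] keeps the former and cancels the latter. *)
Lemma D2_potential Z X Y : inM Z ->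
  D2 (@potential R N) Z X Y =
  - 2 * complex.Re (hform Z X Y + \tr (K Z *m Z *m adjmx X *m K Z *m Z *m adjmx Y)).
Proof.
move=> hZ; rewrite /D2 derive1E.
have d := mxderiv_line Z X; have dK := mxderiv_K X hZ.
have dT := cderiv_tr (mxderivM (mxderivM dK d) (mxderiv_cst (adjmx Y))).
rewrite /= scale0r addr0 mulmx0 addr0 in dT.
have [dT1 _] := cderiv_eq dT (trace_dpot X (adjmx X) (adjmx Y) (L_ZKZ hZ)).
have dR := is_deriveZ (- 2 : R) dT1.
rewrite -[RHS](@derive_val _ _ _ _ _ _ _ dR); apply: near_eq_derive.
apply: filterS (near_det_gt0 X hZ) => s hs.
rewrite derive1E; have ds := potential_deriv Y hs.
by rewrite (@derive_val _ _ _ _ _ _ _ ds).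
Qed.

Lemma hformZr Z c X Y : hform Z X (c *: Y) = c^* * hform Z X Y.
Proof. by rewrite (hform_herm Z (c *: Y) X) hformZl rmorphM /= -hform_herm. Qed.

Lemma D2_potentialZ Z c d X Y : inM Z ->
  D2 (@potential R N) Z (c *: X) (d *: Y) =
  - 2 * complex.Re (c * (d^* * hform Z X Y) +
     c^* * d^* * \tr (K Z *m Z *m adjmx X *m K Z *m Z *m adjmx Y)).
Proof.
move=> hZ; rewrite (D2_potential _ _ hZ); congr (_ * complex.Re (_ + _)).
  by rewrite hformZl hformZr.
by rewrite (adjmxZ c) (adjmxZ d); exact: trace_scale2.
Qed.

Lemma ddbar_D2 (F : 'M[C]_N -> R) Z X Y a b c d :
  D2 F Z X Y = a -> D2 F Z ('i%C *: X) ('i%C *: Y) = b ->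
  D2 F Z X ('i%C *: Y) = c -> D2 F Z ('i%C *: X) Y = d ->
  ddbar F Z X Y = 4^-1 * Complex (a + b) (c - d).
Proof. by move=> <- <- <- <-. Qed.

Lemma hform_ddbar Z X Y : inM Z -> hform Z X Y = - ddbar (@potential R N) Z X Y.
Proof.
move=> hZ.
have e1 := D2_potential X Y hZ; have e2 := D2_potentialZ 'i%C 'i%C X Y hZ.
have e3 := D2_potentialZ 1 'i%C X Y hZ; have e4 := D2_potentialZ 'i%C 1 X Y hZ.
rewrite (scale1r X) in e3; rewrite (scale1r Y) in e4.
rewrite (ddbar_D2 e1 e2 e3 e4) => {e1 e2 e3 e4}.
move: (hform Z X Y) (\tr _) => [a b] [c d].
have -> : (4^-1 : C) = Complex (4^-1) 0.
  by rewrite -[RHS]/(((4%:R : R)^-1)%:C)%C fmorphV rmorph_nat.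
rewrite !conjCE.
by apply: complex_ext; rewrite ?(cReN, cImN, cReM, cImM) /=; field.
Qed.

End KahlerCalculus.

(** * Occupation numbers *)

Section Occupation.
Variable N : nat.
Implicit Types (n : occ N) (i j : 'I_N).

Lemma occ_incrE n i j : occ_incr n i j = (n j + (j == i))%N.
Proof. by rewrite ffunE. Qed.
Lemma occ_decrE n i j : occ_decr n i j = (n j - (j == i))%N.
Proof. by rewrite ffunE. Qed.

Lemma occ_incrK n i : occ_decr (occ_incr n i) i = n.
Proof. by apply/ffunP => j; rewrite occ_decrE occ_incrE addnK. Qed.

Lemma occ_decrK n i : n i != 0%N -> occ_incr (occ_decr n i) i = n.
Proof.
move=> ni; apply/ffunP => j; rewrite occ_incrE occ_decrE subnK //.
by case: eqP => [->|//]; rewrite lt0n.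
Qed.

Lemma occ_incr_inj i : injective (occ_incr (N := N) ^~ i).
Proof. by move=> n m /= e; rewrite -(occ_incrK n i) e occ_incrK. Qed.

Lemma occ_incrC n i j : occ_incr (occ_incr n i) j = occ_incr (occ_incr n j) i.
Proof. by apply/ffunP => k; rewrite !occ_incrE addnAC. Qed.

Lemma occ_decrC n i j : occ_decr (occ_decr n i) j = occ_decr (occ_decr n j) i.
Proof. by apply/ffunP => k; rewrite !occ_decrE subnAC. Qed.

Lemma occ_incr_decr n i j : i != j ->
  occ_decr (occ_incr n i) j = occ_incr (occ_decr n j) i.
Proof.
move=> ij; apply/ffunP => k; rewrite !occ_incrE !occ_decrE occ_incrE.
by case: (eqVneq k i) => [->|]; rewrite ?(negbTE ij) ?subn0 ?addn0.
Qed.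

Lemma occ_tot_incr n i : occ_tot (occ_incr n i) = (occ_tot n).+1.
Proof.
rewrite /occ_tot; under eq_bigr do rewrite occ_incrE.
rewrite big_split /= -addn1; congr addn.
by rewrite (bigD1 i) //= eqxx big1 // => j /negbTE ->.
Qed.

Lemma occ_tot_decr n i : n i != 0%N -> occ_tot n = (occ_tot (occ_decr n i)).+1.
Proof. by move=> ni; rewrite -(occ_tot_incr _ i) occ_decrK. Qed.

Lemma leq_occ_tot n i : (n i <= occ_tot n)%N.
Proof. by rewrite /occ_tot (bigD1 i) //= leq_addr. Qed.

Lemma occ_fact_decr n i : n i != 0%N ->
  occ_fact n = (n i * occ_fact (occ_decr n i))%N.
Proof.
move=> ni; rewrite /occ_fact (bigD1 i) //= [in RHS](bigD1 i) //= mulnA.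
congr muln.
  by rewrite occ_decrE eqxx subn1; case: (n i) ni => // m _; rewrite factS.
by apply: eq_bigr => j ji; rewrite occ_decrE (negbTE ji) subn0.
Qed.

Definition occ0 : occ N := [ffun=> 0%N].

Lemma finite_occ d : finite_set [set n : occ N | (occ_tot n <= d)%N].
Proof.
have /sub_finite_set := @finite_image {ffun 'I_N -> 'I_d.+1} (occ N) setT
  (fun m => [ffun i => nat_of_ord (m i)]) (@finite_finset _ setT).
apply => n /= nd; exists [ffun i => inord (n i)] => //.
by apply/ffunP => i; rewrite !ffunE inordK // ltnS (leq_trans (leq_occ_tot n i)).
Qed.

End Occupation.

(** * Creation and annihilation operators, and the squeezed vector in the number basis *)

Section Fock.
Variables (R : realType) (N : nat).
Local Notation C := R[i].
Implicit Types (n : occ N) (i j : 'I_N) (f g : occ N -> C).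

Lemma sqrtn2 (m : nat) : sqrtC (m%:R : C) * sqrtC m%:R = m%:R.
Proof. by rewrite -expr2 sqrtCK. Qed.

Lemma sqrtn_conj (m : nat) : (sqrtC (m%:R : C))^* = sqrtC m%:R.
Proof. by apply/CrealP/ger0_real; rewrite sqrtC_ge0 ler0n. Qed.

Lemma sqrtn_normR (m : nat) : normR (sqrtC (m%:R : C)) ^+ 2 = m%:R.
Proof. by apply: complexI; rewrite normR_sqC sqrtn_conj sqrtn2 rmorph_nat. Qed.

Lemma cre_incr i f n : cre i f (occ_incr n i) = sqrtC (n i).+1%:R * f n.
Proof. by rewrite /cre occ_incrE eqxx addn1 /= occ_incrK. Qed.

Lemma cre_ann i f n : cre i (ann i f) n = (n i)%:R * f n.
Proof.
rewrite /cre /ann; case: eqP => [->|/eqP ni]; first by rewrite mul0r.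
rewrite occ_decrK // occ_decrE eqxx subn1 prednK ?lt0n //.
by rewrite mulrA sqrtn2.
Qed.

Lemma ann_cre i j f : ann i (cre j f) = (fun n => cre j (ann i f) n + (i == j)%:R * f n).
Proof.
apply: funext => n; case: eqVneq => [<-|ij].
  by rewrite cre_ann /ann cre_incr mulrA sqrtn2 -mulrDl natr1.
rewrite mul0r addr0 /ann /cre occ_incrE [j == i]eq_sym (negbTE ij) addn0.
case: eqP => [_|_]; first by rewrite mulr0.
by rewrite occ_incr_decr // occ_decrE (negbTE ij) subn0 mulrCA.
Qed.

Lemma cre_cre i j f : cre i (cre j f) = cre j (cre i f).
Proof.
apply: funext => n; have [->//|ij] := eqVneq i j.
rewrite /cre !occ_decrE [j == i]eq_sym (negbTE ij) !subn0.
by case: eqP => _; case: eqP => _; rewrite ?mulr0 // occ_decrC mulrCA.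
Qed.

Lemma ann_sum (I : Type) (r : seq I) (c : I -> C) (f : I -> occ N -> C) i :
  ann i (fun n => \sum_(k <- r) c k * f k n) =
  (fun n => \sum_(k <- r) c k * ann i (f k) n).
Proof.
apply: funext => n; rewrite /ann mulr_sumr; apply: eq_bigr => k _.
by rewrite mulrCA.
Qed.

Lemma cre_sum (I : Type) (r : seq I) (c : I -> C) (f : I -> occ N -> C) i :
  cre i (fun n => \sum_(k <- r) c k * f k n) =
  (fun n => \sum_(k <- r) c k * cre i (f k) n).
Proof.
apply: funext => n; rewrite /cre; case: eqP => _.
  by rewrite big1 // => k _; rewrite mulr0.
by rewrite mulr_sumr; apply: eq_bigr => k _; rewrite mulrCA.
Qed.

Lemma annD f g i : ann i (fun n => f n + g n) = (fun n => ann i f n + ann i g n).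
Proof. by apply: funext => n; rewrite /ann mulrDr. Qed.

Lemma creD f g i : cre i (fun n => f n + g n) = (fun n => cre i f n + cre i g n).
Proof. by apply: funext => n; rewrite /cre; case: eqP => _; [rewrite addr0|rewrite mulrDr]. Qed.

Lemma annZ c f i : ann i (fun n => c * f n) = (fun n => c * ann i f n).
Proof. by apply: funext => n; rewrite /ann mulrCA. Qed.

Lemma creZ c f i : cre i (fun n => c * f n) = (fun n => c * cre i f n).
Proof. by apply: funext => n; rewrite /cre; case: eqP => _; [rewrite mulr0|rewrite mulrCA]. Qed.

Lemma cre0 i : cre i (fun=> 0) = (fun=> 0) :> (occ N -> C).
Proof. by apply: funext => n; rewrite /cre mulr0 if_same. Qed.

Lemma number_op f n : \sum_i cre i (ann i f) n = (occ_tot n)%:R * f n.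
Proof.
by under eq_bigr do rewrite cre_ann; rewrite -mulr_suml -natr_sum.
Qed.

(** The operator [(a^*, Z a^* )]. *)
Definition quadop (Z : 'M[C]_N) f n : C :=
  \sum_(p : 'I_N * 'I_N) Z p.1 p.2 * cre p.1 (cre p.2 f) n.

Definition vac n : C := (n == occ0 N)%:R.

Definition qpow (Z : 'M[C]_N) k : occ N -> C := iter k (quadop Z) vac.

Definition homog (d : nat) f := forall n, occ_tot n <> d -> f n = 0.

Lemma homog_cre d f i : homog d f -> homog d.+1 (cre i f).
Proof.
move=> hf n nd; rewrite /cre; case: eqP => // /eqP ni.
by rewrite hf ?mulr0 // => e; apply: nd; rewrite (occ_tot_decr ni) e.
Qed.

Lemma homog_quadop Z d f : homog d f -> homog d.+2 (quadop Z f).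
Proof.
move=> hf n nd; rewrite /quadop big1 // => p _.
by rewrite (homog_cre _ (homog_cre _ hf)) ?mulr0.
Qed.

Lemma homog_qpow Z k : homog k.*2 (qpow Z k).
Proof.
elim: k => [|k IH]; last exact: homog_quadop.
move=> n n0; rewrite /qpow /= /vac; case: eqP => // e; exfalso; apply: n0.
by rewrite e /occ_tot big1 // => i _; rewrite ffunE.
Qed.

(** A word of [k.+1] pairs is a first pair followed by a word of [k] pairs. The zero tests guard the
    truncated subtraction in [occ_decr]; the second one looks at the index already lowered once, so
    that a pair [(i, i)] requires [n i >= 2]. *)
Lemma qcoefS (Z : 'M[C]_N) k n : qcoef Z k.+1 n =
  \sum_(p : 'I_N * 'I_N) Z p.1 p.2 *
    (if (n p.1 == 0)%N then 0 else if (occ_decr n p.1 p.2 == 0)%N then 0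
     else qcoef Z k (occ_decr (occ_decr n p.1) p.2)).
Proof.
pose A := ('I_N * 'I_N)%type.
pose h (p : A * {ffun 'I_k -> A}) : {ffun 'I_k.+1 -> A} :=
  [ffun l => if unlift ord0 l is Some j then p.2 j else p.1].
pose h' (s : {ffun 'I_k.+1 -> A}) := (s ord0, [ffun j => s (lift ord0 j)]).
have hK : cancel h h'.
  move=> [a s]; rewrite /h' /h ffunE unlift_none; congr pair.
  by apply/ffunP => j; rewrite !ffunE liftK.
have h'K : cancel h' h.
  by move=> s; apply/ffunP => l; rewrite ffunE; case: unliftP => [j|] -> //=; rewrite ffunE.
rewrite /qcoef (reindex h) /=; last by exists h' => x _; [exact: hK|exact: h'K].
rewrite big_mkcond /=.
pose G (a : A) (s : {ffun 'I_k -> A}) : C :=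
  Z a.1 a.2 * (if (n a.1 == 0)%N then 0 else if (occ_decr n a.1 a.2 == 0)%N then 0
     else (if [forall i : 'I_N, (\sum_(l < k) (((s l).1 == i) + ((s l).2 == i)) ==
        occ_decr (occ_decr n a.1) a.2 i)%N] then \prod_(l < k) Z (s l).1 (s l).2 else 0)).
have eG p : (if [forall i, (\sum_(l < k.+1) (((h p l).1 == i) + ((h p l).2 == i)) == n i)%N]
    then \prod_(l < k.+1) Z (h p l).1 (h p l).2 else 0) = G p.1 p.2.
  rewrite /G.
  case: p => a s /=; rewrite big_ord_recl /= ffunE unlift_none.
  under [\prod_(i < k) _]eq_bigr => l _ do rewrite ffunE liftK.
  have e i : (\sum_(l < k.+1) (((h (a, s) l).1 == i) + ((h (a, s) l).2 == i)))%N =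
     ((a.1 == i) + (a.2 == i) + \sum_(l < k) (((s l).1 == i) + ((s l).2 == i)))%N.
    rewrite big_ord_recl ffunE unlift_none; congr addn.
    by apply: eq_bigr => l _; rewrite ffunE liftK.
  rewrite (eq_forallb (P2 := fun i => ((a.1 == i) + (a.2 == i) +
     \sum_(l < k) (((s l).1 == i) + ((s l).2 == i)) == n i)%N)); last by move=> i; rewrite e.
  case: ifP => [/forallP H|H].
    have /eqP H1 := H a.1; have /eqP H2 := H a.2.
    rewrite ifF; last by apply/eqP; rewrite -H1 eqxx; lia.
    rewrite ifF; last first.
      by rewrite occ_decrE -H2 eqxx [a.2 == _]eq_sym; case: eqP => ?; apply/eqP; lia.
    rewrite ifT //; apply/forallP => i; have /eqP := H i.
    rewrite !occ_decrE => <-; by rewrite [i == a.1]eq_sym [i == a.2]eq_sym -addnA !addKn.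
  case: eqP => [|n1]; first by rewrite mulr0.
  case: eqP => [|n2]; first by rewrite mulr0.
  case: ifP => [/forallP H'|]; last by rewrite mulr0.
  move/forallP: H; case=> i; have /eqP -> := H' i.
  rewrite !occ_decrE [i == a.1]eq_sym [i == a.2]eq_sym; apply/eqP.
  have [e1|] := eqVneq a.1 i; have [e2|] := eqVneq a.2 i; move: n1 n2; rewrite ?occ_decrE.
        by rewrite e1 e2 eqxx; lia.
      by rewrite e1; lia.
    by rewrite e2; lia.
  by lia.
rewrite (eq_bigr _ (fun p _ => eG p)) -(pair_bigA _ G) /=.
apply: eq_bigr => a _; rewrite /G -mulr_sumr; congr (_ * _).
case: eqP => _; first by rewrite big1.
case: eqP => _; first by rewrite big1.
by rewrite -big_mkcond.
Qed.

Lemma qcoef0 (Z : 'M[C]_N) n : qcoef Z 0 n = (n == occ0 N)%:R.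
Proof.
rewrite /qcoef; under eq_bigr do rewrite big_ord0.
have e (s : {ffun 'I_0 -> 'I_N * 'I_N}) : [forall i : 'I_N, (\sum_(l < 0) (((s l).1 == i) + ((s l).2 == i)) == n i)%N] = (n == occ0 N).
  apply/forallP/eqP => [H|->]; last by move=> i; rewrite big_ord0 ffunE.
  by apply/ffunP => i; rewrite ffunE; have := H i; rewrite big_ord0 => /eqP <-.
rewrite (eq_bigl _ _ e); case: eqP => _; last by rewrite big_pred0.
by rewrite sumr_const card_ffun card_ord expn0.
Qed.

Lemma sqrt_fact_decr n i : n i != 0%N ->
  sqrtC ((occ_fact n)%:R : C) = sqrtC (n i)%:R * sqrtC (occ_fact (occ_decr n i))%:R.
Proof.
by move=> ni; rewrite (occ_fact_decr ni) natrM sqrtCM ?nnegrE ?ler0n.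
Qed.

(** Each creation operator contributes the square root of one occupation number, and along a word
    these multiply to [sqrt(n!)]. This ties the combinatorial [squeeze_coef] to powers of an
    operator. *)
Lemma qpow_qcoef (Z : 'M[C]_N) k n : qpow Z k n = qcoef Z k n * sqrtC ((occ_fact n)%:R).
Proof.
elim: k n => [|k IH] n.
  rewrite qcoef0 /qpow /= /vac; case: eqP => [->|_]; last by rewrite mul0r.
  by rewrite mul1r /occ_fact big1 ?sqrtC1 // => i _; rewrite ffunE.
rewrite qcoefS /qpow iterS /quadop mulr_suml; apply: eq_bigr => p _.
rewrite -mulrA; congr (_ * _); rewrite /cre.
case: eqP => [_|/eqP n1]; first by rewrite mul0r.
case: eqP => [_|/eqP n2]; first by rewrite mulr0 mul0r.
rewrite -/(qpow Z k) IH (sqrt_fact_decr n1) (sqrt_fact_decr n2); ring.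
Qed.

Definition phik (Z : 'M[C]_N) k n : C := (- 2^-1) ^+ k / (k`!)%:R * qpow Z k n.

Lemma homog_phik Z k : homog k.*2 (phik Z k).
Proof. by move=> n nk; rewrite /phik homog_qpow ?mulr0. Qed.

Lemma squeeze_phik Z k n : occ_tot n = k.*2 -> squeeze_coef Z n = phik Z k n.
Proof.
move=> nk; rewrite /squeeze_coef nk odd_double doubleK /phik qpow_qcoef.
by rewrite !mulrA.
Qed.

Lemma squeeze_odd (Z : 'M[C]_N) n : odd (occ_tot n) -> squeeze_coef Z n = 0.
Proof. by rewrite /squeeze_coef => ->. Qed.

Lemma quadop_sum (I : Type) (r : seq I) (c : I -> C) (f : I -> occ N -> C) Z :
  quadop Z (fun n => \sum_(k <- r) c k * f k n) =
  (fun n => \sum_(k <- r) c k * quadop Z (f k) n).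
Proof.
apply: funext => n; rewrite /quadop; under eq_bigr do rewrite cre_sum cre_sum mulr_sumr.
rewrite exchange_big; apply: eq_bigr => k _; rewrite mulr_sumr.
by apply: eq_bigr => p _; rewrite mulrCA.
Qed.

Lemma quadopZ c f Z : quadop Z (fun n => c * f n) = (fun n => c * quadop Z f n).
Proof.
apply: funext => n; rewrite /quadop mulr_sumr; apply: eq_bigr => p _.
by rewrite !creZ mulrCA.
Qed.

Lemma cre_quadop Z f j : cre j (quadop Z f) = quadop Z (cre j f).
Proof.
rewrite /quadop (cre_sum _ (fun p => Z p.1 p.2)); apply: funext => n.
by apply: eq_bigr => p _; rewrite cre_cre (cre_cre j p.2).
Qed.

Lemma quadop_comm Z X f : quadop Z (quadop X f) = quadop X (quadop Z f).
Proof.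
rewrite (_ : quadop X (quadop Z f) =
  fun n => \sum_p Z p.1 p.2 * quadop X (cre p.1 (cre p.2 f)) n); last first.
  exact: (quadop_sum _ (fun p => Z p.1 p.2)).
apply: funext => n; rewrite {1}/quadop.
by apply: eq_bigr => p _; rewrite !cre_quadop.
Qed.

Lemma quadop_line Z X (z : C) f :
  quadop (Z + z *: X) f = (fun n => quadop Z f n + z * quadop X f n).
Proof.
apply: funext => n; rewrite /quadop mulr_sumr -big_split; apply: eq_bigr => p _.
by rewrite !mxE mulrDl mulrA.
Qed.

(** The commutator of [a_i] with [(a^*, Z a^* )]: the contractions with the two creation operators
    agree by symmetry of [Z], whence the 2. *)
Lemma ann_quadop (Z : 'M[C]_N) f i : Z^T = Z ->
  ann i (quadop Z f) =
  (fun n => quadop Z (ann i f) n + 2 * \sum_j Z i j * cre j f n).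
Proof.
move=> sZ; rewrite /quadop (ann_sum _ (fun p => Z p.1 p.2)); apply: funext => n.
have e p : ann i (cre p.1 (cre p.2 f)) n = cre p.1 (cre p.2 (ann i f)) n +
    ((i == p.2)%:R * cre p.1 f n + (i == p.1)%:R * cre p.2 f n).
  by rewrite ann_cre ann_cre creD creZ -addrA.
under eq_bigr do rewrite e !mulrDr; rewrite big_split; congr (_ + _).
have d (F : 'I_N -> C) : \sum_j (i == j)%:R * F j = F i.
  rewrite (bigD1 i) //= eqxx mul1r big1 ?addr0 // => j ji.
  by rewrite eq_sym (negbTE ji) mul0r.
rewrite big_split /= mulr2n mulrDl mul1r; congr (_ + _).
  rewrite -(pair_bigA _ (fun a b => Z a b * ((i == b)%:R * cre a f n))) /=.
  apply: eq_bigr => a _; under eq_bigr do rewrite mulrCA.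
  by rewrite d -[in LHS]sZ mxE.
rewrite -(pair_bigA _ (fun a b => Z a b * ((i == a)%:R * cre b f n))) exchange_big /=.
apply: eq_bigr => b _; under eq_bigr do rewrite mulrCA.
by rewrite d.
Qed.

Lemma ann_qpow (Z : 'M[C]_N) k i : Z^T = Z ->
  ann i (qpow Z k.+1) = (fun n => k.+1%:R * (2 * \sum_j Z i j * cre j (qpow Z k) n)).
Proof.
move=> sZ; elim: k => [|k IH].
  rewrite /qpow /= ann_quadop //; apply: funext => n; rewrite mul1r.
  suff -> : ann i vac = (fun=> 0).
    by rewrite /quadop big1 ?add0r // => p _; rewrite !cre0 mulr0.
  apply: funext => m; rewrite /ann /vac; case: eqP => [/(congr1 (@occ_tot N))|]; last by rewrite mulr0.
  by rewrite occ_tot_incr /occ_tot [RHS]big1 // => j _; rewrite ffunE.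
rewrite {1}/qpow iterS -/(qpow Z k.+1) ann_quadop // IH quadopZ quadopZ quadop_sum.
apply: funext => n; rewrite -[k.+2%:R]natr1 (mulrDl (k.+1%:R) 1) [X in _ = _ + X]mul1r; congr (_ + _).
congr (_ * _); congr (_ * _).
by apply: eq_bigr => j _; rewrite -cre_quadop.
Qed.

(** The factor [2 (k + 1)] of the commutator meets the ratio [- 1 / (2 (k + 1))] of consecutive
    coefficients of the exponential, leaving -1. *)
Lemma ann_phik (Z : 'M[C]_N) k i : Z^T = Z ->
  ann i (phik Z k.+1) = (fun n => - \sum_j Z i j * cre j (phik Z k) n).
Proof.
move=> sZ; rewrite /phik annZ ann_qpow //; apply: funext => n.
have e j : cre j (fun n => (- 2^-1) ^+ k / (k`!)%:R * qpow Z k n) n =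
  (- 2^-1) ^+ k / (k`!)%:R * cre j (qpow Z k) n by rewrite creZ.
under [in RHS]eq_bigr do rewrite e mulrCA.
rewrite -mulr_sumr exprS factS natrM; set S := \sum_j _; set u := _ ^+ k.
have k0 : (k.+1%:R : C) != 0 by rewrite pnatr_eq0.
have f0 : (k`!%:R : C) != 0 by rewrite pnatr_eq0 -lt0n fact_gt0.
move: (k.+1%:R) (k`!%:R) k0 f0 => a b a0 b0.
by field; rewrite ?a0 ?b0.
Qed.

Lemma squeeze_ann (Z : 'M[C]_N) i n : Z^T = Z ->
  ann i (squeeze_coef Z) n = - \sum_j Z i j * cre j (squeeze_coef Z) n.
Proof.
move=> sZ; have [odd_n|/negbTE ev_n] := boolP (odd (occ_tot n)).
  pose k := (occ_tot n)./2.
  have nk : occ_tot n = k.*2.+1 by rewrite /k -{1}[occ_tot n]odd_double_half odd_n.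
  have := congr1 (fun f => f n) (ann_phik k i sZ).
  rewrite /ann (squeeze_phik Z (k := k.+1)); last first.
    by rewrite occ_tot_incr nk doubleS.
  move=> ->; congr (- _); apply: eq_bigr => j _; congr (_ * _); rewrite /cre.
  case: eqP => // /eqP nj; congr (_ * _); apply/esym/squeeze_phik.
  by have := occ_tot_decr nj; rewrite nk => -[].
rewrite /ann squeeze_odd ?occ_tot_incr /= ?ev_n // mulr0 big1 ?oppr0 // => j _.
rewrite /cre; case: eqP => [_|/eqP nj]; first by rewrite mulr0.
rewrite squeeze_odd ?mulr0 //.
by move: ev_n; rewrite (occ_tot_decr nj) /= => /negbFE.
Qed.

End Fock.

(** * Generating functions and their logarithmic derivatives *)

Section PowerSeries.
Variable R : realType.
Implicit Types (a b c p : nat -> R) (s : seq R).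

Definition conv a b k : R := \sum_(j < k.+1) a j * b (k - j)%N.
(* [t d/dt] on generating functions. *)
Definition theta a k : R := k%:R * a k.

(** Up to a fixed degree the Cauchy product is multiplication of truncated polynomials, so its
    algebraic laws are inherited from [{poly R}]. *)
Lemma conv_poly K a b k : (k < K)%N ->
  conv a b k = (\poly_(i < K) a i * \poly_(i < K) b i)`_k.
Proof.
move=> kK; rewrite coefM; apply: eq_bigr => j _; rewrite !coef_poly.
rewrite !ifT //; first by apply: leq_ltn_trans kK; exact: leq_subr.
by apply: leq_ltn_trans kK; rewrite -ltnS.
Qed.

Lemma convC a b k : conv a b k = conv b a k.
Proof. by rewrite (conv_poly _ _ (ltnSn k)) (conv_poly b _ (ltnSn k)) mulrC. Qed.

Lemma convA a b c k : conv (conv a b) c k = conv a (conv b c) k.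
Proof.
transitivity ((\poly_(i < k.+1) a i * \poly_(i < k.+1) b i * \poly_(i < k.+1) c i)`_k).
  rewrite coefM; apply: eq_bigr => j _; rewrite (conv_poly _ _ (ltn_ord j)) coef_poly ifT //.
  exact: leq_subr.
rewrite -mulrA coefM; apply: eq_bigr => j _; rewrite coef_poly ltn_ord; congr (_ * _).
by rewrite -conv_poly // ltnS leq_subr.
Qed.

Lemma eq_conv a a' b b' k : (forall j, (j <= k)%N -> a j = a' j) ->
  (forall j, (j <= k)%N -> b j = b' j) -> conv a b k = conv a' b' k.
Proof.
by move=> ea eb; apply: eq_bigr => j _; rewrite ea -1?ltnS // eb ?leq_subr.
Qed.

Lemma convDr a b c k : conv a (fun j => b j + c j) k = conv a b k + conv a c k.
Proof. by rewrite /conv -big_split; apply: eq_bigr => j _; rewrite mulrDr. Qed.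

Lemma theta_conv a b k :
  theta (conv a b) k = conv (theta a) b k + conv a (theta b) k.
Proof.
rewrite /theta /conv mulr_sumr -big_split; apply: eq_bigr => j _ /=.
rewrite -{1}(subnKC (n := k) (m := j)) ?natrD; last by rewrite -ltnS.
ring.
Qed.

(** As [p] has no constant term, the equation expresses [k a_k] through earlier coefficients, and
    [k] can be cancelled for [k > 0]. *)
Lemma theta_uniq a b p : p 0%N = 0 -> a 0%N = b 0%N ->
  (forall k, theta a k = conv a p k) -> (forall k, theta b k = conv b p k) ->
  forall k, a k = b k.
Proof.
move=> p0 ab ha hb k; elim/ltn_ind: k => -[//|k] IH.
apply: (@mulfI _ k.+1%:R); first by rewrite pnatr_eq0.
have := ha k.+1; have := hb k.+1; rewrite /theta => -> ->.
rewrite /conv big_ord_recr /= [RHS]big_ord_recr /= subnn p0 !mulr0 !addr0.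
by apply: eq_bigr => j _; rewrite IH.
Qed.

Definition geo (l : R) k : R := l ^+ k.
Definition power_sum s k : R := \sum_(l <- s) (if k == 0%N then 0 else l ^+ k).
(** The complete homogeneous symmetric functions, coefficients of [prod_l (1 - l t)^-1].
    [power_sum s] is the logarithmic derivative of that product under [t d/dt], hence its constant
    term 0. *)
Definition complete s : nat -> R :=
  foldr (fun l h => conv (geo l) h) (fun k => (k == 0)%:R) s.

Lemma theta_geo l k : theta (geo l) k = conv (geo l) (power_sum [:: l]) k.
Proof.
rewrite convC /theta /conv /power_sum big_ord_recl big_seq1 /= mul0r add0r.
rewrite (eq_bigr (fun _ => l ^+ k)); last first.
  move=> j _; rewrite big_seq1 /= /geo -exprD; congr (_ ^+ _).
  by rewrite /bump /= add1n subnKC.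
by rewrite sumr_const card_ord mulr_natl.
Qed.

(** Newton's identities, by the product rule applied factor by factor. *)
Lemma theta_complete s k : theta (complete s) k = conv (complete s) (power_sum s) k.
Proof.
elim: s k => [|l s IH] k.
  rewrite /theta /= /conv /power_sum; case: k => [|k] /=.
    by rewrite mul0r big1 // => j _; rewrite big_nil mulr0.
  by rewrite mulr0 big1 // => j _; rewrite big_nil mulr0.
rewrite /= theta_conv.
have e (j : nat) : power_sum (l :: s) j = power_sum [:: l] j + power_sum s j.
  by rewrite /power_sum big_cons big_seq1.
rewrite [RHS](eq_conv (a' := conv (geo l) (complete s)) (fun _ _ => erefl) (fun j _ => e j)) convDr.
congr (_ + _).
  rewrite (eq_conv (a' := conv (geo l) (power_sum [:: l])) (b' := complete s)) //; last first.
    by move=> j _; exact: theta_geo.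
  rewrite !convA; apply: eq_conv => // j _; exact: convC.
by rewrite convA; apply: eq_conv => // j _; exact: IH.
Qed.

Lemma complete0 s : complete s 0 = 1.
Proof.
by elim: s => //= l s IH; rewrite /conv big_ord1 /= IH mulr1.
Qed.

Lemma conv_ge0 a b k : (forall j, 0 <= a j) -> (forall j, 0 <= b j) -> 0 <= conv a b k.
Proof. by move=> a0 b0; apply: sumr_ge0 => j _; rewrite mulr_ge0. Qed.

Lemma complete_ge0 s k : all (fun l => 0 <= l) s -> 0 <= complete s k.
Proof.
elim: s k => [|l s IH] k /=; first by rewrite ler0n.
move=> /andP[l0 hs]; apply: conv_ge0 => j; last exact: IH.
exact: exprn_ge0.
Qed.

Local Open Scope ereal_scope.

(** Tonelli, after the bijection [(i, j) |-> (i + j, i)] onto the pairs [(k, j)] with [j <= k]. *)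
Lemma esum_conv a b : (forall j, 0 <= a j)%R -> (forall j, 0 <= b j)%R ->
  \esum_(k in [set: nat]) (b k)%:E < +oo ->
  \esum_(k in [set: nat]) (conv a b k)%:E =
  (\esum_(k in [set: nat]) (a k)%:E) * (\esum_(k in [set: nat]) (b k)%:E).
Proof.
move=> a0 b0 bfin; rewrite -esum_prod //.
transitivity (\esum_(k in [set: nat]) \esum_(j in `I_k.+1) (a j * b (k - j)%N)%:E).
  apply: eq_esum => k _; rewrite esum_fset //; last by move=> *; rewrite lee_fin mulr_ge0.
  by rewrite -fsbig_ord /conv -sumEFin.
rewrite esum_esum; last by move=> *; rewrite lee_fin mulr_ge0.
rewrite (@reindex_esum _ _ _ [set: nat * nat] _ (fun q : nat * nat => (q.1 + q.2, q.1)%N)).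
  by apply: eq_esum => -[i j] _ /=; rewrite addKn.
split.
    by move=> [i j] _; split => //=; rewrite ltnS leq_addr.
  by move=> [i j] [i' j'] _ _ /= [] + e; rewrite e => /addnI ->.
move=> [k j] [_ /= jk]; exists (j, (k - j)%N) => //=.
  by rewrite subnKC // -ltnS.
Qed.

Lemma esum_geo l : (0 <= l < 1)%R ->
  \esum_(k in [set: nat]) (geo l k)%:E = ((1 - l)^-1)%:E.
Proof.
move=> /andP[l0 l1]; rewrite -nneseries_esumT; last first.
  by move=> k; rewrite lee_fin exprn_ge0.
apply/cvg_lim => //.
have := @cvg_geometric_series R 1 l; rewrite ger0_norm // => /(_ l1).
rewrite mul1r => h.
rewrite (_ : (fun n => _) = (fun n => (series (geometric 1 l) n)%:E)); last first.
  apply: funext => n; rewrite sumEFin; congr EFin; apply: eq_bigr => i _.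
  by rewrite /geo /= mul1r.
by apply: cvg_EFin; [exact: nearW|exact: h].
Qed.

Lemma esum_complete s : all (fun l => 0 <= l < 1)%R s ->
  \esum_(k in [set: nat]) (complete s k)%:E = (\prod_(l <- s) (1 - l)^-1)%:E.
Proof.
elim: s => [_|l s IH /= /andP[hl hs]].
  rewrite big_nil (esumID [set 0%N]) /=; last by move=> k _; rewrite lee_fin ler0n.
  rewrite setTI esum_set1 ?lee_fin ?ler01 //= esum1 ?adde0 // => k [_ /= k0].
  by case: eqP k0.
have h0 k : (0 <= complete s k)%R.
  by apply: complete_ge0; apply: sub_all hs => x /andP[].
have g0 k : (0 <= geo l k)%R by rewrite exprn_ge0 //; case/andP: hl.
rewrite esum_conv // IH // ?ltry // esum_geo // big_cons EFinM //.
Qed.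

(* The recursion says that [prod_l (1 - l t)^(-1/2)] and the generating function of
   [c] have the same logarithmic derivative. *)
Lemma esum_half c s : (forall k, 0 <= c k)%R -> c 0%N = 1%R ->
  all (fun l => 0 <= l < 1)%R s ->
  (forall k, 2 * (k%:R * c k) = \sum_(j < k) c (k.-1 - j)%N * \sum_(l <- s) l ^+ j.+1)%R ->
  \esum_(k in [set: nat]) (c k)%:E < +oo /\
  (\esum_(k in [set: nat]) (c k)%:E) * (\esum_(k in [set: nat]) (c k)%:E) =
    (\prod_(l <- s) (1 - l)^-1)%:E.
Proof.
move=> c0 c1 hs hc.
have p0 : power_sum s 0%N = 0%R by rewrite /power_sum big1.
have h2 k : (2 * theta c k = conv c (power_sum s) k)%R.
  rewrite /theta hc convC /conv big_ord_recl /= p0 mul0r add0r.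
  apply: eq_bigr => j _; rewrite mulrC; congr (_ * c _)%R.
  rewrite /bump /= add1n; have := ltn_ord j; lia.
(* Both sides solve the same first-order equation: the product rule contributes [theta c] twice,
   which cancels the exponent 1/2. *)
have hd k : conv c c k = complete s k.
  apply: (theta_uniq (p := power_sum s)); last exact: theta_complete.
      by rewrite /power_sum big1.
    by rewrite complete0 /conv big_ord1 c1 mulr1.
  move=> m; apply: (@mulfI _ 2%R); first by rewrite pnatr_eq0.
  rewrite theta_conv mulrDr.
  have e1 a b k' : (2 * conv a b k' = conv (fun j => 2 * a j)%R b k')%R.
    by rewrite /conv mulr_sumr; apply: eq_bigr => j _; rewrite mulrA.
  have e2 a b k' : (2 * conv a b k' = conv a (fun j => 2 * b j)%R k')%R.
    by rewrite /conv mulr_sumr; apply: eq_bigr => j _; rewrite mulrCA.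
  rewrite e1 (e2 c (theta c)).
  rewrite (eq_conv (a' := conv c (power_sum s)) (b' := c) (fun j _ => h2 j)) //.
  rewrite [X in (_ + X)%R](eq_conv (a' := c) (b' := conv c (power_sum s))) //.
  rewrite -convA convA (eq_conv (a' := c) (b' := conv c (power_sum s))) //; last first.
    by move=> j _; exact: convC.
  by rewrite -convA mulr2n mulrDl mul1r.
(* Since [c 0 = 1], the number [c k] is one of the nonnegative terms of [conv c c k], so comparison
   gives finiteness. *)
have fin : \esum_(k in [set: nat]) (c k)%:E < +oo.
  apply: (@le_lt_trans _ _ (\esum_(k in [set: nat]) (complete s k)%:E)).
    apply: le_esum => k _; rewrite lee_fin -hd /conv big_ord_recl subn0 /= c1 mul1r.
    by rewrite lerDl sumr_ge0 // => j _; rewrite mulr_ge0.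
  by rewrite esum_complete // ltry.
split=> //; rewrite -esum_conv // -esum_complete //.
by apply: eq_esum => k _; rewrite hd.
Qed.

End PowerSeries.

(** * Absolute summability under reindexing *)

Section AbsoluteSummability.
Variable R : realType.

Lemma asummable_ext_inj (T T' : choiceType) (e : T -> T') (f : T' -> R) :
  injective e -> (forall y, ~ range e y -> f y = 0) ->
  asummable (f \o e) -> asummable f.
Proof.
move=> ie f0 h; rewrite /asummable (esum_inj (f := fun y => `|f y|) ie) //.
by move=> y /f0 ->; rewrite normr0.
Qed.

Lemma asummable_comp (T T' : choiceType) (e : T -> T') (f : T' -> R) :
  injective e -> asummable f -> asummable (f \o e).
Proof.
move=> ie; apply: le_lt_trans.
rewrite -(@esum_image _ _ _ setT e (fun y => `|f y|%:E)); last by move=> x y _ _ /ie.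
by rewrite esum_mkcond; apply: le_esum => y _; case: ifP => // _; rewrite lee_fin.
Qed.

Lemma asummable_finite (T : choiceType) (F : set T) (f : T -> R) :
  finite_set F -> (forall x, ~ F x -> f x = 0) -> asummable f.
Proof.
move=> finF f0; rewrite /asummable.
rewrite (_ : \esum_(x in [set: T]) `|f x|%:E = \esum_(x in F) `|f x|%:E)%E; last first.
  rewrite [RHS]esum_mkcond; apply: eq_esum => x _; case: ifPn => //.
  by rewrite notin_setE => /f0 ->; rewrite normr0.
by rewrite esum_fset // fsumEFin // ltry.
Qed.

End AbsoluteSummability.

(** * Rapidly decaying vectors and the inner product *)

Section FockInner.
Variables (R : realType) (N : nat).
Local Notation C := R[i].
Implicit Types (n : occ N) (i j : 'I_N) (f g : occ N -> C).

Lemma weight_ge0 (m l : nat) (x : R) : 0 <= m%:R ^+ l * x ^+ 2.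
Proof. by rewrite mulr_ge0 ?sqr_ge0 // exprn_ge0 // ler0n. Qed.

Lemma leq_expn (a b k : nat) : (a <= b)%N -> (a ^ k <= b ^ k)%N.
Proof. by move=> ab; elim: k => // k IH; rewrite !expnS leq_mul. Qed.

(* Fast decay, stable under [ann] and [cre], makes these formally adjoint operators
   adjoint for the inner product [ip]. *)
Definition tempered f := forall k,
  asummable (fun n => (occ_tot n).+1%:R ^+ k * normR (f n) ^+ 2 : R).

Lemma tempered_l2 f : tempered f -> (l2sq f < +oo)%E.
Proof.
move=> /(_ 0%N); apply: le_lt_trans; apply: le_esum => n _.
by rewrite expr0 mul1r lee_fin ler_norm.
Qed.

Lemma temperedD f g : tempered f -> tempered g -> tempered (fun n => f n + g n).
Proof.
move=> tf tg k; apply: asummable_le (asummableZ 2 (asummableD (tf k) (tg k))) => n.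
have w0 : 0 <= (occ_tot n).+1%:R ^+ k :> R by rewrite exprn_ge0 // ler0n.
rewrite ger0_norm ?weight_ge0 // ger0_norm; last first.
  by apply: mulr_ge0 => //; apply: addr_ge0; exact: weight_ge0.
by rewrite -mulrDr (mulrCA 2); apply: ler_wpM2l => //; exact: normRD_sq.
Qed.

Lemma temperedZ c f : tempered f -> tempered (fun n => c * f n).
Proof.
move=> tf k; apply: asummable_le (asummableZ (normR c ^+ 2) (tf k)) => n.
by rewrite normRM exprMn mulrCA.
Qed.

Lemma tempered0 : tempered (fun=> 0).
Proof.
move=> k; apply: (@asummable_finite _ _ set0) => // n _.
by rewrite normR_sq /= !expr0n /= addr0 mulr0.
Qed.

Lemma tempered_sum (I : Type) (r : seq I) (c : I -> C) (f : I -> occ N -> C) :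
  (forall k, tempered (f k)) -> tempered (fun n => \sum_(k <- r) c k * f k n).
Proof.
move=> tf; elim: r => [|k r IH].
  rewrite (_ : (fun n => _) = fun=> 0); first exact: tempered0.
  by apply: funext => n; rewrite big_nil.
rewrite (_ : (fun n => _) = fun n => c k * f k n + \sum_(l <- r) c l * f l n).
  by apply: temperedD => //; exact: temperedZ.
by apply: funext => n; rewrite big_cons.
Qed.

(** The factor [n_i + 1] is at most the weight at the raised index, so one more power of the weight
    pays for it. *)
Lemma tempered_ann i f : tempered f -> tempered (ann i f).
Proof.
move=> tf k.
apply: asummable_le (asummable_comp (@occ_incr_inj N i) (tf k.+1)) => n /=.
rewrite !ger0_norm ?weight_ge0 //.
rewrite /ann normRM exprMn sqrtn_normR mulrA; apply: ler_wpM2r; first exact: sqr_ge0.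
rewrite occ_tot_incr -!natrX -natrM ler_nat expnSr.
apply: leq_mul; first exact: leq_expn.
by rewrite !ltnS (leq_trans (leq_occ_tot n i)) // leqW.
Qed.

Lemma not_range_incr i n : ~ range (occ_incr (N := N) ^~ i) n -> n i = 0%N.
Proof.
by move=> h; apply/eqP; apply: contrapT => /negP ni; apply: h; exists (occ_decr n i) => //; rewrite occ_decrK.
Qed.

Lemma tempered_cre i f : tempered f -> tempered (cre i f).
Proof.
move=> tf k; apply: (asummable_ext_inj (@occ_incr_inj N i)).
  move=> n /not_range_incr ni; rewrite /cre ni eqxx.
  by rewrite normR_sq /= !expr0n /= addr0 mulr0.
(* Raising the index changes the weight from [|n| + 1] to [|n| + 2 <= 2 (|n| + 1)], which accounts
   for [2 ^+ k]. *)
apply: asummable_le (asummableZ (2 ^+ k) (tf k.+1)) => n /=.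
rewrite ger0_norm ?weight_ge0 // ger0_norm; last first.
  by apply: mulr_ge0; [rewrite exprn_ge0 // ler0n|exact: weight_ge0].
rewrite cre_incr normRM exprMn sqrtn_normR [leLHS]mulrA [leRHS]mulrA; apply: ler_wpM2r; first exact: sqr_ge0.
rewrite occ_tot_incr -!natrX -!natrM ler_nat expnSr mulnA -expnMn.
apply: leq_mul; first by apply: leq_expn; lia.
by rewrite ltnS leq_occ_tot.
Qed.

Lemma tempered_homog d f : homog d f -> tempered f.
Proof.
move=> hf k; apply: (@asummable_finite _ _ _ _ (finite_occ N d)) => n /= nd.
rewrite hf ?normR_sq /= ?expr0n /= ?addr0 ?mulr0 // => e.
by apply: nd; rewrite e.
Qed.

Definition ip f g : C := csum (fun n => f n * (g n)^*).

Lemma ip_conj f g : ip g f = (ip f g)^*.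
Proof. by rewrite /ip -csumJ; apply: eq_csum => n; rewrite rmorphM /= conjCK mulrC. Qed.

(** Reindexing along [occ_incr] makes the sums agree term by term; the indices it misses have
    [n i = 0], where [cre] vanishes. *)
Lemma ip_annl i f g : ip (ann i f) g = ip f (cre i g).
Proof.
rewrite /ip [RHS](csum_inj (@occ_incr_inj N i)).
  by apply: eq_csum => n /=; rewrite cre_incr rmorphM /= sqrtn_conj /ann mulrCA mulrA.
by move=> n /not_range_incr ni; rewrite /cre ni eqxx conjC0 mulr0.
Qed.

Lemma ip_crel i f g : ip (cre i f) g = ip f (ann i g).
Proof. by rewrite ip_conj -ip_annl -ip_conj. Qed.

Lemma ip_sum f g : tempered f -> tempered g -> csummable (fun n => f n * (g n)^*).
Proof. by move=> tf tg; apply: csummable_mul; exact: tempered_l2. Qed.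

Lemma ipDl f g h : tempered f -> tempered g -> tempered h ->
  ip (fun n => f n + g n) h = ip f h + ip g h.
Proof.
move=> tf tg th; rewrite /ip -csumD; [|exact: ip_sum..].
by apply: eq_csum => n; rewrite mulrDl.
Qed.

Lemma ipZl c f g : tempered f -> tempered g -> ip (fun n => c * f n) g = c * ip f g.
Proof.
move=> tf tg; rewrite /ip -csumZ; last exact: ip_sum.
by apply: eq_csum => n; rewrite mulrA.
Qed.

Lemma ip_suml (I : Type) (r : seq I) (c : I -> C) (f : I -> occ N -> C) g :
  (forall k, tempered (f k)) -> tempered g ->
  ip (fun n => \sum_(k <- r) c k * f k n) g = \sum_(k <- r) c k * ip (f k) g.
Proof.
move=> tf tg; rewrite /ip.
under [RHS]eq_bigr => k _ do rewrite -(csumZ _ (ip_sum (tf k) tg)).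
have [_ <-] := @csum_sum _ _ r _ (fun k n => c k * (f k n * (g n)^*))
  (fun k => csummableZ (c k) (ip_sum (tf k) tg)).
by apply: eq_csum => n; rewrite mulr_suml; apply: eq_bigr => k _; rewrite mulrA.
Qed.

Lemma ip_sumr (I : Type) (r : seq I) (c : I -> C) (f : I -> occ N -> C) g :
  (forall k, tempered (f k)) -> tempered g ->
  ip g (fun n => \sum_(k <- r) c k * f k n) = \sum_(k <- r) (c k)^* * ip g (f k).
Proof.
move=> tf tg; rewrite ip_conj ip_suml // rmorph_sum; apply: eq_bigr => k _.
by rewrite rmorphM /= -ip_conj.
Qed.

Lemma ipZr c f g : tempered f -> tempered g -> ip f (fun n => c * g n) = c^* * ip f g.
Proof. by move=> tf tg; rewrite ip_conj ipZl // rmorphM /= -ip_conj. Qed.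

Lemma ip_cre_cre l m f g : tempered f -> tempered g ->
  ip (cre l f) (cre m g) = ip (ann m f) (ann l g) + (l == m)%:R * ip f g.
Proof.
move=> tf tg; rewrite -ip_annl ann_cre.
rewrite (ipDl (tempered_cre _ (tempered_ann _ tf)) (temperedZ _ tf) tg).
by rewrite ip_crel ipZl // eq_sym.
Qed.

End FockInner.

(** * Recursion for the norms of the homogeneous components *)

Section Normalization.
Variables (R : realType) (N : nat) (Z : 'M[R[i]]_N).
Local Notation C := R[i].
Hypothesis sZ : Z^T = Z.

Lemma tempered_phik k : tempered (phik Z k).
Proof. exact: tempered_homog (@homog_phik R N Z k). Qed.

(** Its trace is the expectation of the number operator in [phik Z k], hence a multiple of
    [norm2 k]. *)
Definition gram k : 'M[C]_N :=
  \matrix_(i, j) ip (ann i (phik Z k)) (ann j (phik Z k)).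
Definition norm2 k : C := ip (phik Z k) (phik Z k).

Fixpoint mxpow (A : 'M[C]_N) k : 'M[C]_N :=
  if k is k'.+1 then A *m mxpow A k' else 1%:M.

Arguments mxpow : simpl never.

Lemma mxpow1 A : mxpow A 1 = A.
Proof. exact: mulmx1. Qed.

Lemma mxpowSr A k : mxpow A k.+1 = mxpow A k *m A.
Proof.
elim: k => [|k IH]; first by rewrite mxpow1 mul1mx.
by rewrite [LHS]/mxpow -/(mxpow A k.+1) {1}IH mulmxA.
Qed.

Lemma trmx_mxpow A k : (mxpow A k)^T = mxpow A^T k.
Proof.
elim: k => [|k IH]; first by rewrite /mxpow trmx1.
by rewrite mxpowSr trmx_mul IH.
Qed.

(** Annihilating [phik Z k.+1] amounts to applying [- Z a^*] to [phik Z k]. Of the inner products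
    between two created vectors, the commutator yields [norm2] and the reordered part the transposed
    [gram]. *)
Lemma gramS k : gram k.+1 = Z *m ((gram k)^T + (norm2 k)%:M) *m adjmx Z.
Proof.
have tk := tempered_phik k.
apply/matrixP => i j; rewrite !mxE !ann_phik //.
have eN l : (fun n => - \sum_j Z l j * cre j (phik Z k) n) =
    (fun n => \sum_j (- Z l j) * cre j (phik Z k) n).
  by apply: funext => n; rewrite -sumrN; apply: eq_bigr => m _; rewrite mulNr.
have tc l := tempered_cre l tk.
rewrite !eN (ip_suml _ _ tc (tempered_sum _ _ tc)).
under eq_bigr => l _ do rewrite (ip_sumr _ _ tc (tc l)).
under [RHS]eq_bigr => m _ do rewrite adjmxE mxE mulr_suml.
rewrite [RHS]exchange_big; apply: eq_bigr => l _; rewrite mulr_sumr.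
apply: eq_bigr => m _; rewrite ip_cre_cre // !mxE.
rewrite (_ : (- Z j m)^* = - (Z j m)^*); last by rewrite rmorphN.
rewrite mulr_natl /norm2; ring.
Qed.

Lemma gram0 : gram 0 = 0.
Proof.
apply/matrixP => i j; rewrite !mxE.
have -> : ann i (phik Z 0) = fun=> 0.
  rewrite /phik annZ; apply: funext => n; rewrite /qpow /= /ann /vac.
  case: eqP => [/(congr1 (@occ_tot N))|]; last by rewrite !mulr0.
  by rewrite occ_tot_incr /occ_tot [RHS]big1 // => l _; rewrite ffunE.
by rewrite /ip -[RHS](csum0 _ (occ N)); apply: eq_csum => n; rewrite mul0r.
Qed.

(** Transposition exchanges [Z Z^*] and [Z^* Z], and [Z (Z^* Z)^j Z^* = (Z Z^* )^(j + 1)] brings the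
    powers back. *)
Lemma gramE k : gram k = \sum_(j < k) norm2 (k.-1 - j)%N *: mxpow (Z *m adjmx Z) j.+1.
Proof.
have trA : (Z *m adjmx Z)^T = adjmx Z *m Z.
  by rewrite trmx_mul sZ; congr (_ *m _); rewrite /adjmx trmxK -{2}sZ map_trmx trmxK.
have ZB j : Z *m mxpow (adjmx Z *m Z) j *m adjmx Z = mxpow (Z *m adjmx Z) j.+1.
  elim: j => [|j IH]; first by rewrite mxpow1 /mxpow mulmx1.
  by rewrite mxpowSr [RHS]mxpowSr -IH !mulmxA.
elim: k => [|k IH]; first by rewrite gram0 big_ord0.
rewrite gramS IH big_ord_recl /= subn0 mxpow1 addrC mulmxDr mulmxDl; congr (_ + _).
  by rewrite mul_mx_scalar -scalemxAl.
rewrite linear_sum /= mulmx_sumr mulmx_suml; apply: eq_bigr => j _.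
rewrite linearZ /= trmx_mxpow trA -scalemxAr -scalemxAl ZB.
by congr (norm2 _ *: _); rewrite /bump /=; have := ltn_ord j; lia.
Qed.

Lemma tr_gram k : \tr (gram k) = k.*2%:R * norm2 k.
Proof.
have tk := tempered_phik k.
rewrite /norm2 -ipZl //.
have -> : (fun n => k.*2%:R * phik Z k n) =
    (fun n => \sum_i 1 * cre i (ann i (phik Z k)) n).
  apply: funext => n; under eq_bigr do rewrite mul1r; rewrite number_op.
  have [->//|nk] := eqVneq (occ_tot n) k.*2.
  by rewrite (@homog_phik R N Z k n) ?mulr0 //; exact/eqP.
rewrite ip_suml //; last by move=> i; exact/tempered_cre/tempered_ann.
by apply: eq_bigr => i _; rewrite mxE mul1r ip_crel.
Qed.

End Normalization.

Arguments mxpow : simpl never.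

(** * Normalization of the squeezed vector *)

Section SqueezedNorm.
Variables (R : realType) (N : nat).
Local Notation C := R[i].
Implicit Type Z : 'M[C]_N.

Lemma esum_exchange (T1 T2 : choiceType) (a : T1 -> T2 -> \bar R) :
  (forall i j, 0 <= a i j)%E ->
  (\esum_(i in [set: T1]) \esum_(j in [set: T2]) a i j =
   \esum_(j in [set: T2]) \esum_(i in [set: T1]) a i j)%E.
Proof.
move=> a0; rewrite !esum_esum // (@reindex_esum _ _ _
  ([set: T2] `*`` (fun=> [set: T1])) _ (fun q : T2 * T1 => (q.2, q.1))) //.
split => //; first by move=> [i j] [i' j'] _ _ /= [-> ->].
by move=> [i j] _; exists (j, i).
Qed.

Lemma esum_single (T : choiceType) (x : T) (f : T -> R) : 0 <= f x ->
  (forall y, y <> x -> f y = 0) -> \esum_(y in [set: T]) (f y)%:E = (f x)%:E.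
Proof.
move=> fx f0; rewrite -(@esum_set1 R T x (fun y => (f y)%:E)) ?lee_fin //.
rewrite [RHS]esum_mkcond; apply: eq_esum => y _; case: ifPn => //.
by rewrite notin_setE => /f0 ->.
Qed.

(** Eigenvalues are nonnegative because [v^* Z Z^* v] is a squared norm, and below 1 by the
    condition [Z Z^* < 1]. *)
Lemma ZZ_spectrum Z : inM Z ->
  exists l : 'I_N -> R, [/\ forall i, 0 <= l i < 1,
    forall j, \tr (mxpow (Z *m adjmx Z) j) = (\sum_i l i ^+ j)%:C%C &
    \det (1%:M - Z *m adjmx Z) = (\prod_i (1 - l i))%:C%C].
Proof.
move=> hZ.
have hA : adjmx (Z *m adjmx Z) = Z *m adjmx Z by rewrite adjmxM adjmxK.
have [P [l [P1 P2 eA]]] := hermitian_diag hA.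
exists l; split.
  move=> i; have [] := hermitian_diag_eigen l i P1; rewrite -eA.
  move: (adjmx P *m delta_mx i 0) => v e1 e2.
  have v0 : v != 0.
    by apply/eqP => v0; move/eqP: e2; rewrite v0 mulmx0 mxE eq_sym oner_eq0.
  apply/andP; split.
    rewrite -(@lecR R) -e1 !mulmxA -(mulmxA _ (adjmx Z)).
    rewrite (_ : adjmx v *m Z = adjmx (adjmx Z *m v)); last by rewrite adjmxM adjmxK.
    by rewrite quad1E; apply: sumr_ge0 => *; exact: exprn_ge0.
  have := hZ.2 v v0; rewrite quadB e1 mulmx1 e2 subr_gt0.
  by rewrite -[1]/((1 : R)%:C)%C ltcR.
  move=> j.
  have -> : mxpow (Z *m adjmx Z) j = adjmx P *m diag_mx (\row_i (l i ^+ j)%:C%C) *m P.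
    elim: j => [|j IH].
      rewrite (_ : \row_i _ = const_mx 1); first by rewrite diag_const_mx mulmx1 P2.
      by apply/rowP => i; rewrite !mxE.
    rewrite [LHS]/mxpow -/(mxpow _ j) IH eA !mulmxA -(mulmxA _ P (adjmx P)) P1 mulmx1.
    rewrite -(mulmxA (adjmx P)) mulmx_diag; congr (_ *m diag_mx _ *m _).
    by apply/rowP => i; rewrite !mxE -rmorphM /= -exprS.
  rewrite mxtrace_mulC mulmxA P1 mul1mx mxtrace_diag rmorph_sum.
  by apply: eq_bigr => i _; rewrite mxE.
  rewrite -(det_hermitian_diag (fun i => 1 - l i) P2); congr (\det _).
  have -> : diag_mx (\row_i (1 - l i)%:C%C) = 1%:M - diag_mx (\row_i (l i)%:C%C) :> 'M[C]_N.
    apply/matrixP => i j; rewrite !mxE.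
    by case: eqP => _; rewrite ?mulr1n ?mulr0n ?subr0 // rmorphB.
  by rewrite mulmxBr mulmxBl mulmx1 P2 -eA.
Qed.

(** The squared norm [S] is recorded through [S^2 det = 1], which avoids fractional powers;
    [psi_norm] selects the nonnegative root. *)
Lemma squeeze_norm Z : inM Z ->
  exists S : R, [/\ 0 <= S, l2sq (squeeze_coef Z) = S%:E &
    S ^+ 2 * complex.Re (\det (1%:M - Z *m adjmx Z)) = 1].
Proof.
move=> hZ; have sZ := hZ.1.
pose c k : R := fine (l2sq (phik Z k)).
have fin k : l2sq (phik Z k) \is a fin_num.
  by rewrite ge0_fin_numE ?l2sq_ge0 // tempered_l2 //; exact: tempered_phik.
have c0 k : 0 <= c k by rewrite fine_ge0 ?l2sq_ge0.
have nc k : norm2 Z k = (c k)%:C%C by rewrite /norm2 /ip csum_normR.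
have [l [l01 ltr ldet]] := ZZ_spectrum hZ.
pose s := [seq l i | i <- index_enum 'I_N].
have e : l2sq (squeeze_coef Z) = \esum_(k in [set: nat]) (c k)%:E.
  (* At each [n] at most one component is nonzero, that of [k = |n| / 2], so squared norms of the
     components add up. *)
  transitivity (\esum_(n in [set: occ N]) \esum_(k in [set: nat])
      (normR (phik Z k n) ^+ 2)%:E).
    apply: eq_esum => n _.
    have [on|en] := boolP (odd (occ_tot n)).
      rewrite squeeze_odd // esum1; last first.
        move=> k _; rewrite (@homog_phik R N Z k n) ?normR_sq /= ?expr0n ?addr0 //.
        by move=> nk; move: on; rewrite nk odd_double.
      by rewrite normR_sq /= expr0n addr0.
    have nk : occ_tot n = (occ_tot n)./2.*2.
      by rewrite -{1}[occ_tot n]odd_double_half (negbTE en).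
    rewrite (squeeze_phik Z nk) (@esum_single _ (occ_tot n)./2 (fun k => normR (phik Z k n) ^+ 2)) ?sqr_ge0 //.
    move=> k kn; rewrite (@homog_phik R N Z k n) ?normR_sq /= ?expr0n ?addr0 //.
    by move=> nk'; apply: kn; rewrite nk' doubleK.
  rewrite esum_exchange; last by move=> *; rewrite lee_fin sqr_ge0.
  by apply: eq_esum => k _; rewrite fineK.
have [] := @esum_half R c s c0.
  have -> : c 0%N = fine (\esum_(n in [set: occ N]) (normR (phik Z 0 n) ^+ 2)%:E) by [].
  rewrite (@esum_single _ (occ0 N) (fun n => normR (phik Z 0 n) ^+ 2)) ?sqr_ge0 //=.
    by rewrite /phik /qpow /= /vac eqxx expr0 fact0 mulr1 divr1 normR_sq /= expr1n expr0n addr0.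
  move=> n /eqP /negbTE n0; rewrite /phik /qpow /= /vac n0 mulr0 normR_sq /=.
  by rewrite expr0n addr0.
  by apply/allP => x /mapP[i _ ->].
  move=> k; apply: complexI.
  have := tr_gram Z k; rewrite (gramE sZ) linear_sum /= nc -muln2 natrM.
  rewrite rmorphM /= rmorphM /= !rmorph_nat => h.
  rewrite (_ : 2 * (k%:R * (c k)%:C%C) = k%:R * 2 * (c k)%:C%C); last by ring.
  rewrite -h rmorph_sum; apply: eq_bigr => j _ /=.
  by rewrite mxtraceZ nc ltr rmorphM /= big_map.
rewrite -e => Sfin Sq.
have Sf : l2sq (squeeze_coef Z) \is a fin_num by rewrite ge0_fin_numE ?l2sq_ge0.
exists (fine (l2sq (squeeze_coef Z))); split.
  by rewrite fine_ge0 ?l2sq_ge0.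
  by rewrite fineK.
move: Sq; rewrite -(fineK Sf) -EFinM => -[]; rewrite -expr2 => ->.
rewrite ldet /= /s big_map -big_split /= big1 // => i _.
by rewrite mulVf // subr_eq0 eq_sym lt_eqF //; case/andP: (l01 i).
Qed.

Lemma sqrt_sqrt_det Z : inM Z ->
  let b := sqrtC (sqrtC (\det (1%:M - Z *m adjmx Z))) in
  0 < b /\ (b * b^*) ^+ 2 = \det (1%:M - Z *m adjmx Z).
Proof.
move=> hZ b; have d0 := inM_det_gt0 hZ.
have b0 : 0 < b by rewrite /b !sqrtC_gt0.
split=> //; rewrite (CrealP (gtr0_real b0)) -expr2 /b !sqrtCK //.
Qed.

Lemma psi_norm Z : inM Z -> l2sq (psi Z) = 1%E.
Proof.
move=> hZ; have [S [S0 eS SS]] := squeeze_norm hZ.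
have [b0 bb] := sqrt_sqrt_det hZ; set b := sqrtC _ in b0 bb.
rewrite /psi -/b l2sqZ eS -EFinM; congr EFin.
set a := normR b ^+ 2; have a0 : 0 <= a by rewrite sqr_ge0.
have aa : a ^+ 2 = complex.Re (\det (1%:M - Z *m adjmx Z)).
  by rewrite -bb -normR_sqC -/a -rmorphXn.
have /eqP : (a * S) ^+ 2 = 1 by rewrite exprMn aa mulrC SS.
by rewrite sqrp_eq1 ?(mulr_ge0 a0 S0) // => /eqP.
Qed.

Lemma psi_ann Z i n : inM Z -> ann i (psi Z) n + \sum_j Z i j * cre j (psi Z) n = 0.
Proof.
move=> [sZ _]; have eA := congr1 (fun f => f n) (annZ
  (sqrtC (sqrtC (\det (1%:M - Z *m adjmx Z)))) (squeeze_coef Z) i).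
rewrite [ann i _ n]eA squeeze_ann //.
have eC j := congr1 (fun f => f n) (creZ
  (sqrtC (sqrtC (\det (1%:M - Z *m adjmx Z)))) (squeeze_coef Z) j).
under [X in _ + X]eq_bigr => j _ do rewrite [cre j _ n]eC mulrCA.
by rewrite -mulr_sumr mulrN addNr.
Qed.

End SqueezedNorm.

(** * Cauchy estimates for finite families of polynomials *)

Section CauchyEstimate.
Variable R : realType.
Local Notation C := R[i].
Implicit Types (p q : {poly C}) (s : seq {poly C}).

Lemma normR0 : normR (0 : C) = 0.
Proof. by rewrite /normR normr0. Qed.

Lemma normR_real (t : R) : normR (t%:C%C) ^+ 2 = t ^+ 2.
Proof. by rewrite normR_sq /= expr0n addr0. Qed.

Lemma parallelogram (a b : C) :
  normR (a + b) ^+ 2 + normR (a - b) ^+ 2 = 2 * (normR a ^+ 2 + normR b ^+ 2).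
Proof. by rewrite !normR_sq !cReD !cImD !cReN !cImN; ring. Qed.

Lemma sum_even_odd (F : nat -> R) n :
  \sum_(m < n.*2) F m = \sum_(m < n) (F m.*2 + F m.*2.+1).
Proof.
elim: n => [|n IH]; first by rewrite !big_ord0.
by rewrite doubleS !big_ord_recr /= IH addrA.
Qed.

Lemma horner_even_odd p (z : C) :
  p.[z] = (even_poly p).[z ^+ 2] + z * (odd_poly p).[z ^+ 2].
Proof.
rewrite -{1}[p]poly_even_odd hornerD hornerM hornerX !horner_comp !hornerXn.
by rewrite mulrC.
Qed.

(* A discrete Parseval inequality: averaging over [z] and [-z] separates the even
   from the odd coefficients, and one recurses on the polynomials in [z^2]. *)
Lemma parseval_le K s (r M : R) : 0 <= r ->
  all (fun q => size q <= 2 ^ K)%N s ->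
  (forall z : C, `|z| = r%:C%C -> \sum_(q <- s) normR q.[z] ^+ 2 <= M) ->
  \sum_(q <- s) \sum_(m < 2 ^ K) normR q`_m ^+ 2 * (r ^+ 2) ^+ m <= M.
Proof.
elim: K s r => [|K IH] s r r0 hs hM.
  apply: le_trans (hM r%:C%C _); last by rewrite normc_def /= expr0n addr0 sqrtr_sqr ger0_norm.
  rewrite le_eqVlt; apply/orP; left; apply/eqP; apply: eq_big_seq => q qs.
  have /size1_polyC e := allP hs _ qs.
  by rewrite expn0 big_ord1 expr0 mulr1 [in RHS]e hornerC.
(* The factor [r] on the odd parts replaces [|z|] in [z q_odd(z^2)], so both halves become
   polynomials in [w = z^2] on the circle of radius [r^2]. *)
pose s' := [seq even_poly q | q <- s] ++ [seq r%:C%C *: odd_poly q | q <- s].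
have hs' : all (fun q => size q <= 2 ^ K)%N s'.
  rewrite all_cat !all_map; apply/andP; split; apply/allP => q /(allP hs) /= sq.
    apply: leq_trans (size_even_poly _) _.
    by rewrite leq_uphalf_double -mul2n -expnS.
  apply: leq_trans (size_scale_leq _ _) _; apply: leq_trans (size_odd_poly _) _.
  by rewrite leq_half_double -mul2n -expnS (leq_trans sq).
have hM' : (forall z : C, `|z| = (r ^+ 2)%:C%C -> \sum_(q <- s') normR q.[z] ^+ 2 <= M).
  (* A point of the new circle is the square of some [z] on the old one; the parallelogram law
     combines the values at [z] and [- z]. *)
  move=> w hw; pose z := sqrtC w; have zw : z ^+ 2 = w by rewrite sqrtCK.
  have hz : `|z| = r%:C%C.
    apply/eqP; rewrite -(@eqrXn2 _ 2) // ?ler0c // -normrX zw hw rmorphXn //.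
  have h1 := hM z hz; have h2 := hM (- z); rewrite normrN in h2; have {}h2 := h2 hz.
  rewrite /s' big_cat !big_map /= -big_split /=.
  have e : 2 * \sum_(q <- s) (normR (even_poly q).[w] ^+ 2 + normR (r%:C%C *: odd_poly q).[w] ^+ 2)
      = \sum_(q <- s) normR q.[z] ^+ 2 + \sum_(q <- s) normR q.[- z] ^+ 2.
    rewrite mulr_sumr -big_split /=; apply: eq_bigr => q _.
    rewrite (horner_even_odd q z) (horner_even_odd q (- z)) sqrrN zw mulNr parallelogram.
    rewrite hornerZ !normRM !exprMn.
    congr (2 * (_ + _ * _)); rewrite normR_real; apply: complexI.
    by rewrite [RHS]rmorphXn /= (normR_C z) hz rmorphXn.
  lra.
have := IH s' (r ^+ 2) (sqr_ge0 r) hs' hM'; congr (_ <= _).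
rewrite /s' big_cat !big_map /= -big_split /=; apply: eq_bigr => q _.
rewrite expnS mul2n (sum_even_odd (fun m => normR q`_m ^+ 2 * (r ^+ 2) ^+ m)) -big_split; apply: eq_bigr => m _ /=.
rewrite coef_even_poly coefZ coef_odd_poly.
have -> : normR (r%:C%C * q`_m.*2.+1) ^+ 2 = r ^+ 2 * normR q`_m.*2.+1 ^+ 2.
  by rewrite normRM exprMn normR_real.
move: (r ^+ 2) (normR _ ^+ 2) (normR _ ^+ 2) => u a b.
by rewrite -!exprM mul2n [u ^+ m.*2.+1]exprS; ring.
Qed.

(** Iterating [|a + b|^2 <= 2 (|a|^2 + |b|^2)] produces the weights [2^(j + 1)]; the condition
    [2 t^2 <= r^2] absorbs them when the terms are [q_j t^j]. *)
Lemma normR_sum_sq (D : nat) (x : nat -> C) :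
  normR (\sum_(j < D) x j) ^+ 2 <= \sum_(j < D) 2 ^+ j.+1 * normR (x j) ^+ 2.
Proof.
elim: D x => [|D IH] x; first by rewrite !big_ord0 normR0 expr0n.
rewrite big_ord_recl [leRHS]big_ord_recl /=.
apply: le_trans (normRD_sq _ _) _; rewrite mulrDr expr1; apply: lerD => //.
apply: (@le_trans _ _ (2 * \sum_(j < D) 2 ^+ j.+1 * normR (x j.+1) ^+ 2)).
  by rewrite ler_pM2l //; exact: (IH (fun j => x j.+1)).
rewrite mulr_sumr le_eqVlt; apply/orP; left; apply/eqP.
by apply: eq_bigr => j _; rewrite mulrA -exprS.
Qed.

(** The remainder is [t q(t)] with [p = p_0 + p_1 t + t^2 q]. The shift by two degrees from [p] to
    [q] accounts for [1 / r^4], and the leftover power in the weights of [normR_sum_sq] for the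
    2. *)
Lemma poly_remainder p (D : nat) (t r : R) : t != 0 -> 0 < r -> 2 * t ^+ 2 <= r ^+ 2 ->
  (size p <= D)%N ->
  normR ((p.[t%:C%C] - p`_0) / t%:C%C - p`_1) ^+ 2 <=
  t ^+ 2 * (2 / r ^+ 4 * \sum_(m < D) normR p`_m ^+ 2 * (r ^+ 2) ^+ m).
Proof.
move=> t0 r0 tr sp; set T := t%:C%C.
have T0 : T != 0 by rewrite /T eq_complex /= eqxx andbT.
pose q := drop_poly 2 p.
have pE : p.[T] = p`_0 + p`_1 * T + q.[T] * T ^+ 2.
  rewrite -{1}(poly_take_drop 2 p) hornerD hornerM hornerXn; congr (_ + _).
  rewrite (horner_coef_wide _ (size_take_poly 2 p)) big_ord_recl big_ord1 /=.
  by rewrite !coef_take_poly /= expr0 mulr1 expr1.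
have -> : (p.[T] - p`_0) / T - p`_1 = T * q.[T] by rewrite pE; field.
rewrite normRM exprMn normR_real; apply: ler_wpM2l; first exact: sqr_ge0.
have sq : (size q <= D)%N by rewrite size_drop_poly (leq_trans (leq_subr _ _)).
rewrite (horner_coef_wide _ sq).
apply: le_trans (normR_sum_sq _ (fun j => q`_j * T ^+ j)) _.
have le1 : \sum_(j < D) 2 ^+ j.+1 * normR (q`_j * T ^+ j) ^+ 2 <=
    2 * \sum_(j < D) normR q`_j ^+ 2 * (r ^+ 2) ^+ j.
  rewrite mulr_sumr; apply: ler_sum => j _.
  have -> : normR (q`_j * T ^+ j) ^+ 2 = normR q`_j ^+ 2 * (t ^+ 2) ^+ j.
    by rewrite normRM exprMn; congr (_ * _); rewrite -rmorphXn normR_real -!exprM mulnC.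
  rewrite exprS -mulrA ler_pM2l // mulrCA; apply: ler_wpM2l; first exact: sqr_ge0.
  rewrite -exprMn; apply: lerXn2r; rewrite ?nnegrE.
      exact: mulr_ge0 (ler0n _ 2) (sqr_ge0 t).
    exact: sqr_ge0.
  exact: tr.
apply: le_trans le1 _; rewrite -mulrA ler_pM2l // ler_pdivlMl ?exprn_gt0 //.
pose F m := normR p`_m ^+ 2 * (r ^+ 2) ^+ m.
have F0 m : 0 <= F m by rewrite mulr_ge0 ?sqr_ge0 // exprn_ge0 // sqr_ge0.
have -> : r ^+ 4 * \sum_(j < D) normR q`_j ^+ 2 * (r ^+ 2) ^+ j = \sum_(j < D) F j.+2.
  rewrite mulr_sumr; apply: eq_bigr => j _.
  by rewrite coef_drop_poly /F addn2 mulrCA; congr (_ * _); rewrite -!exprM -exprD; congr (_ ^+ _); lia.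
have e : \sum_(j < D.+2) F j = \sum_(j < D) F j.
  by rewrite !big_ord_recr /= /F !nth_default ?normR0 ?expr0n ?mul0r ?addr0 // leqW.
rewrite -/F -[leRHS]e 2!big_ord_recl /= addrA.
rewrite (eq_bigr (fun j : 'I_D => F j.+2)) // lerDr addr_ge0 ?F0 //.
Qed.

End CauchyEstimate.

(** * Polynomial dependence of the coefficients along a line *)

Section TaylorExpansion.
Variables (R : realType) (N : nat) (Z X : 'M[R[i]]_N).
Local Notation C := R[i].
Implicit Types (n : occ N) (f g : occ N -> C).

(* The coefficient of [z^m] in the k-th power of [quadop (Z + z *: X)] on [vac]. *)
Fixpoint tay k m : occ N -> C :=
  if k is k'.+1 then
    fun n => quadop Z (tay k' m) n + (if m is m'.+1 then quadop X (tay k' m') n else 0)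
  else if m is 0 then @vac R N else fun=> 0.

Lemma quadop0 (Y : 'M[C]_N) : quadop Y (fun=> 0) = fun=> 0.
Proof. by apply: funext => n; rewrite /quadop big1 // => p _; rewrite !cre0 mulr0. Qed.

Lemma tayS k m : tay k.+1 m.+1 = fun n => quadop Z (tay k m.+1) n + quadop X (tay k m) n.
Proof. by []. Qed.

Lemma tay_gt k m : (k < m)%N -> tay k m = fun=> 0.
Proof.
elim: k m => [|k IH] [//|m] //= km.
by rewrite !IH ?quadop0 // ?(ltnW km) //; apply: funext => n; rewrite addr0.
Qed.

Lemma tay_eval k z n : qpow (Z + z *: X) k n = \sum_(m < k.+1) z ^+ m * tay k m n.
Proof.
elim: k n => [|k IH] n; first by rewrite big_ord1 expr0 mul1r.
rewrite /qpow iterS -/(qpow _ k).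
have -> : qpow (Z + z *: X) k = fun n => \sum_(m < k.+1) z ^+ m * tay k m n.
  by apply: funext => m; rewrite IH.
rewrite quadop_line !quadop_sum /=.
under [RHS]eq_bigr do rewrite mulrDr.
rewrite big_split /=; congr (_ + _).
  by rewrite [RHS]big_ord_recr /= tay_gt // quadop0 mulr0 addr0.
rewrite [RHS]big_ord_recl /= mulr0 add0r mulr_sumr.
by apply: eq_bigr => m _; rewrite mulrA -exprS.
Qed.

Lemma tay0 k : tay k 0 = qpow Z k.
Proof. by elim: k => //= k ->; apply: funext => n; rewrite addr0. Qed.

Lemma tay1 k : tay k.+1 1 = fun n => k.+1%:R * quadop X (qpow Z k) n.
Proof.
elim: k => [|k IH]; first by rewrite /= quadop0; apply: funext => n; rewrite add0r mul1r.
rewrite tayS IH tay0 quadopZ quadop_comm; apply: funext => n.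
by rewrite -/(qpow Z k.+1) -[k.+2%:R]natr1 mulrDl mul1r.
Qed.

Definition phipoly n : {poly C} :=
  if odd (occ_tot n) then 0
  else let k := (occ_tot n)./2 in
    \poly_(m < k.+1) ((- 2^-1) ^+ k / (k`!)%:R * tay k m n).

Lemma phipoly_eval z n : (phipoly n).[z] = squeeze_coef (Z + z *: X) n.
Proof.
rewrite /phipoly; have [on|en] := boolP (odd _); first by rewrite horner0 squeeze_odd.
have nk : occ_tot n = (occ_tot n)./2.*2.
  by rewrite -{1}[occ_tot n]odd_double_half (negbTE en).
rewrite (squeeze_phik _ nk) /phik tay_eval horner_poly mulr_sumr.
by apply: eq_bigr => m _; rewrite mulrCA mulrC.
Qed.

Lemma phipoly0 n : (phipoly n)`_0 = squeeze_coef Z n.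
Proof. by rewrite -horner_coef0 phipoly_eval scale0r addr0. Qed.

Lemma quadop_local (Y : 'M[C]_N) f g n :
  (forall m, (occ_tot m).+2 = occ_tot n -> f m = g m) -> quadop Y f n = quadop Y g n.
Proof.
move=> fg; apply: eq_bigr => p _; congr (_ * _); rewrite /cre.
case: eqP => // /eqP n1; case: eqP => // /eqP n2.
by rewrite fg // (occ_tot_decr n1) (occ_tot_decr n2).
Qed.

Lemma phipoly1 n : (phipoly n)`_1 = - 2^-1 * quadop X (squeeze_coef Z) n.
Proof.
rewrite /phipoly; have [on|en] := boolP (odd _).
  rewrite coef0 (@quadop_local X _ (fun=> 0) n) ?quadop0 ?mulr0 // => m mn.
  by rewrite squeeze_odd //; move: on; rewrite -mn /= negbK.
have nk : occ_tot n = (occ_tot n)./2.*2.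
  by rewrite -{1}[occ_tot n]odd_double_half (negbTE en).
move: nk; case: (occ_tot n)./2 => [|k] nk.
  rewrite coef_poly /= (@quadop_local X _ (fun=> 0) n) ?quadop0 ?mulr0 // => m mn.
  by move: mn; rewrite nk.
transitivity ((- 2^-1) ^+ k.+1 / (k.+1`!)%:R * tay k.+1 1 n); first by rewrite coef_poly.
rewrite tay1 (@quadop_local X (squeeze_coef Z) (phik Z k) n); last first.
  by move=> m; rewrite nk doubleS => -[] /squeeze_phik.
rewrite /phik quadopZ exprS factS natrM.
have k0 : (k.+1%:R : C) != 0 by rewrite pnatr_eq0.
have f0 : (k`!%:R : C) != 0 by rewrite pnatr_eq0 -lt0n fact_gt0.
by move: (k.+1%:R) (k`!%:R) k0 f0 => a b a0 b0; field; rewrite ?a0 ?b0.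
Qed.

End TaylorExpansion.

(** * Differentiability in l^2 and rapid decay *)

Section L2Derivative.
Variables (R : realType) (N : nat).
Local Notation C := R[i].
Implicit Types (n : occ N) (Z X : 'M[C]_N).

(** From [S^2 det = 1] and [det >= m] follows [S^2 <= 1 / m], hence [S <= 1 + 1 / m]. *)
Lemma squeeze_bound Z X : inM Z -> X^T = X ->
  exists2 r : R, 0 < r & exists2 M : R, 0 <= M & forall z : C, `|z| <= r%:C%C ->
    inM (Z + z *: X) /\ (l2sq (squeeze_coef (Z + z *: X)) <= M%:E)%E.
Proof.
move=> hZ sX; have [r r0 [m m0 h]] := inM_line hZ sX.
exists r => //; exists (1 + m^-1); first by rewrite addr_ge0 // invr_ge0 ltW.
move=> z /h[hW hd]; split=> //; have [S [S0 -> SS]] := squeeze_norm hW.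
rewrite lee_fin; set d := complex.Re _ in SS.
have md : m <= d by move: hd; rewrite lecE => /andP[].
have : S ^+ 2 <= m^-1.
  by rewrite -[m^-1]mul1r ler_pdivlMr // -SS ler_wpM2l ?sqr_ge0.
have := sqr_ge0 (S - 1); have := sqr_ge0 S; nra.
Qed.

Lemma l2sq_le_fin (T : choiceType) (f : T -> C) (M : R) :
  (forall s : seq T, uniq s -> \sum_(x <- s) normR (f x) ^+ 2 <= M) ->
  (l2sq f <= M%:E)%E.
Proof.
move=> h; apply: ge_ereal_sup => _ [F [finF _]] <-.
rewrite fsbig_finite //= sumEFin lee_fin; apply: h; exact: finmap.fset_uniq.
Qed.

Lemma l2sq_ge_fin (T : choiceType) (f : T -> C) (M : R) (s : seq T) :
  uniq s -> (l2sq f <= M%:E)%E -> \sum_(x <- s) normR (f x) ^+ 2 <= M.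
Proof.
move=> us h; rewrite -lee_fin; apply: le_trans h; apply: esum_ge.
exists [set` s]; first by split => //; exact: finite_seq.
by rewrite -(@fsbig_seq _ _ _ _ s _ us) sumEFin.
Qed.

(** The squared norm is a supremum over finite sets of indices. On each, the coefficients are
    finitely many polynomials obeying the common bound [M] on the circle, and the resulting estimate
    depends neither on their number nor on their degrees. *)
Lemma phi_diff Z X : inM Z -> X^T = X ->
  exists2 r : R, 0 < r & exists2 B : R, 0 <= B & forall t : R, t != 0 -> 2 * t ^+ 2 <= r ^+ 2 ->
    (l2sq (fun n => (squeeze_coef (Z + t%:C%C *: X) n - squeeze_coef Z n) / t%:C%C
            - (- 2^-1 * quadop X (squeeze_coef Z) n))%R <= (t ^+ 2 * B)%:E)%E.
Proof.
move=> hZ sX; have [r r0 [M M0 h]] := squeeze_bound hZ sX.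
exists r => //; exists (2 / r ^+ 4 * M).
  by rewrite mulr_ge0 // divr_ge0 // exprn_ge0 // ltW.
move=> t t0 tr; apply: l2sq_le_fin => s us.
pose K := \max_(n <- s) size (phipoly Z X n).
have sK n : n \in s -> (size (phipoly Z X n) <= 2 ^ K)%N.
  move=> ns; apply: leq_trans (ltnW (ltn_expl _ (ltnSn 1))).
  by rewrite /K (big_rem n) //= leq_maxl.
apply: (@le_trans _ _ (\sum_(n <- s) t ^+ 2 * (2 / r ^+ 4 *
    \sum_(m < 2 ^ K) normR (phipoly Z X n)`_m ^+ 2 * (r ^+ 2) ^+ m))).
  rewrite big_seq [leRHS]big_seq; apply: ler_sum => n ns.
  rewrite -phipoly_eval -(phipoly0 Z X) -phipoly1.
  exact: poly_remainder (sK n ns).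
rewrite -mulr_sumr -mulr_sumr; apply: ler_wpM2l; first exact: sqr_ge0.
apply: ler_wpM2l; first by rewrite divr_ge0 // exprn_ge0 // ltW.
have := @parseval_le R K [seq phipoly Z X n | n <- s] r M (ltW r0).
rewrite big_map; apply; first by rewrite all_map; apply/allP => n /sK.
move=> z hz; rewrite big_map; under eq_bigr do rewrite phipoly_eval.
by apply: l2sq_ge_fin us _; apply: (h z _).2; rewrite hz.
Qed.

(** [rho^m] splits into two factors [sqrt(rho)^m]: one is used by the induction hypothesis, the
    other by Bernoulli's inequality to dominate the extra [m + 1]. *)
Lemma poly_le_exp (k : nat) (rho : R) : 1 < rho ->
  exists2 B : R, 0 <= B & forall m : nat, m.+1%:R ^+ k <= B * rho ^+ m.
Proof.
elim: k rho => [|k IH] rho r1.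
  by exists 1 => // m; rewrite expr0 mul1r exprn_ege1 // ltW.
pose s := Num.sqrt rho.
have s1 : 1 < s by rewrite -(@sqrtr1 R) ltr_sqrt // (lt_trans _ r1).
have [B B0 hB] := IH s s1.
pose d := s - 1; have d0 : 0 < d by rewrite subr_gt0.
exists (B * (1 + d^-1)); first by rewrite mulr_ge0 // addr_ge0 // invr_ge0 ltW.
move=> m; rewrite exprSr.
have sE : rho ^+ m = s ^+ m * s ^+ m.
  by rewrite -exprMn -expr2 sqr_sqrtr // ltW // (lt_trans _ r1).
rewrite sE mulrACA; apply: ler_pM => //.
have bern : 1 + m%:R * d <= s ^+ m.
  elim: m {sE hB} => [|m IHm]; first by rewrite mul0r addr0 expr0.
  rewrite exprS -natr1; apply: (@le_trans _ _ (s * (1 + m%:R * d))).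
    have sd : s = 1 + d by rewrite /d addrC subrK.
    rewrite [in leRHS]sd; have : 0 <= m%:R * (d * d) :> R by rewrite mulr_ge0 ?ler0n // mulr_ge0 // ltW.
    move: (m%:R : R) => x; lra.
  by rewrite ler_pM2l // (lt_trans _ s1).
apply: (@le_trans _ _ ((1 + d^-1) * (1 + m%:R * d))); last first.
  by rewrite ler_pM2l // addr_gt0 // invr_gt0.
have di : d^-1 * d = 1 by rewrite mulVf // gt_eqF.
have -> : (1 + d^-1) * (1 + m%:R * d) = 1 + m%:R * d + d^-1 + m%:R * (d^-1 * d) by ring.
rewrite -natr1 di mulr1.
have : 0 <= m%:R * d by rewrite mulr_ge0 ?ler0n // ltW.
have : 0 < d^-1 by rewrite invr_gt0.
move: (m%:R : R) (d^-1) => x y; lra.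
Qed.

Lemma qpowZ c Z k n : qpow (c *: Z) k n = c ^+ k * qpow Z k n.
Proof.
elim: k n => [|k IH] n; first by rewrite expr0 mul1r.
rewrite /qpow !iterS -/(qpow _ k) -/(qpow _ k).
have -> : qpow (c *: Z) k = fun n => c ^+ k * qpow Z k n by apply: funext.
rewrite quadopZ exprS -mulrA mulrCA; congr (_ * _).
rewrite /quadop mulr_sumr; apply: eq_bigr => p _; rewrite mxE mulrA //.
Qed.

(** The bound in the direction [X = Z] shows that [(1 + r) Z] still gives a square-summable vector.
    Its coefficient at [n] is [(1 + r)^(|n| / 2)] times that of [Z], and this gain beats every power
    of [|n|]. *)
Lemma squeeze_tempered Z : inM Z -> tempered (squeeze_coef Z).
Proof.
move=> hZ k; have [r r0 [M M0 h]] := squeeze_bound hZ hZ.1.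
have /h[_ hl] : `|r%:C%C| <= r%:C%C.
  by rewrite normc_def /= expr0n addr0 sqrtr_sqr ger0_norm // ltW.
have r1 : 1 < 1 + r by rewrite ltrDl.
have [B B0 hB] := poly_le_exp k r1.
have sl : asummable (fun n : occ N => B * normR (squeeze_coef (Z + r%:C%C *: Z) n) ^+ 2).
  apply: asummableZ; apply: le_lt_trans (ltry M); apply: le_trans hl.
  by apply: le_esum => n _; rewrite lee_fin ger0_norm ?sqr_ge0.
apply: asummable_le sl => n.
rewrite ger0_norm ?weight_ge0 // ger0_norm ?(mulr_ge0 B0 (sqr_ge0 _)) //.
have [on|en] := boolP (odd (occ_tot n)).
  by rewrite !squeeze_odd // normR0 expr0n /= !mulr0.
have nk : occ_tot n = (occ_tot n)./2.*2.
  by rewrite -{1}[occ_tot n]odd_double_half (negbTE en).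
rewrite !(squeeze_phik _ nk) /phik.
have -> : Z + r%:C%C *: Z = (1 + r)%:C%C *: Z by rewrite rmorphD rmorph1 scalerDl scale1r.
rewrite qpowZ; set a := _ / _; set x := qpow _ _ _; set j := (occ_tot n)./2.
have -> : normR (a * ((1 + r)%:C%C ^+ j * x)) ^+ 2 = ((1 + r) ^+ j) ^+ 2 * normR (a * x) ^+ 2.
  by rewrite mulrCA normRM exprMn -rmorphXn normR_real.
rewrite [leRHS]mulrA; apply: ler_wpM2r; first exact: sqr_ge0.
apply: le_trans (hB _) _; rewrite -exprM muln2 -nk //.
Qed.

End L2Derivative.

(** * Bogoliubov operators and Wick's formula *)

Section Bogoliubov.
Variables (R : realType) (N : nat) (Z : 'M[R[i]]_N).
Local Notation C := R[i].
Implicit Types (n : occ N) (i j p q : 'I_N) (f g : occ N -> C).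

(* [bst p] is the adjoint of [bop p], and [psi Z] is the vacuum of the [bop q]. *)
Definition bop q f n : C := ann q f n + \sum_j Z q j * cre j f n.
Definition bst p f n : C := cre p f n + \sum_j (Z p j)^* * ann j f n.

Lemma ann_ann i j f : ann i (ann j f) = ann j (ann i f).
Proof.
apply: funext => n; have [->//|ij] := eqVneq i j.
rewrite /ann !occ_incrE [j == i]eq_sym (negbTE ij) !addn0.
by rewrite occ_incrC mulrCA.
Qed.

Lemma tempered_bst p f : tempered f -> tempered (bst p f).
Proof.
move=> tf; apply: temperedD; first exact: tempered_cre.
by apply: tempered_sum => j; exact: tempered_ann.
Qed.

Lemma ip_bstr q f g : tempered f -> tempered g -> ip f (bst q g) = ip (bop q f) g.
Proof.
move=> tf tg; rewrite /bop.
rewrite (ipDl (tempered_ann _ tf) (tempered_sum _ _ (fun j => tempered_cre j tf)) tg).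
rewrite (ip_suml _ _ (fun j => tempered_cre j tf) tg) ip_annl.
rewrite ip_conj (ipDl (tempered_cre _ tg) (tempered_sum _ _ (fun j => tempered_ann j tg)) tf).
rewrite rmorphD /= -ip_conj; congr (_ + _).
rewrite -ip_conj (ip_sumr _ _ (fun j => tempered_ann j tg) tf).
by apply: eq_bigr => j _; rewrite conjCK ip_crel.
Qed.

Lemma bstZ p c f : bst p (fun n => c * f n) = fun n => c * bst p f n.
Proof.
apply: funext => n; rewrite /bst creZ mulrDr mulr_sumr; congr (_ + _).
by apply: eq_bigr => j _; rewrite annZ mulrCA.
Qed.

Lemma bst_sum (I : Type) (r : seq I) (c : I -> C) (f : I -> occ N -> C) p :
  bst p (fun n => \sum_(k <- r) c k * f k n) =
  fun n => \sum_(k <- r) c k * bst p (f k) n.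
Proof.
apply: funext => n; rewrite /bst cre_sum.
under [X in _ + X]eq_bigr => j _ do rewrite ann_sum mulr_sumr.
rewrite exchange_big -big_split; apply: eq_bigr => k _ /=.
by rewrite mulrDr mulr_sumr; congr (_ + _); apply: eq_bigr => j _; rewrite mulrCA.
Qed.

Lemma sum_delta (F : 'I_N -> C) i : \sum_j (i == j)%:R * F j = F i.
Proof.
rewrite (bigD1 i) //= eqxx mul1r big1 ?addr0 // => j ji.
by rewrite eq_sym (negbTE ji) mul0r.
Qed.

Lemma bop_bst q p f : bop q (bst p f) =
  fun n => bst p (bop q f) n + (1%:M - Z *m adjmx Z) q p * f n.
Proof.
apply: funext => n.
(* Both orders of the product share [A], [B] and [D]; they differ by the contraction [(q == p)] in
   one and by [E], an entry of [Z Z^*], in the other. *)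
pose A := \sum_l (Z p l)^* * ann q (ann l f) n.
pose B := \sum_j Z q j * cre p (cre j f) n.
pose D := \sum_l \sum_j Z q j * ((Z p l)^* * cre j (ann l f) n).
pose E := \sum_l Z q l * (Z p l)^*.
have eL : bop q (bst p f) n = cre p (ann q f) n + (q == p)%:R * f n + A + (B + D).
  have e1 : ann q (bst p f) n = cre p (ann q f) n + (q == p)%:R * f n + A.
    by rewrite /bst annD (ann_sum _ (fun l => (Z p l)^*)) ann_cre.
  have e2 j : cre j (bst p f) n = cre p (cre j f) n +
      \sum_l (Z p l)^* * cre j (ann l f) n.
    by rewrite /bst creD (cre_sum _ (fun l => (Z p l)^*)) (cre_cre j p).
  rewrite {1}/bop e1; congr (_ + _).
  rewrite (eq_bigr _ (fun j _ => congr1 (fun x => Z q j * x) (e2 j))).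
  under eq_bigr do rewrite mulrDr mulr_sumr.
  by rewrite big_split /= /D [in RHS]exchange_big.
have eR : bst p (bop q f) n = cre p (ann q f) n + B + (A + (D + E * f n)).
  have e1 : cre p (bop q f) n = cre p (ann q f) n + B.
    by rewrite /bop creD (cre_sum _ (fun l => Z q l)).
  have e2 l : ann l (bop q f) n = ann q (ann l f) n +
      (\sum_j Z q j * cre j (ann l f) n + Z q l * f n).
    rewrite /bop annD (ann_sum _ (fun l => Z q l)) (ann_ann l q); congr (_ + _).
    under eq_bigr do rewrite ann_cre mulrDr; rewrite big_split; congr (_ + _).
    by under eq_bigr do rewrite mulrCA; rewrite sum_delta.
  rewrite {1}/bst e1; congr (_ + _).
  rewrite (eq_bigr _ (fun j _ => congr1 (fun x => (Z p j)^* * x) (e2 j))).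
  under eq_bigr do rewrite mulrDr; rewrite big_split; congr (_ + _).
  under eq_bigr do rewrite mulrDr; rewrite big_split /= /E mulr_suml; congr (_ + _).
    apply: eq_bigr => l _; rewrite mulr_sumr; apply: eq_bigr => j _.
    by rewrite mulrCA.
  by apply: eq_bigr => l _; rewrite mulrA [_^* * _]mulrC.
have -> : (1%:M - Z *m adjmx Z) q p = (q == p)%:R - E.
  by rewrite !mxE; congr (_ - _); apply: eq_bigr => l _; rewrite adjmxE.
rewrite eL eR; ring.
Qed.

(** * Excitations of a normalized vector annihilated by every [bop q] *)

Section Vacuum.
Variable psi : occ N -> C.
Hypotheses (sZ : Z^T = Z) (tpsi : tempered psi) (npsi : ip psi psi = 1)
  (bpsi : forall q, bop q psi = fun=> 0).

Let S := 1%:M - Z *m adjmx Z.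
Let Li := 1%:M - adjmx Z *m Z.

Lemma bst0 p : bst p (fun=> 0) = fun=> 0.
Proof.
apply: funext => n; rewrite /bst cre0 add0r big1 // => j _.
by rewrite /ann !mulr0.
Qed.

Lemma bop_bst_vac q p : bop q (bst p psi) = fun n => S q p * psi n.
Proof. by rewrite bop_bst bpsi bst0; apply: funext => n; rewrite add0r. Qed.

Lemma ip_bst_bst p r : ip (bst p psi) (bst r psi) = S r p.
Proof.
rewrite (ip_bstr _ (tempered_bst _ tpsi) tpsi) bop_bst_vac (ipZl _ tpsi tpsi).
by rewrite npsi mulr1.
Qed.

(** [bop q] is moved to the right until it annihilates [psi]; its two contractions leave inner
    products of single excitations. *)
Lemma wick p m q r : ip (bst p (bst m psi)) (bst q (bst r psi)) =
  S q m * S r p + S q p * S r m.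
Proof.
have t1 := tempered_bst; have tm := t1 m _ tpsi; have tr := t1 r _ tpsi.
rewrite (ip_bstr _ (t1 p _ tm) tr) bop_bst bop_bst_vac bstZ.
rewrite (ipDl (temperedZ _ (t1 p _ tpsi)) (temperedZ _ tm) tr).
by rewrite (ipZl _ (t1 p _ tpsi) tr) (ipZl _ tm tr) !ip_bst_bst.
Qed.

Lemma ip_bst2_vac p m : ip (bst p (bst m psi)) psi = 0.
Proof.
have tm := tempered_bst m tpsi.
rewrite ip_conj (ip_bstr _ tpsi tm) bpsi.
rewrite (_ : ip _ _ = 0) ?conjC0 // /ip -[RHS](csum0 _ (occ N)).
by apply: eq_csum => n; rewrite mul0r.
Qed.

(** On [psi] every annihilator may be replaced by [- Z a^*], so [b^*] acts there as
    [(1 - Z^* Z) a^*]. *)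
Lemma bst_vac m : bst m psi = fun n => \sum_l Li m l * cre l psi n.
Proof.
apply: funext => n; rewrite /bst.
have ea j : ann j psi n = - \sum_l Z j l * cre l psi n.
  by apply/eqP; rewrite -addr_eq0; apply/eqP; exact: (congr1 (fun f => f n) (bpsi j)).
under eq_bigr do rewrite ea mulrN mulr_sumr.
rewrite sumrN exchange_big.
under [RHS]eq_bigr => l _ do rewrite !mxE mulrBl.
rewrite [RHS]sumrB; congr (_ - _).
  by under eq_bigr do rewrite -mulr_natl mulr1; rewrite sum_delta.
apply: eq_bigr => l _; rewrite mulr_suml; apply: eq_bigr => j _.
by rewrite adjmxE (_ : Z j m = Z m j) ?mulrA // -{1}sZ mxE.
Qed.

Lemma bst_cre_vac p l : bst p (cre l psi) =
  fun n => (Z p l)^* * psi n + \sum_k Li p k * cre l (cre k psi) n.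
Proof.
apply: funext => n.
have -> : \sum_k Li p k * cre l (cre k psi) n = cre l (bst p psi) n.
  by rewrite bst_vac (cre_sum _ (fun k => Li p k)).
rewrite /bst creD (cre_sum _ (fun j => (Z p j)^*)) cre_cre addrCA; congr (_ + _).
have e j : ann j (cre l psi) n = cre l (ann j psi) n + (j == l)%:R * psi n.
  by rewrite ann_cre.
under eq_bigr do rewrite e mulrDr; rewrite big_split /= addrC; congr (_ + _).
by under eq_bigr do rewrite mulrCA eq_sym; rewrite sum_delta.
Qed.

(** The vector [(b^*, T b^* ) psi]. *)
Definition pairop (T : 'M[C]_N) n : C :=
  \sum_(p : 'I_N * 'I_N) T p.1 p.2 * bst p.1 (bst p.2 psi) n.

Lemma tempered_pairop T : tempered (pairop T).
Proof. by apply: tempered_sum => p; do 2 apply: tempered_bst. Qed.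

Lemma ip_pairop_vac T : ip (pairop T) psi = 0.
Proof.
rewrite /pairop (ip_suml _ (fun p : 'I_N * 'I_N => T p.1 p.2) (f := fun p : 'I_N * 'I_N => bst p.1 (bst p.2 psi))) //.
  by rewrite big1 // => p _; rewrite ip_bst2_vac mulr0.
by move=> p; do 2 apply: tempered_bst.
Qed.

(** Normal ordering: both [b^*] turn into [Li a^*], and the contraction between them contributes the
    multiple of [psi]. The identity [Li^T = S] arranges the coefficients as [S T Li]. *)
Lemma pairop_quadop (T X : 'M[C]_N) : S *m T *m Li = X ->
  exists c, forall n, pairop T n = quadop X psi n + c * psi n.
Proof.
move=> eX.
exists (\sum_(p : 'I_N * 'I_N) T p.1 p.2 * \sum_l Li p.2 l * (Z p.1 l)^*) => n.
have e p m : bst p (bst m psi) n = (\sum_l Li m l * (Z p l)^*) * psi n +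
    \sum_l \sum_k Li m l * Li p k * cre l (cre k psi) n.
  rewrite bst_vac bst_sum mulr_suml -big_split; apply: eq_bigr => l _.
  rewrite bst_cre_vac mulrDr mulrA /= mulr_sumr; congr (_ + _).
  by apply: eq_bigr => k _; rewrite mulrA.
rewrite /pairop; under eq_bigr do rewrite e mulrDr mulrA; rewrite big_split /=.
rewrite -mulr_suml addrC; congr (_ + _).
rewrite /quadop -eX.
rewrite -(pair_bigA _ (fun k l => (S *m T *m Li) k l * cre k (cre l psi) n)) /=.
have tS : Li^T = S by rewrite /Li -(tr_sym_ZZ sZ) trmxK.
have eM k l : (S *m T *m Li) k l = \sum_(p : 'I_N * 'I_N) T p.1 p.2 * (Li p.2 l * Li p.1 k).
  rewrite mxE -(pair_bigA _ (fun p m => T p m * (Li m l * Li p k))) exchange_big /=.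
  apply: eq_bigr => m _; rewrite mxE mulr_suml; apply: eq_bigr => p _.
  by rewrite -tS mxE; ring.
under [RHS]eq_bigr => k _ do under eq_bigr => l _ do rewrite eM mulr_suml.
rewrite exchange_big /=.
under [RHS]eq_bigr => l _ do rewrite exchange_big /=.
rewrite exchange_big /=; apply: eq_bigr => p _; rewrite mulr_sumr.
apply: eq_bigr => l _; rewrite mulr_sumr; apply: eq_bigr => k _.
by rewrite cre_cre !mulrA.
Qed.

(** The two Wick pairings produce [X] and its transpose against [T']; they coincide since [X] is
    symmetric, whence the 2. *)
Lemma ip_pairop (T T' X : 'M[C]_N) : S *m T *m S^T = X -> X^T = X ->
  ip (pairop T) (pairop T') = 2 * \tr (X *m adjmx T').
Proof.
move=> eX sX.
have tb (p : 'I_N * 'I_N) : tempered (bst p.1 (bst p.2 psi)) by do 2 apply: tempered_bst.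
rewrite {1}/pairop (ip_suml _ (fun p : 'I_N * 'I_N => T p.1 p.2) tb (tempered_pairop T')).
have e (p : 'I_N * 'I_N) : ip (bst p.1 (bst p.2 psi)) (pairop T') =
    \sum_(q : 'I_N * 'I_N) (T' q.1 q.2)^* * (S q.1 p.2 * S q.2 p.1 + S q.1 p.1 * S q.2 p.2).
  rewrite /pairop (ip_sumr _ (fun q : 'I_N * 'I_N => T' q.1 q.2) tb (tb p)).
  by apply: eq_bigr => q _; rewrite wick.
under eq_bigr do rewrite e mulr_sumr; rewrite exchange_big /=.
have eM q r : X q r = \sum_(p : 'I_N * 'I_N) T p.1 p.2 * (S q p.1 * S r p.2).
  rewrite -eX mxE -(pair_bigA _ (fun p m => T p m * (S q p * S r m))) exchange_big /=.
  apply: eq_bigr => m _; rewrite [S^T m r]mxE mxE mulr_suml; apply: eq_bigr => p _.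
  ring.
have -> : \tr (X *m adjmx T') = \sum_(q : 'I_N * 'I_N) X q.1 q.2 * (T' q.1 q.2)^*.
  rewrite -(pair_bigA _ (fun q r => X q r * (T' q r)^*)); apply: eq_bigr => q _.
  by rewrite mxE; apply: eq_bigr => r _; rewrite adjmxE.
rewrite mulr_sumr; apply: eq_bigr => -[q r] _ /=.
have sX' : X q r = \sum_(p : 'I_N * 'I_N) T p.1 p.2 * (S r p.1 * S q p.2).
  by rewrite -eM -[in RHS]sX mxE.
rewrite (_ : 2 * (X q r * (T' q r)^*) = (X q r + X q r) * (T' q r)^*); last by ring.
rewrite {1}sX' eM -big_split /= mulr_suml; apply: eq_bigr => p _; ring.
Qed.

End Vacuum.

End Bogoliubov.

(** * Calculus of l^2 remainders tending to 0 *)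

Section L2Small.
Variables (R : realType).
Local Notation C := R[i].

(* Convergence of [l2sq (v t)] to 0, with a real majorant to avoid limits in [\bar R]. *)
Definition l2small (T : choiceType) (v : R -> T -> C) :=
  exists2 E : R -> R, E t @[t --> (0 : R)^'] --> (0 : R) &
    \forall t \near (0 : R)^', (l2sq (v t) <= (E t)%:E)%E.

Lemma cvg_mull0 (K : R) (E : R -> R) : E t @[t --> (0 : R)^'] --> (0 : R) ->
  K * E t @[t --> (0 : R)^'] --> (0 : R).
Proof.
by move=> hE; rewrite -[X in _ --> X](mulr0 K); apply: cvgM hE; exact: cvg_cst.
Qed.

Lemma cvg_mulr0 (K : R) (E : R -> R) : E t @[t --> (0 : R)^'] --> (0 : R) ->
  E t * K @[t --> (0 : R)^'] --> (0 : R).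
Proof.
by move=> hE; rewrite -[X in _ --> X](mul0r K); apply: cvgM hE _; exact: cvg_cst.
Qed.

Lemma l2small_cvg (T : choiceType) (v : R -> T -> C) : l2small v ->
  (fun t => l2sq (v t)) @ (0 : R)^' --> 0%E.
Proof.
move=> [E E0 hE]; apply: (@squeeze_cvge _ _ _ _ (fun=> 0%E) _ (fun t => (E t)%:E)).
  by apply: filterS hE => t ->; rewrite l2sq_ge0.
  exact: cvg_cst.
  by apply: cvg_EFin => //; exact: nearW.
Qed.

Lemma l2smallD (T : choiceType) (v w : R -> T -> C) : l2small v -> l2small w ->
  l2small (fun t x => v t x + w t x).
Proof.
move=> [E E0 hE] [F F0 hF]; exists (fun t => 2 * (E t + F t)).
  by apply: cvg_mull0; rewrite -[X in _ --> X](addr0 0); exact: cvgD.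
near=> t; apply: le_trans (l2sqD _ _) _; rewrite EFinM lee_pmul2l // EFinD.
by apply: leeD; near: t.
Unshelve. all: by end_near. Qed.

Lemma l2small_scale (T : choiceType) (c : R -> C) (K : R) (v : R -> T -> C) :
  (\forall t \near (0 : R)^', normR (c t) ^+ 2 <= K) -> l2small v ->
  l2small (fun t x => c t * v t x).
Proof.
move=> hc [E E0 hE]; exists (fun t => K * E t).
  exact: cvg_mull0.
near=> t; rewrite l2sqZ [leRHS]EFinM; apply: lee_pmul.
  by rewrite lee_fin sqr_ge0.
  exact: l2sq_ge0.
  by rewrite lee_fin; near: t.
  by near: t.
Unshelve. all: by end_near. Qed.

Lemma l2small_fixed (T : choiceType) (c : R -> C) (f : T -> C) :
  normR (c t) ^+ 2 @[t --> (0 : R)^'] --> (0 : R) -> (l2sq f < +oo)%E ->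
  l2small (fun t x => c t * f x).
Proof.
move=> hc hf; exists (fun t => normR (c t) ^+ 2 * fine (l2sq f)).
  exact: cvg_mulr0.
by near=> t; rewrite l2sqZ [leRHS]EFinM fineK // ge0_fin_numE // l2sq_ge0.
Unshelve. all: by end_near. Qed.

Lemma l2small_tensorl (T T' : choiceType) (v : R -> T -> C) (w : R -> T' -> C) (K : R) :
  l2small v -> (\forall t \near (0 : R)^', (l2sq (w t) <= K%:E)%E) ->
  l2small (fun t (p : T * T') => v t p.1 * (w t p.2)^*).
Proof.
move=> [E E0 hE] hw; exists (fun t => E t * K).
  exact: cvg_mulr0.
near=> t; have hwt : (l2sq (w t) <= K%:E)%E by near: t.
rewrite l2sq_tensor; last exact: le_lt_trans hwt (ltry _).
by rewrite EFinM; apply: lee_pmul => //; rewrite ?l2sq_ge0 //; near: t.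
Unshelve. all: by end_near. Qed.

Lemma l2small_tensorr (T T' : choiceType) (v : T -> C) (w : R -> T' -> C) :
  (l2sq v < +oo)%E -> l2small w ->
  l2small (fun t (p : T * T') => v p.1 * (w t p.2)^*).
Proof.
move=> hv [E E0 hE]; exists (fun t => fine (l2sq v) * E t).
  exact: cvg_mull0.
near=> t; have hwt : (l2sq (w t) <= (E t)%:E)%E by near: t.
rewrite l2sq_tensor; last exact: le_lt_trans hwt (ltry _).
by rewrite EFinM fineK ?ge0_fin_numE ?l2sq_ge0 //; apply: lee_pmul => //; rewrite ?l2sq_ge0.
Unshelve. all: by end_near. Qed.

Lemma l2small_near (T : choiceType) (v w : R -> T -> C) :
  (\forall t \near (0 : R)^', v t = w t) -> l2small v -> l2small w.
Proof.
move=> vw [E E0 hE]; exists E => //; near=> t.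
by rewrite -(near vw t) //; near: t.
Unshelve. all: by end_near. Qed.

Lemma cvg_sub_lim (c : R -> R) (l : R) : c t @[t --> (0 : R)^'] --> l ->
  c t - l @[t --> (0 : R)^'] --> (0 : R).
Proof.
by move=> hc; rewrite -[X in _ --> X](subrr l); apply: cvgB hc _; exact: cvg_cst.
Qed.

Lemma real_quotient_cvg (b : R -> R) (b' : R) : is_derive (0 : R) (1 : R) b b' ->
  (b t - b 0) / t - b' @[t --> (0 : R)^'] --> (0 : R).
Proof.
move=> db; have /cvg_ex[l hl] := @ex_derive _ _ _ _ _ _ _ db.
have e : l = b' by rewrite -(@derive_val _ _ _ _ _ _ _ db); apply/esym/cvg_lim.
apply: cvg_sub_lim; rewrite -e; apply: cvg_trans hl; apply: near_eq_cvg; near=> t.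
by rewrite /= /GRing.scale /= mulr1 addr0 mulrC.
Unshelve. all: by end_near. Qed.

Lemma cvg_sq0 (c : R -> R) : c t @[t --> (0 : R)^'] --> (0 : R) ->
  normR (c t)%:C%C ^+ 2 @[t --> (0 : R)^'] --> (0 : R).
Proof.
move=> hc; have h : c t * c t @[t --> (0 : R)^'] --> (0 : R).
  by rewrite -[X in _ --> X](mulr0 0); exact: cvgM.
apply: cvg_trans h; apply: near_eq_cvg; near=> t.
by rewrite normR_real expr2.
Unshelve. all: by end_near. Qed.

Lemma near0_neq : \forall t \near (0 : R)^', t != 0.
Proof. exact: nbhs_dnbhs_neq. Qed.

(** The remainder of [b u] is [b(t)] times the remainder of [u], plus the remainder of [b] times
    [f], plus [(b(t) - b(0)) f']. *)
Lemma l2small_product (T : choiceType) (b : R -> R) (b' : R) (u : R -> T -> C)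
    (f f' F F' : T -> C) (U : R -> T -> C) :
  is_derive (0 : R) (1 : R) b b' -> (l2sq f < +oo)%E -> (l2sq f' < +oo)%E ->
  l2small (fun t x => (u t x - f x) / t%:C%C - f' x) ->
  (\forall t \near (0 : R)^', U t = fun x => (b t)%:C%C * u t x) ->
  F = (fun x => (b 0)%:C%C * f x) ->
  F' = (fun x => b'%:C%C * f x + (b 0)%:C%C * f' x) ->
  l2small (fun t x => (U t x - F x) / t%:C%C - F' x).
Proof.
move=> db hf hf' hu hU -> ->.
have cb : b t @[t --> (0 : R)^'] --> b 0.
  by apply: cvg_within_filter; exact: is_derive_continuous0 db.
have bnd : \forall t \near (0 : R)^', normR (b t)%:C%C ^+ 2 <= (b 0 ^+ 2 + 1).
  have : b t * b t @[t --> (0 : R)^'] --> b 0 * b 0 by apply: cvgM.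
  move=> /cvgr_le /(_ (b 0 ^+ 2 + 1)); rewrite -expr2 ltrDl ltr01 => /(_ isT).
  by apply: filterS => t; rewrite normR_real.
have s1 := l2small_scale bnd hu.
have s2 := l2small_fixed (cvg_sq0 (real_quotient_cvg db)) hf.
have s3 := l2small_fixed (cvg_sq0 (cvg_sub_lim cb)) hf'.
apply: l2small_near (l2smallD s1 (l2smallD s2 s3)).
near=> t; have t0 : t != 0 by near: t; exact: near0_neq.
rewrite (near hU t) //; apply: funext => x.
have T0 : (t%:C%C : C) != 0 by rewrite eq_complex /= eqxx andbT.
have ec (a c : R) : ((a / c)%:C%C : C) = a%:C%C / c%:C%C by rewrite rmorphM fmorphV.
rewrite rmorphB /= ec !rmorphB /=.
by field.
Unshelve. all: by end_near. Qed.

(** With [rho] the remainder of [U], that of [U (x) conj U] is [rho (x) conj U + F (x) conj (U - f)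
    + f (x) conj rho], where [U - f = t rho + t F]. *)
Lemma l2small_tensor (T : choiceType) (U : R -> T -> C) (f F : T -> C) (K : R) :
  l2small (fun t x => (U t x - f x) / t%:C%C - F x) ->
  (l2sq f < +oo)%E -> (l2sq F < +oo)%E ->
  (\forall t \near (0 : R)^', (l2sq (U t) <= K%:E)%E) ->
  l2small (fun t (p : T * T) =>
    (U t p.1 * (U t p.2)^* - f p.1 * (f p.2)^*) / t%:C%C
    - (F p.1 * (f p.2)^* + f p.1 * (F p.2)^*)).
Proof.
move=> hU hf hF hK.
have ct : t @[t --> (0 : R)^'] --> (0 : R) by exact: cvg_within.
have bt : \forall t \near (0 : R)^', normR (t%:C%C : C) ^+ 2 <= 1.
  by move: (cvg_sq0 ct) => /cvgr_le; apply; exact: ltr01.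
have s1 := l2small_tensorl hU hK.
have s2 := l2small_tensorr hF (l2smallD (l2small_scale bt hU) (l2small_fixed (cvg_sq0 ct) hF)).
have s3 := l2small_tensorr hf hU.
apply: l2small_near (l2smallD s1 (l2smallD s2 s3)).
near=> t; have t0 : t != 0 by near: t; exact: near0_neq.
apply: funext => -[x y] /=.
have T0 : (t%:C%C : C) != 0 by rewrite eq_complex /= eqxx andbT.
have cT : ((t%:C%C : C)^*) = t%:C%C by exact: conjc_real.
rewrite !(rmorphD, rmorphN, rmorphM, fmorphV) /= cT.
move: (t%:C%C) T0 ((U t y)^*) ((f y)^*) ((F y)^*) => s s0 a b c.
by field.
Unshelve. all: by end_near. Qed.

Lemma scal_arith (b' b0 : R) (x y : C) : 0 < b0 ->
  (b' / b0)%:C%C * (b0%:C%C * x) + - 2^-1 * (b0%:C%C * y) =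
  b'%:C%C * x + b0%:C%C * (- 2^-1 * y).
Proof.
move=> b00; congr (_ + _); last by rewrite mulrCA.
by rewrite mulrA -rmorphM /= divfK // gt_eqF.
Qed.

Lemma half_sq_le (t r : R) : 0 < r -> `|t| < r / 2 -> 2 * t ^+ 2 <= r ^+ 2.
Proof.
move=> r0 tr; have r20 : 0 <= r / 2 by apply: divr_ge0 => //; exact: ltW.
have : `|t| ^+ 2 <= (r / 2) ^+ 2.
  by apply: lerXn2r; rewrite ?nnegrE; [exact: normr_ge0|exact: r20|exact: ltW].
rewrite real_normK ?num_real // exprMn => h.
have := sqr_ge0 r; have e : (2^-1 : R) ^+ 2 = 4^-1 by rewrite exprVn -natrX.
rewrite e in h; lra.
Qed.

End L2Small.

(** * Derivative of the projection and evaluation of [h] *)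

Section ProjectionDerivative.
Variables (R : realType) (N : nat).
Local Notation C := R[i].
Implicit Types (n : occ N) (Z X Y : 'M[C]_N).

Lemma sqrtC_real (x : R) : 0 <= x -> sqrtC (x%:C%C : C) = (Num.sqrt x)%:C%C.
Proof.
move=> x0; rewrite -{1}(sqr_sqrtr x0) rmorphXn /= sqrCK // ler0c.
exact: sqrtr_ge0.
Qed.

Definition rdet Z : R := complex.Re (\det (1%:M - Z *m adjmx Z)).

(** The determinant is real, so where it is nonnegative its complex fourth root is a real one, to
    which the real chain rule applies. *)
Lemma psi_factor Z : 0 <= rdet Z -> psi Z =
  fun n => (Num.sqrt (Num.sqrt (rdet Z)))%:C%C * squeeze_coef Z n.
Proof.
move=> d0; apply: funext => n; rewrite /psi.
have -> : \det (1%:M - Z *m adjmx Z) = (rdet Z)%:C%C.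
  by apply: complex_ext => //=; rewrite im_det.
by rewrite !sqrtC_real // sqrtr_ge0.
Qed.

Lemma rdet_gt0 Z : inM Z -> 0 < rdet Z.
Proof. by move=> /inM_det_gt0; rewrite ltcE => /andP[]. Qed.

Lemma psi_tempered Z : inM Z -> tempered (psi Z).
Proof. by move=> hZ; apply: temperedZ; exact: squeeze_tempered. Qed.

Lemma tempered_quadop Y f : tempered f -> tempered (quadop Y f).
Proof. by move=> tf; apply: tempered_sum => p; do 2 apply: tempered_cre. Qed.

Lemma near_inM Z X : inM Z -> X^T = X ->
  \forall t \near (0 : R)^', inM (Z + t%:C%C *: X).
Proof.
move=> hZ sX; have [r r0 [m m0 h]] := inM_line hZ sX.
near=> t; apply: (h _ _).1; rewrite normc_def /= expr0n addr0 sqrtr_sqr lecR.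
near: t; apply: nbhs_dnbhs; exists r => //= t.
by rewrite /= sub0r normrN => /ltW.
Unshelve. all: by end_near. Qed.

Lemma psi_l2diff Z X : inM Z -> X^T = X -> exists c : C,
  l2small (fun t n => (psi (Z + t%:C%C *: X) n - psi Z n) / t%:C%C
    - (c * psi Z n + - 2^-1 * quadop X (psi Z) n)).
Proof.
move=> hZ sX.
pose b (t : R) := Num.sqrt (Num.sqrt (rdet (Z + t%:C%C *: X))).
have d0 := rdet_gt0 hZ.
have b00 : b 0 = Num.sqrt (Num.sqrt (rdet Z)) by rewrite /b scale0r addr0.
have [b' db] : exists b', is_derive (0 : R) (1 : R) b b'.
  have [dd _] := cderiv_det (mxderiv_ZZ Z X).
  have e0 : rdet (Z + (0 : R)%:C%C *: X) = rdet Z by rewrite scale0r addr0.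
  have s1 : is_derive (rdet (Z + (0 : R)%:C%C *: X)) 1 (@Num.sqrt R) (2 * Num.sqrt (rdet Z))^-1.
    by rewrite e0; exact: is_derive1_sqrt.
  have d1 := @is_derive1_comp _ (@Num.sqrt R) (fun t : R => rdet (Z + t%:C%C *: X)) 0 _ _ s1 dd.
  have s2 : is_derive (Num.sqrt (rdet (Z + (0 : R)%:C%C *: X))) 1 (@Num.sqrt R)
      (2 * Num.sqrt (Num.sqrt (rdet Z)))^-1.
    by rewrite e0; apply: is_derive1_sqrt; rewrite sqrtr_gt0.
  eexists; exact: (@is_derive1_comp _ (@Num.sqrt R) _ 0 _ _ s2 d1).
have bpos : 0 < b 0 by rewrite b00 !sqrtr_gt0.
pose phi' n : C := - 2^-1 * quadop X (squeeze_coef Z) n.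
have tphi := squeeze_tempered hZ.
have tphi' : tempered phi' by apply: temperedZ; exact: tempered_quadop.
have [r r0 [B B0 hB]] := phi_diff hZ sX.
have sphi : l2small (fun t n => (squeeze_coef (Z + t%:C%C *: X) n - squeeze_coef Z n) / t%:C%C - phi' n).
  exists (fun t => t ^+ 2 * B).
    apply: cvg_mulr0; rewrite -[X in _ --> X](mulr0 0); apply: cvgM; exact: cvg_within.
  near=> t; apply: hB.
    by near: t; exact: near0_neq.
  near: t; apply: nbhs_dnbhs; exists (r / 2); first by rewrite /= divr_gt0.
  move=> t /=; rewrite sub0r normrN => tr.
  exact: half_sq_le.
exists ((b' / b 0)%:C%C).
have eZ : psi Z = fun n => (b 0)%:C%C * squeeze_coef Z n.
  by rewrite b00; exact: psi_factor (ltW d0).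
have hU : \forall t \near (0 : R)^',
    psi (Z + t%:C%C *: X) = fun n => (b t)%:C%C * squeeze_coef (Z + t%:C%C *: X) n.
  near=> t; have hW : inM (Z + t%:C%C *: X) by near: t; exact: near_inM.
  exact: psi_factor (ltW (rdet_gt0 hW)).
have hF' : (fun n => (b' / b 0)%:C%C * psi Z n + - 2^-1 * quadop X (psi Z) n) =
    (fun n => b'%:C%C * squeeze_coef Z n + (b 0)%:C%C * phi' n).
  apply: funext => n; rewrite eZ quadopZ /phi'.
  exact: scal_arith.
have res := (@l2small_product _ _ b b' (fun t => squeeze_coef (Z + t%:C%C *: X)) (squeeze_coef Z)
  phi' (psi Z) _ (fun t => psi (Z + t%:C%C *: X)) db (tempered_l2 tphi)
  (tempered_l2 tphi') sphi hU eZ hF').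
exact: res.
Unshelve. all: by end_near. Qed.

(* [c] is the logarithmic derivative of the normalization, which [1 - P] projects out. *)
Definition dpsi Z X c n : C := c * psi Z n + - 2^-1 * quadop X (psi Z) n.

Definition dPker Z (F : occ N -> C) (p : occ N * occ N) : C :=
  F p.1 * (psi Z p.2)^* + psi Z p.1 * (F p.2)^*.

Lemma tempered_dpsi Z X c : inM Z -> tempered (dpsi Z X c).
Proof.
move=> hZ; have tp := psi_tempered hZ.
by apply: temperedD; apply: temperedZ => //; exact: tempered_quadop.
Qed.

Lemma dP_exists Z X : inM Z -> X^T = X -> exists c, is_dP Z X (dPker Z (dpsi Z X c)).
Proof.
move=> hZ sX; have [c hc] := psi_l2diff hZ sX; exists c.
have hK : \forall t \near (0 : R)^', (l2sq (psi (Z + t%:C%C *: X)) <= 1%:E)%E.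
  by apply: filterS (near_inM hZ sX) => t hW; rewrite psi_norm.
have := l2small_tensor hc (tempered_l2 (psi_tempered hZ)) (tempered_l2 (tempered_dpsi X c hZ)) hK.
exact: l2small_cvg.
Qed.

(** Convergence in l^2 controls each coefficient; errors below [e / 8] give the contradiction
    [e <= 2 (e / 8 + e / 8) = e / 2]. Uniqueness lets [h] be computed on one explicit derivative. *)
Lemma cvg_l2sq_uniq (T : choiceType) (a : R -> T -> C) (D D' : T -> C) :
  (fun t => l2sq (fun x => a t x - D x)) @ (0 : R)^' --> 0%E ->
  (fun t => l2sq (fun x => a t x - D' x)) @ (0 : R)^' --> 0%E -> D = D'.
Proof.
move=> h h'; apply: funext => x; apply/eqP; rewrite -subr_eq0.
suff : normR (D x - D' x) ^+ 2 <= 0.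
  move=> n0; have {}n0 : normR (D x - D' x) ^+ 2 = 0.
    by apply/eqP; rewrite eq_le n0 sqr_ge0.
  by move/eqP: n0; rewrite sqrf_eq0 => /eqP n0; rewrite -normr_eq0 -normR_C n0.
rewrite leNgt; apply/negP; set e := _ ^+ 2 => e0.
have e8 : (0 < (e / 8)%:E)%E by rewrite lte_fin divr_gt0.
have [t [h1 h2]] : exists t, (l2sq (fun x => a t x - D x)%R < (e / 8)%:E)%E /\
    (l2sq (fun x => a t x - D' x)%R < (e / 8)%:E)%E.
  apply: (@filter_ex _ ((0 : R)^')); near=> t; split; near: t.
    exact: h (open_ereal_lt' e8).
  exact: h' (open_ereal_lt' e8).
have l1 := le_lt_trans (l2sq_ge _ x) h1; have l2 := le_lt_trans (l2sq_ge _ x) h2.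
rewrite !lte_fin in l1 l2.
have : e <= 2 * (normR (- (a t x - D x)) ^+ 2 + normR (a t x - D' x) ^+ 2).
  apply: le_trans (normRD_sq _ _); rewrite /e le_eqVlt; apply/orP; left; apply/eqP.
  by congr (normR _ ^+ 2); ring.
rewrite normRN; move: l1 l2 e0; move: (normR _ ^+ 2) (normR _ ^+ 2) e {e8 h1 h2} => u v e.
lra.
Unshelve. all: by end_near. Qed.

Lemma is_dP_uniq Z X D D' : is_dP Z X D -> is_dP Z X D' -> D = D'.
Proof. exact: cvg_l2sq_uniq. Qed.

Lemma psi_ip1 Z : inM Z -> ip (psi Z) (psi Z) = 1.
Proof. by move=> hZ; rewrite /ip csum_normR psi_norm. Qed.

(** [1 - P] kills the summand [|psi><F|] and projects [F] in [|F><psi|]. *)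
Lemma Aconn_dPker Z F : inM Z -> tempered F ->
  Aconn Z (dPker Z F) = fun p => (F p.1 - ip F (psi Z) * psi Z p.1) * (psi Z p.2)^*.
Proof.
move=> hZ tF; have tp := psi_tempered hZ; apply: funext => -[n m]; rewrite /Aconn /dPker /Pker /=.
have -> : csum (fun k => psi Z n * (psi Z k)^* * (F k * (psi Z m)^* + psi Z k * (F m)^*)) =
    (psi Z n * (psi Z m)^*) * ip F (psi Z) + (psi Z n * (F m)^*) * ip (psi Z) (psi Z).
  have s1 := ip_sum tF tp; have s2 := ip_sum tp tp.
  rewrite /ip -!csumZ // -csumD; [|exact: csummableZ..].
  by apply: eq_csum => k; ring.
rewrite psi_ip1 //; ring.
Qed.

Lemma hP_dPker Z F G : inM Z -> tempered F -> tempered G ->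
  hP Z (dPker Z F) (dPker Z G) =
  2 * ip (fun n => F n - ip F (psi Z) * psi Z n) (fun n => G n - ip G (psi Z) * psi Z n).
Proof.
move=> hZ tF tG; have tp := psi_tempered hZ.
have tproj H : tempered H -> tempered (fun n => H n - ip H (psi Z) * psi Z n).
  move=> tH; rewrite (_ : (fun n => _) = fun n => H n + - ip H (psi Z) * psi Z n).
    by apply: temperedD => //; exact: temperedZ.
  by apply: funext => n; rewrite mulNr.
rewrite /hP !Aconn_dPker //; congr (2 * _).
have := csum_prod (ip_sum (tproj F tF) (tproj G tG))
  (fun n => sqr_ge0 (normR (psi Z n))) (tempered_l2 tp).
rewrite (_ : fine _ = 1); last by have := psi_norm hZ; rewrite /l2sq => ->.
rewrite mulr1 => hp; apply: etrans hp; apply: eq_csum => -[n m] /=.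
move: (ip F _) (ip G _) => u v; move: (F n - _) (G n - _) (psi Z m) => a b c.
by rewrite normR_sqC rmorphM /= conjCK; ring.
Qed.

(** Up to a multiple of [psi], the derivative is [- 1/2 (b^*, T b^* ) psi], which is orthogonal to
    [psi]; so exactly this vector survives the projection. *)
Lemma dpsi_projected Z X c : inM Z -> X^T = X ->
  (fun n => dpsi Z X c n - ip (dpsi Z X c) (psi Z) * psi Z n) =
  (fun n => - 2^-1 * pairop Z (psi Z) (invmx (1%:M - Z *m adjmx Z) *m X *m
      invmx (1%:M - adjmx Z *m Z)) n).
Proof.
move=> hZ sX; have tp := psi_tempered hZ.
set T := _ *m _ *m _.
have bp q : bop Z q (psi Z) = fun=> 0.
  by apply: funext => n; rewrite /bop psi_ann.
have eT : (1%:M - Z *m adjmx Z) *m T *m (1%:M - adjmx Z *m Z) = X.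
  rewrite /T !mulmxA (mulmxV (inM_unit hZ)) mul1mx.
  by rewrite -mulmxA (mulVmx (inM_unit' hZ)) mulmx1.
have [d hd] := pairop_quadop hZ.1 bp eT.
have e : dpsi Z X c = fun n => (c + 2^-1 * d) * psi Z n + - 2^-1 * pairop Z (psi Z) T n.
  by apply: funext => n; rewrite /dpsi hd; ring.
have tP := tempered_pairop Z tp T.
have -> : ip (dpsi Z X c) (psi Z) = c + 2^-1 * d.
  rewrite e (ipDl (temperedZ _ tp) (temperedZ _ tP) tp) (ipZl _ tp tp) (ipZl _ tP tp).
  by rewrite psi_ip1 // (ip_pairop_vac tp bp) mulr0 addr0 mulr1.
by apply: funext => n; rewrite e; ring.
Qed.

Lemma hP_hform Z X Y DX DY : inM Z -> X^T = X -> Y^T = Y ->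
  is_dP Z X DX -> is_dP Z Y DY -> hP Z DX DY = hform Z X Y.
Proof.
move=> hZ sX sY dX dY; have tp := psi_tempered hZ.
have [c hc] := dP_exists hZ sX; have [d hd] := dP_exists hZ sY.
rewrite (is_dP_uniq dX hc) (is_dP_uniq dY hd).
rewrite (hP_dPker hZ (tempered_dpsi X c hZ) (tempered_dpsi Y d hZ)).
rewrite (dpsi_projected c hZ sX) (dpsi_projected d hZ sY).
set T := _ *m _ *m _; set T' := _ *m _ *m _.
have bp q : bop Z q (psi Z) = fun=> 0.
  by apply: funext => n; rewrite /bop psi_ann.
have tP := tempered_pairop Z tp T; have tP' := tempered_pairop Z tp T'.
rewrite (ipZl _ tP (temperedZ _ tP')) (ipZr _ tP tP').
have eT : (1%:M - Z *m adjmx Z) *m T *m (1%:M - Z *m adjmx Z)^T = X.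
  rewrite (tr_sym_ZZ hZ.1) /T !mulmxA (mulmxV (inM_unit hZ)) mul1mx.
  by rewrite -mulmxA (mulVmx (inM_unit' hZ)) mulmx1.
rewrite (ip_pairop tp (psi_ip1 hZ) bp T' eT sX).
have -> : \tr (X *m adjmx T') = hform Z X Y.
  rewrite /hform /T' !adjmxM !adjmxV herm_ZZ.
  have -> : adjmx (1%:M - adjmx Z *m Z) = 1%:M - adjmx Z *m Z.
    by rewrite adjmxB adjmx1 adjmxM adjmxK.
  move: (invmx _) (invmx _) (adjmx Y) => A B D.
  by rewrite !mulmxA mxtrace_mulC !mulmxA.
have -> : ((- 2^-1)^* : C) = - 2^-1.
  by rewrite rmorphN fmorphV rmorph_nat.
(* The constants combine to [2 (1/2)^2 2 = 1]: from [h], from the two derivatives, and from the two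
   pairings. *)
by field.
Qed.

End ProjectionDerivative.

Theorem mainTheorem10 (R : realType) (N : nat) :
  forall Z : 'M[R[i]]_N, inM Z ->
  (* psi_Z is a normalized vector annihilated by a_i + sum_j Z_ij a_j^* *)
  [/\ l2sq (psi Z) = 1%E,
      (forall (i : 'I_N) (n : occ N),
         ann i (psi Z) n + \sum_j Z i j * cre j (psi Z) n = 0),
  (* Z |-> P_Z is differentiable, and h = 2 tr(A A^* ) equals the explicit formula *)
      (forall X : 'M[R[i]]_N, symm X -> exists D, is_dP Z X D),
      (forall (X Y : 'M[R[i]]_N) DX DY, symm X -> symm Y ->
         is_dP Z X DX -> is_dP Z Y DY -> hP Z DX DY = hform Z X Y) &
  (* h = - d (x) dbar tr log(1 - Z Z^* ) *)
      (forall X Y : 'M[R[i]]_N, symm X -> symm Y ->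
         hform Z X Y = - ddbar (@potential R N) Z X Y)] /\
  (* Kahler: h Hermitian for the complex structure X |-> iX, g positive definite,
     omega closed *)
  [/\ (forall X Y : 'M[R[i]]_N, symm X -> symm Y ->
         hform Z ('i%C *: X) Y = 'i%C * hform Z X Y /\
         hform Z Y X = (hform Z X Y)^*),
      (forall X : 'M[R[i]]_N, symm X -> X != 0 -> 0 < gform Z X X) &
      (forall X Y W : 'M[R[i]]_N, symm X -> symm Y -> symm W ->
         [/\ derivable (fun t : R => omegaform (Z + (t%:C)%C *: X) Y W) 0 1,
             derivable (fun t : R => omegaform (Z + (t%:C)%C *: Y) X W) 0 1,
             derivable (fun t : R => omegaform (Z + (t%:C)%C *: W) X Y) 0 1 &
             derive1 (fun t : R => omegaform (Z + (t%:C)%C *: X) Y W) 0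
           - derive1 (fun t : R => omegaform (Z + (t%:C)%C *: Y) X W) 0
           + derive1 (fun t : R => omegaform (Z + (t%:C)%C *: W) X Y) 0 = 0])] /\
  (* the U-form *)
  [/\ (exists U : 'M[R[i]]_N, U *m adjmx U = invmx (1%:M - Z *m adjmx Z)),
      (forall U V : 'M[R[i]]_N,
         U *m adjmx U = invmx (1%:M - Z *m adjmx Z) ->
         V *m adjmx V = invmx (1%:M - Z *m adjmx Z) ->
         exists W : 'M[R[i]]_N, W *m adjmx W = 1%:M /\ V = U *m W) &
      (forall U : 'M[R[i]]_N, U *m adjmx U = invmx (1%:M - Z *m adjmx Z) ->
       forall X Y : 'M[R[i]]_N, symm X -> symm Y ->
         hform Z X Y = \tr ((adjmx U *m X *m mxconj U)
                              *m adjmx (adjmx U *m Y *m mxconj U)))].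
Proof.
move=> Z hZ; split; last split; split.
exact: psi_norm.
by move=> i n; exact: psi_ann.
by move=> X sX; have [c hc] := dP_exists hZ sX; eexists; exact: hc.
by move=> X Y DX DY; exact: hP_hform.
by move=> X Y _ _; exact: hform_ddbar.
by move=> X Y _ _; split; [exact: hformZl | exact: hform_herm].
by move=> X _; exact: gform_gt0.
by move=> X Y W _ _ _; exact: omega_closed.
exact: exists_U.
by move=> U V; exact: U_unique.
by move=> U hU X Y _ _; exact: hform_U.
Qed.
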